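(* Let $X_0$ be a complex Banach space, let $\theta\in[0,\pi)$ and let $A\in\mathcal{S}(\theta)$ be a sectorial operator in $X_0$ such that $A+c_0\in\mathcal{R}(\theta)$ for a certain $c_0\ge 0$. Then for each $\sigma\in(0,1)$ there exists a $c\ge 0$ such that $A^{\sigma}+c\in\mathcal{R}(\pi-(\pi-\theta)\sigma)$; in particular, one can choose $c=0$ when $c_0=0$.
   Context: For $\theta\in[0,\pi)$ let $S_\theta=\{\lambda\in\mathbb{C}\,|\,|\arg(\lambda)|\le\theta\}\cup\{0\}$. $\mathcal{S}(\theta)$ (sectorial operators of angle $\theta$) is the class of all closed densely defined linear operators $A:\mathcal{D}(A)\to X_0$ in $X_0$ such that $S_\theta\setminus\{0\}\subset\rho(-A)$ and, for some $K\ge1$, $|\lambda|\,\|(A+\lambda)^{-1}\|_{\mathcal{L}(X_0)}\le K$ for all $\lambda\in S_\theta\setminus\{0\}$. ($A$ need not be invertible.) A set $E\subset\mathcal{L}(X_0)$ is $R$-bounded if there is $C>0$ such that for all $N\in\mathbb{N}$, $T_1,\dots,T_N\in E$, $x_1,\dots,x_N\in X_0$ we have $\|\sum_{k=1}^N\epsilon_kT_kx_k\|_{L^2(0,1;X_0)}\le C\|\sum_{k=1}^N\epsilon_kx_k\|_{L^2(0,1;X_0)}$, where $\{\epsilon_k\}_{k\in\mathbb{N}}$ is the sequence of Rademacher functions. $\mathcal{R}(\theta)$ ($R$-sectorial operators of angle $\theta$) is the class of all $A\in\mathcal{S}(\theta)$ such that the set $\{\lambda(A+\lambda)^{-1}\,|\,\lambda\in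 S_\theta\setminus\{0\}\}$ is $R$-bounded. Fractional powers: for $A\in\mathcal{S}(\theta)$ and $\sigma\in(0,1)$, $A^\sigma$ denotes the unique closed linear operator in $X_0$ such that, for all $\lambda\neq0$ with $|\arg\lambda|<\pi(1-\sigma)$, $$(A^{\sigma}+\lambda)^{-1}=\frac{\sin(\pi\sigma)}{\pi}\int_0^\infty\frac{s^\sigma}{(s^\sigma+\lambda e^{i\pi\sigma})(s^\sigma+\lambda e^{-i\pi\sigma})}(A+s)^{-1}ds.$$ It satisfies $\mathcal{D}(A^\sigma)=\mathcal{D}((A+c)^\sigma)$ for every $c>0$, where $\mathcal{D}((A+c)^\sigma)$ is the range of $(A+c)^{-\sigma}=\frac{\sin(\pi\sigma)}{\pi}\int_0^\infty s^{-\sigma}(A+c+s)^{-1}ds\in\mathcal{L}(X_0)$. *)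

(* Defs.v *)
From Stdlib Require Import Reals.
From Coquelicot Require Import Coquelicot.

Open Scope R_scope.

(* A complex Banach space is a [CompleteNormedModule C_AbsRing].  Riemann
   integrals in Coquelicot take values in real normed modules, so the real
   Banach space underlying a complex one is needed: same carrier, same norm,
   same uniform structure, scalars acting through [RtoC]. *)
Section RestrictScalars.

Variable X : NormedModule C_AbsRing.

Definition restr_scal (r : R) (x : X) : X := scal (RtoC r) x.

Lemma restr_scal_assoc (a b : R) (x : X) :
  restr_scal a (restr_scal b x) = restr_scal (mult a b) x.
Proof.
unfold restr_scal; rewrite scal_assoc; f_equal.
exact (eq_sym (RtoC_mult a b)).
Qed.

Lemma restr_scal_one (x : X) : restr_scal one x = x.
Proof. exact (scal_one x). Qed.

Lemma restr_scal_distr_l (a : R) (x y : X) :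
  restr_scal a (plus x y) = plus (restr_scal a x) (restr_scal a y).
Proof. exact (scal_distr_l (RtoC a) x y). Qed.

Lemma restr_scal_distr_r (a b : R) (x : X) :
  restr_scal (plus a b) x = plus (restr_scal a x) (restr_scal b x).
Proof.
unfold restr_scal.
etransitivity; [|exact (scal_distr_r (RtoC a) (RtoC b) x)].
f_equal; exact (RtoC_plus a b).
Qed.

Definition restr_ModuleSpace_mixin :
  ModuleSpace.mixin_of R_Ring (NormedModule.AbelianGroup C_AbsRing X) :=
  ModuleSpace.Mixin R_Ring (NormedModule.AbelianGroup C_AbsRing X) restr_scal
    restr_scal_assoc restr_scal_one restr_scal_distr_l restr_scal_distr_r.

Definition restr_NormedModuleAux : NormedModuleAux R_AbsRing :=
  NormedModuleAux.Pack R_AbsRing X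
    (NormedModuleAux.Class R_AbsRing X
      (ModuleSpace.Class R_Ring X
        (AbelianGroup.class (NormedModule.AbelianGroup C_AbsRing X))
        restr_ModuleSpace_mixin)
      (UniformSpace.class (NormedModule.UniformSpace C_AbsRing X)))
    X.

Lemma restr_norm_scal (r : R) (x : X) :
  norm (restr_scal r x) <= Rabs r * norm x.
Proof.
rewrite <- Cmod_R.
exact (norm_scal (RtoC r) x).
Qed.

Definition restr_NormedModule_mixin :
  NormedModule.mixin_of R_AbsRing restr_NormedModuleAux :=
  NormedModule.Mixin R_AbsRing restr_NormedModuleAux
    (@norm C_AbsRing X) (@norm_factor C_AbsRing X)
    (@norm_triangle C_AbsRing X) restr_norm_scal
    (@norm_compat1 C_AbsRing X) (@norm_compat2 C_AbsRing X)
    (@norm_eq_zero C_AbsRing X).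

Definition restr_NormedModule : NormedModule R_AbsRing :=
  NormedModule.Pack R_AbsRing X
    (NormedModule.Class R_AbsRing X
      (NormedModuleAux.class R_AbsRing restr_NormedModuleAux)
      restr_NormedModule_mixin)
    X.

End RestrictScalars.

(* Principal argument, with values in (-PI, PI]; the value at 0 is
   meaningless and never used. *)
Definition Carg (z : C) : R :=
  if Rle_dec 0 (Im z) then acos (Re z / Cmod z) else - acos (Re z / Cmod z).

Definition sector (theta : R) (z : C) : Prop :=
  (z <> RtoC 0 /\ Rabs (Carg z) <= theta) \/ z = RtoC 0.

Definition Cexp_i (t : R) : C := (cos t, sin t).

(* Values of [app] outside [dom] are irrelevant: every notion below only
   looks at [app x] for [x] in [dom]. *)
Record lin_op (X : NormedModule C_AbsRing) := Lin_op {
  dom : X -> Prop;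
  app : X -> X;
  dom_zero : dom zero;
  dom_plus : forall x y, dom x -> dom y -> dom (plus x y);
  dom_scal : forall (l : C) x, dom x -> dom (scal l x);
  app_plus : forall x y, dom x -> dom y ->
    app (plus x y) = plus (app x) (app y);
  app_scal : forall (l : C) x, dom x -> app (scal l x) = scal l (app x)
}.

Arguments Lin_op {X} _ _ _ _ _ _ _.
Arguments dom {X} _ _.
Arguments app {X} _ _.
Arguments dom_zero {X} _.
Arguments dom_plus {X} _ _ _ _ _.
Arguments dom_scal {X} _ _ _ _.
Arguments app_plus {X} _ _ _ _ _.
Arguments app_scal {X} _ _ _ _.

Section Operators.

Variable X : NormedModule C_AbsRing.

Lemma op_opp_plus (A : lin_op X) (x y : X) : dom A x -> dom A y ->
  opp (app A (plus x y)) = plus (opp (app A x)) (opp (app A y)).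
Proof.
intros Hx Hy; rewrite (app_plus A x y Hx Hy); exact (opp_plus _ _).
Qed.

Lemma op_opp_scal (A : lin_op X) (l : C) (x : X) : dom A x ->
  opp (app A (scal l x)) = scal l (opp (app A x)).
Proof.
intros Hx; rewrite (app_scal A l x Hx); exact (eq_sym (scal_opp_r l _)).
Qed.

Definition op_opp (A : lin_op X) : lin_op X :=
  Lin_op (dom A) (fun x => opp (app A x))
    (dom_zero A) (dom_plus A) (dom_scal A) (op_opp_plus A) (op_opp_scal A).

Lemma op_shift_plus (A : lin_op X) (mu : C) (x y : X) : dom A x -> dom A y ->
  plus (app A (plus x y)) (scal mu (plus x y)) =
  plus (plus (app A x) (scal mu x)) (plus (app A y) (scal mu y)).
Proof.
intros Hx Hy; rewrite (app_plus A x y Hx Hy).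
replace (scal mu (plus x y)) with (plus (scal mu x) (scal mu y))
  by exact (eq_sym (scal_distr_l mu x y)).
rewrite <- !plus_assoc; f_equal.
rewrite !plus_assoc; f_equal; apply plus_comm.
Qed.

Lemma op_shift_scal (A : lin_op X) (mu l : C) (x : X) : dom A x ->
  plus (app A (scal l x)) (scal mu (scal l x)) =
  scal l (plus (app A x) (scal mu x)).
Proof.
intros Hx; rewrite (app_scal A l x Hx).
etransitivity; [|exact (eq_sym (scal_distr_l l (app A x) (scal mu x)))].
f_equal; etransitivity; [exact (scal_assoc mu l x)|].
etransitivity; [|exact (eq_sym (scal_assoc l mu x))].
f_equal; exact (Cmult_comm mu l).
Qed.

(* A + mu *)
Definition op_shift (A : lin_op X) (mu : C) : lin_op X :=
  Lin_op (dom A) (fun x => plus (app A x) (scal mu x))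
    (dom_zero A) (dom_plus A) (dom_scal A)
    (op_shift_plus A mu) (op_shift_scal A mu).

Definition closed_op (A : lin_op X) : Prop :=
  closed (fun p : X * X => dom A (fst p) /\ snd p = app A (fst p)).

Definition densely_defined (A : lin_op X) : Prop :=
  forall (x : X) (eps : posreal),
    exists y : X, dom A y /\ norm (minus y x) < eps.

(* Meaningful for bounded linear [T] only. *)
Definition op_norm (T : X -> X) : R :=
  real (Lub_Rbar (fun r => exists x : X, norm x <= 1 /\ r = norm (T x))).

End Operators.

Arguments op_opp {X} _.
Arguments op_shift {X} _ _.
Arguments closed_op {X} _.
Arguments densely_defined {X} _.
Arguments op_norm {X} _.

Section Sectorial.

Variable X : CompleteNormedModule C_AbsRing.

Definition op_bijective (A : lin_op X) : Prop :=
  forall y : X, exists! x : X, dom A x /\ app A x = y.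

(* Meaningful when [op_bijective A] only. *)
Definition op_inv (A : lin_op X) (y : X) : X :=
  iota (fun x : X => dom A x /\ app A x = y).

(* lambda is in rho(B): lambda - B is a bijection of its domain onto X with
   bounded inverse. *)
Definition resolvent_set (B : lin_op X) (lambda : C) : Prop :=
  op_bijective (op_shift (op_opp B) lambda) /\
  is_linear (op_inv (op_shift (op_opp B) lambda)).

Definition sectorial (theta : R) (A : lin_op X) : Prop :=
  closed_op A /\ densely_defined A /\
  (forall lambda : C, sector theta lambda -> lambda <> RtoC 0 ->
     resolvent_set (op_opp A) lambda) /\
  exists K : R, 1 <= K /\
    forall lambda : C, sector theta lambda -> lambda <> RtoC 0 ->
      Cmod lambda * op_norm (op_inv (op_shift A lambda)) <= K.

(* Used for k >= 1. *)
Definition rademacher (k : nat) (t : R) : R := sign (sin (2 ^ k * PI * t)).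

(* The L^2(0,1;X)-norm; it is only applied to step functions, for which the
   Riemann integral is the Lebesgue one. *)
Definition L2_norm (f : R -> X) : R :=
  sqrt (RInt (fun t => norm (f t) ^ 2) 0 1).

Definition R_bounded (E : (X -> X) -> Prop) : Prop :=
  (forall T, E T -> is_linear T) /\
  exists K : R, 0 < K /\
    forall (N : nat) (T : nat -> X -> X) (x : nat -> X),
      (forall k, (1 <= k <= N)%nat -> E (T k)) ->
      L2_norm (fun t =>
        sum_n_m (fun k => scal (RtoC (rademacher k t)) (T k (x k))) 1 N)
      <= K * L2_norm (fun t =>
        sum_n_m (fun k => scal (RtoC (rademacher k t)) (x k)) 1 N).

Definition R_sectorial (theta : R) (A : lin_op X) : Prop :=
  sectorial theta A /\
  R_bounded (fun T => exists lambda : C,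
    sector theta lambda /\ lambda <> RtoC 0 /\
    T = (fun x => scal lambda (op_inv (op_shift A lambda) x))).

Definition frac_kernel (sigma : R) (lambda : C) (s : R) : C :=
  (RtoC (Rpower s sigma) /
   ((RtoC (Rpower s sigma) + lambda * Cexp_i (PI * sigma)) *
    (RtoC (Rpower s sigma) + lambda * Cexp_i (- (PI * sigma)))))%C.

(* [As] is the fractional power A^sigma.  The identity between bounded
   operators is stated at every vector, the integral over (0, oo) being an
   improper Riemann integral in X. *)
Definition is_frac_power (A : lin_op X) (sigma : R) (As : lin_op X) : Prop :=
  closed_op As /\
  forall lambda : C, lambda <> RtoC 0 ->
    Rabs (Carg lambda) < PI * (1 - sigma) ->
    resolvent_set (op_opp As) lambda /\
    forall x : X, exists I : X,
      is_RInt_gen (V := restr_NormedModule X)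
        (fun s => scal (frac_kernel sigma lambda s)
                       (op_inv (op_shift A (RtoC s)) x))
        (at_right 0) (Rbar_locally p_infty) I /\
      op_inv (op_shift As lambda) x =
        scal (RtoC (sin (PI * sigma) / PI)) I.

End Sectorial.

Arguments op_bijective {X} _.
Arguments op_inv {X} _ _.
Arguments resolvent_set {X} _ _.
Arguments sectorial {X} _ _.
Arguments L2_norm {X} _.
Arguments R_bounded {X} _.
Arguments R_sectorial {X} _ _.
Arguments is_frac_power {X} _ _ _.

(* Main.v *)
Require Import Defs.
From Stdlib Require Import Reals Lra Lia Psatz.
From Stdlib Require List.
From Coquelicot Require Import Coquelicot.

(** By a Neumann series the resolvents of [A] and the [R]-bound for [A + c0]
    extend to a slightly larger sector of angle [phi0 > theta].  Substituting in
    the definition of [A^sigma] gives, for [r > 0] and [|arg l| < pi (1 - sigma)],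
    with [k_l] the kernel of that definition,
      [l r^sigma (A^sigma + l r^sigma)^-1
         = sin(pi sigma) / pi * int_0^oo l k_l(s) H(s r) ds / s],
    where [H(w) = w (A + w)^-1].  The right-hand side makes sense with [r]
    replaced by [z = r e^(i phi)], [|phi| <= phi0], and depends analytically on
    [z]; by the identity theorem it is the resolvent of [A^sigma] at the point
    [- l z^sigma], and these points cover a sector larger than the required one,
    with [arg l] staying away from the singular angle [pi (1 - sigma)].
    The change of variables removes [|l|] from the kernel, which is then
    dominated by one integrable function, so that the [R]-bound of [H] passes
    through the integral.  If [c0 <> 0], [(A + w)^-1] is replaced by
    [(A + c0 + w)^-1]; with finitely many rays [arg z] the difference involves
    finitely many operators for each [s], and the kernels with [|l| >= 1] have a
    common integrable bound, which makes the difference [R]-bounded as well. *)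

Open Scope R_scope.

(** * Complex vector spaces *)

(** [A^sigma] is given only through its resolvents for [|arg l| < pi (1 - sigma)], so what the
    continuation produces must be recognised as a resolvent. Applying the unbounded [A^sigma] to it
    is not an analytic operation; instead the resolvent identity with the fixed operator
    [(A^sigma + 1)^-1] is tested, an equation between bounded operators. It yields the right
    inverse; the left inverse comes from commutation with that operator. Analyticity is used in an
    elementary form: expansions in [d], where the moving point is [1 + d] times a fixed one, with
    geometric bounds on all remainders. Their radius does not depend on the point, so finitely many
    steps cover the sector. A Rademacher average of [n] vectors is, up to the factor [2 ^ (n/2)],
    the norm of a single vector in a product of [2 ^ n] copies of the space; bringing an [R]-bound
    through an integral is then the usual norm estimate of an integral. The shift [c] serves to keep
    [|l + c| >= 1] on the sector, where [A] and [A + c0] can be compared. *)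

Lemma plus_perm4 {G : AbelianMonoid} (a b c d : G) :
  plus (plus a b) (plus c d) = plus (plus a c) (plus b d).
Proof.
rewrite <- !plus_assoc; f_equal; rewrite !plus_assoc; f_equal; apply plus_comm.
Qed.

Section ModuleReflection.

Variable X : NormedModule C_AbsRing.

Inductive mexpr : Type :=
| MVar (n : nat)
| MZero
| MPlus (e f : mexpr)
| MOpp (e : mexpr)
| MScal (c : C) (e : mexpr).

Fixpoint meval (env : list X) (e : mexpr) : X :=
  match e with
  | MVar n => List.nth n env zero
  | MZero => zero
  | MPlus e f => plus (meval env e) (meval env f)
  | MOpp e => opp (meval env e)
  | MScal c e => scal c (meval env e)
  end.

Fixpoint mcoef (e : mexpr) (k : nat) : C :=
  match e with
  | MVar n => if Nat.eqb n k then RtoC 1 else RtoC 0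
  | MZero => RtoC 0
  | MPlus e f => Cplus (mcoef e k) (mcoef f k)
  | MOpp e => Copp (mcoef e k)
  | MScal c e => Cmult c (mcoef e k)
  end.

Fixpoint msum (env : list X) (c : nat -> C) : X :=
  match env with
  | nil => zero
  | cons x env => plus (scal (c 0%nat) x) (msum env (fun k => c (S k)))
  end.

Lemma msum_zero (env : list X) (c : nat -> C) :
  (forall k, c k = RtoC 0) -> msum env c = zero.
Proof.
revert c; induction env as [|x env IH]; intros c Hc; [reflexivity|].
simpl; rewrite Hc, IH by (intro; apply Hc).
etransitivity; [apply plus_zero_r|exact (scal_zero_l x)].
Qed.

Lemma msum_ext (env : list X) (c d : nat -> C) :
  (forall k, (k < length env)%nat -> c k = d k) -> msum env c = msum env d.
Proof.
revert c d; induction env as [|x env IH]; intros c d Hc; [reflexivity|].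
simpl; rewrite (Hc 0%nat) by (simpl; lia).
f_equal; apply IH; intros k Hk; apply Hc; simpl; lia.
Qed.

Lemma msum_plus (env : list X) (c d : nat -> C) :
  msum env (fun k => Cplus (c k) (d k)) = plus (msum env c) (msum env d).
Proof.
revert c d; induction env as [|x env IH]; intros c d; simpl.
- exact (eq_sym (plus_zero_r _)).
- rewrite (IH (fun k => c (S k)) (fun k => d (S k))).
  etransitivity; [|exact (plus_perm4 (G := X) _ _ _ _)]; f_equal.
  exact (scal_distr_r (c 0%nat) (d 0%nat) x).
Qed.

Lemma msum_scal (env : list X) (l : C) (c : nat -> C) :
  msum env (fun k => Cmult l (c k)) = scal l (msum env c).
Proof.
revert c; induction env as [|x env IH]; intros c; simpl.
- exact (eq_sym (scal_zero_r l)).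
- rewrite (IH (fun k => c (S k))).
  etransitivity; [|exact (eq_sym (scal_distr_l l _ _))]; f_equal.
  exact (eq_sym (scal_assoc l (c 0%nat) x)).
Qed.

Lemma msum_opp (env : list X) (c : nat -> C) :
  msum env (fun k => Copp (c k)) = opp (msum env c).
Proof.
revert c; induction env as [|x env IH]; intros c; simpl.
- exact (eq_sym opp_zero).
- rewrite (IH (fun k => c (S k))).
  etransitivity; [|exact (eq_sym (opp_plus _ _))]; f_equal.
  exact (scal_opp_l (c 0%nat) x).
Qed.

Lemma msum_var (env : list X) (n : nat) :
  msum env (fun k => if Nat.eqb n k then RtoC 1 else RtoC 0) = List.nth n env zero.
Proof.
revert n; induction env as [|x env IH]; intros [|n]; simpl; try reflexivity.
- rewrite msum_zero by reflexivity.
  rewrite plus_zero_r; exact (scal_one x).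
- rewrite (IH n).
  replace (scal (RtoC 0) x) with (@zero X) by exact (eq_sym (scal_zero_l x)).
  apply plus_zero_l.
Qed.

Lemma meval_msum (env : list X) (e : mexpr) : meval env e = msum env (mcoef e).
Proof.
induction e as [n| |e IHe f IHf|e IHe|c e IHe]; simpl.
- exact (eq_sym (msum_var env n)).
- symmetry; apply msum_zero; reflexivity.
- rewrite IHe, IHf; symmetry; apply msum_plus.
- rewrite IHe; symmetry; apply msum_opp.
- rewrite IHe; symmetry; apply msum_scal.
Qed.

(** For a concrete [n] this computes to an explicit conjunction, which [repeat split] turns into one
    goal per atom. *)
Fixpoint ball_nat (n : nat) (P : nat -> Prop) : Prop :=
  match n with
  | O => True
  | S n => P 0%nat /\ ball_nat n (fun k => P (S k))
  end.

Lemma ball_nat_spec (n : nat) (P : nat -> Prop) :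
  ball_nat n P -> forall k, (k < n)%nat -> P k.
Proof.
revert P; induction n as [|n IH]; intros P H k Hk; [lia|].
destruct H as [H0 H]; destruct k as [|k]; [exact H0|].
apply (IH _ H k); lia.
Qed.

Lemma meval_eq (env : list X) (e f : mexpr) :
  ball_nat (length env) (fun k => mcoef e k = mcoef f k) ->
  meval env e = meval env f.
Proof.
intros H; rewrite !meval_msum; apply msum_ext.
exact (ball_nat_spec _ _ H).
Qed.

End ModuleReflection.

Ltac mvar_index x env :=
  lazymatch env with
  | cons x _ => constr:(O)
  | cons _ ?env => let n := mvar_index x env in constr:(S n)
  end.

Ltac mvar_add x env :=
  let rec in_list l :=
    lazymatch l with
    | nil => constr:(false) | cons x _ => constr:(true)
    | cons _ ?l => in_list l end in
  let b := in_list env in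
  lazymatch b with true => env | false => constr:(cons x env) end.

Ltac matoms e env :=
  lazymatch e with
  | zero => env
  | plus ?a ?b => let env := matoms a env in matoms b env
  | minus ?a ?b => let env := matoms a env in matoms b env
  | opp ?a => matoms a env
  | scal ?c ?a => matoms a env
  | ?x => mvar_add x env
  end.

Ltac mreify e env :=
  lazymatch e with
  | zero => constr:(MZero)
  | plus ?a ?b =>
      let a := mreify a env in let b := mreify b env in constr:(MPlus a b)
  | minus ?a ?b =>
      let a := mreify a env in let b := mreify b env in
      constr:(MPlus a (MOpp b))
  | opp ?a => let a := mreify a env in constr:(MOpp a)
  | scal ?c ?a => let a := mreify a env in constr:(MScal c a)
  | ?x => let n := mvar_index x env in constr:(MVar n)
  end.

(* Equalities in a complex vector space, reduced to one equality of complex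
   coefficients per atom; [mring_with tac] leaves these to [tac]. *)
Ltac mring_with X tac :=
  lazymatch goal with
  | |- ?a = ?b =>
    let env := matoms a (@nil X) in
    let env := matoms b env in
    let ea := mreify a env in
    let eb := mreify b env in
    change (meval X env ea = meval X env eb);
    apply meval_eq;
    cbn [ball_nat length mcoef Nat.eqb];
    repeat split; tac
  end.

Ltac mring X := mring_with X ltac:(ring).

(** * Improper integrals over (0, oo) *)

Lemma plus_minus_cancel {G : AbelianGroup} (x y : G) : plus y (minus x y) = x.
Proof.
unfold minus; rewrite (plus_comm x), plus_assoc, plus_opp_r; apply plus_zero_l.
Qed.

Lemma minus_plus_swap {G : AbelianGroup} (x y z : G) :
  minus (plus (plus x y) z) y = plus x z.
Proof.
unfold minus; rewrite <- (plus_assoc x), (plus_comm y z), !plus_assoc.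
rewrite <- (plus_assoc (plus x z)), plus_opp_r; apply plus_zero_r.
Qed.

Definition hlint {V : NormedModule R_AbsRing} (f : R -> V) (I : V) : Prop :=
  is_RInt_gen f (at_right 0) (Rbar_locally p_infty) I.

Lemma filter_pos_pair :
  filter_prod (at_right 0) (Rbar_locally p_infty)
    (fun ab : R * R => 0 < fst ab /\ fst ab <= snd ab).
Proof.
exists (fun a => 0 < a < 1) (fun b => 1 < b).
- exists (mkposreal 1 Rlt_0_1); intros y Hy Hy0; split; [exact Hy0|].
  change (Rabs (y - 0) < 1) in Hy; apply Rabs_def2 in Hy; lra.
- exists 1; auto.
- intros a b Ha Hb; simpl; lra.
Qed.

(** The extra condition [P] lets one interval serve two integrals at once: in [hlint_norm_le] it
    says that the integral of the bound is also close to its limit. *)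
Lemma hlint_approx {V : NormedModule R_AbsRing} (f : R -> V) (I : V)
    (P : R * R -> Prop) (eps : posreal) :
  hlint f I -> filter_prod (at_right 0) (Rbar_locally p_infty) P ->
  exists a b J, 0 < a /\ a <= b /\ P (a, b) /\ is_RInt f a b J /\ ball I eps J.
Proof.
intros H HP.
assert (H1 := H (ball I eps) (locally_ball I eps)); unfold filtermapi in H1.
assert (H2 := filter_and _ _ (filter_and _ _ H1 HP) filter_pos_pair).
destruct (filter_ex (F := filter_prod (at_right 0) (Rbar_locally p_infty)) _ H2)
  as [[a b] [[[J [HJ1 HJ2]] HP2] [Ha Hab]]].
exists a, b, J; simpl in *; auto.
Qed.

Lemma hlint_intro {V : NormedModule R_AbsRing} (f : R -> V) (I : V)
    (J : R -> R -> V) :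
  (forall a b, 0 < a -> a <= b -> is_RInt f a b (J a b)) ->
  filterlim (fun ab => J (fst ab) (snd ab))
    (filter_prod (at_right 0) (Rbar_locally p_infty)) (locally I) ->
  hlint f I.
Proof.
intros HJ Hlim P HP.
assert (H0 := Hlim P HP); unfold filtermap in H0.
generalize (filter_and _ _ H0 filter_pos_pair).
unfold filtermapi; apply filter_imp; intros [a b] [H1 [H2 H3]]; simpl in *.
exists (J a b); split; [apply HJ; assumption|exact H1].
Qed.

Lemma hlint_ext {V : NormedModule R_AbsRing} (f g : R -> V) (I : V) :
  (forall s, 0 < s -> f s = g s) -> hlint f I -> hlint g I.
Proof.
intros Hfg; apply is_RInt_gen_ext.
generalize filter_pos_pair; apply filter_imp; intros [a b] [Ha Hab] x; simpl in *.
rewrite Rmin_left by lra; intros [Hx _]; apply Hfg; lra.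
Qed.

Lemma hlint_plus {V : NormedModule R_AbsRing} (f g : R -> V) (I J : V) :
  hlint f I -> hlint g J -> hlint (fun s => plus (f s) (g s)) (plus I J).
Proof. exact (is_RInt_gen_plus f g I J). Qed.

(** A bounded linear map commutes with every Riemann sum, by induction on the pointed subdivision,
    and continuity carries this to the limit. *)
Lemma is_RInt_linear {V W : NormedModule R_AbsRing} (l : V -> W) (f : R -> V)
    (a b : R) (J : V) :
  is_linear l -> is_RInt f a b J -> is_RInt (fun s => l (f s)) a b (l J).
Proof.
intros Hl H; unfold is_RInt in *.
apply filterlim_ext with
  (fun ptd => l (scal (sign (b - a)) (Riemann_sum f ptd))).
- intros ptd; rewrite (linear_scal l Hl); f_equal.
  apply SF_cons_ind with (s := ptd); [intro x0|intros h s IH].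
  + unfold Riemann_sum; simpl; exact (linear_zero l Hl).
  + rewrite !Riemann_sum_cons, (linear_plus l Hl), (linear_scal l Hl), IH.
    reflexivity.
- eapply filterlim_comp; [exact H|].
  exact (linear_cont l J Hl).
Qed.

Lemma hlint_linear {V W : NormedModule R_AbsRing} (l : V -> W) (f : R -> V)
    (I : V) :
  is_linear l -> hlint f I -> hlint (fun s => l (f s)) (l I).
Proof.
intros Hl H P HP.
assert (H1 := H _ (linear_cont l I Hl P HP)).
revert H1; unfold filtermapi; apply filter_imp; intros [a b] [J [H1 H2]].
exists (l J); split; [apply is_RInt_linear; assumption|exact H2].
Qed.

Lemma hlint_pair {U V : NormedModule R_AbsRing} (f : R -> U) (g : R -> V)
    (I : U) (J : V) :
  hlint f I -> hlint g J ->
  hlint (V := prod_NormedModule R_AbsRing U V) (fun s => (f s, g s)) (I, J).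
Proof.
intros Hf Hg P [eps HP].
assert (Hf1 := Hf _ (locally_ball I eps)); assert (Hg1 := Hg _ (locally_ball J eps)).
unfold filtermapi in *; generalize (filter_and _ _ Hf1 Hg1); apply filter_imp.
intros [a b] [[I' [H1 H2]] [J' [H3 H4]]].
exists (I', J'); split.
- apply is_RInt_fct_extend_pair; assumption.
- apply HP; split; assumption.
Qed.

(** The dilation by [r] preserves both filters, at [0+] and at infinity, so the substitution rule on
    compact intervals passes to the limit. *)
Lemma hlint_scale {V : NormedModule R_AbsRing} (f : R -> V) (I : V) (r : R) :
  0 < r -> hlint f I -> hlint (fun s => scal r (f (r * s))) I.
Proof.
intros Hr H P HP.
destruct (H P HP) as [Q1 Q2 [d Hd] [M HM] HQ].
assert (Hdr : 0 < d / r) by (apply Rdiv_lt_0_compat; [apply cond_pos|exact Hr]).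
exists (fun a => Q1 (r * a)) (fun b => Q2 (r * b)).
- exists (mkposreal _ Hdr); intros y Hy Hy0; apply Hd; [|nra].
  change (Rabs (y - 0) < d / r) in Hy; change (Rabs (r * y - 0) < d).
  apply Rabs_def2 in Hy; destruct Hy as [Hy1 Hy2].
  assert (y * r < d) by (apply (Rmult_lt_reg_r (/ r));
     [apply Rinv_0_lt_compat, Hr|field_simplify; lra]).
  apply Rabs_def1; nra.
- exists (M / r); intros y Hy; apply HM.
  apply (Rmult_lt_compat_l r) in Hy; [|exact Hr].
  replace (r * (M / r)) with M in Hy by (field; lra); exact Hy.
- intros a b Ha Hb; destruct (HQ _ _ Ha Hb) as [J [HJ1 HJ2]].
  exists J; split; [|exact HJ2]; simpl in *.
  apply is_RInt_ext with (fun y => scal r (f (r * y + 0))).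
  + intros x _; rewrite Rplus_0_r; reflexivity.
  + apply is_RInt_comp_lin; rewrite !Rplus_0_r; exact HJ1.
Qed.

Lemma hlint_norm_le {V : NormedModule R_AbsRing} (f : R -> V) (g : R -> R)
    (I : V) (J : R) :
  hlint f I -> hlint g J -> (forall s, 0 < s -> norm (f s) <= g s) ->
  norm I <= J.
Proof.
intros Hf Hg Hfg; apply le_epsilon; intros eps Heps.
(* A ball of radius [d] controls the norm only up to [norm_factor]: the error in [I] costs
   [norm_factor * d], the one in [J] costs [d], and together they make [eps]. *)
assert (Hd : 0 < eps / (@norm_factor _ V + 1)).
{ apply Rdiv_lt_0_compat; [exact Heps|].
  generalize (@norm_factor_gt_0 _ V); lra. }
set (d := mkposreal _ Hd).
destruct (hlint_approx _ _ (fun ab => exists K, is_RInt g (fst ab) (snd ab) K /\ ball J d K)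
  d Hf (Hg _ (locally_ball J d))) as [a [b [I' [Ha [Hab [[K [HK1 HK2]] [HI1 HI2]]]]]]].
assert (H1 : norm I' <= K).
{ apply (norm_RInt_le f g a b); try assumption; intros x Hx; apply Hfg; lra. }
assert (H2 := norm_compat2 _ _ _ (ball_sym _ _ _ HI2)).
assert (H3 : norm I <= norm I' + norm (minus I I')).
{ assert (E : I = plus I' (minus I I')); [|rewrite E at 1; apply norm_triangle].
  exact (eq_sym (plus_minus_cancel (G := V) I I')). }
assert (H4 : K < J + d).
{ change (Rabs (K - J) < d) in HK2; apply Rabs_def2 in HK2; lra. }
assert (H5 : (@norm_factor _ V + 1) * d = eps).
{ unfold d; simpl; field; generalize (@norm_factor_gt_0 _ V); lra. }
lra.
Qed.

(** * Integrals dominated by an explicit density *)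

Section Dominated.

Variable sigma : R.
Hypothesis Hsigma : 0 < sigma < 1.

(* The derivative of [s^sigma / (s^sigma + rho)], hence of integral 1 over
   (0, oo); all kernels below are dominated by multiples of it. *)
Definition dens (rho s : R) : R :=
  sigma * rho * Rpower s sigma / (s * (Rpower s sigma + rho) ^ 2).

Definition dens_prim (rho s : R) : R := Rpower s sigma / (Rpower s sigma + rho).

Lemma Rpower_gt0 (s a : R) : 0 < Rpower s a.
Proof. apply exp_pos. Qed.

Lemma dens_gt0 (rho s : R) : 0 < rho -> 0 < s -> 0 < dens rho s.
Proof.
intros Hr Hs; unfold dens; assert (H := Rpower_gt0 s sigma).
apply Rdiv_lt_0_compat.
- apply Rmult_lt_0_compat; [apply Rmult_lt_0_compat|]; lra.
- apply Rmult_lt_0_compat; [lra|apply pow_lt; lra].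
Qed.

Lemma dens_prim_bounds (rho s : R) : 0 < rho -> 0 < dens_prim rho s < 1.
Proof.
intros Hr; unfold dens_prim; assert (H := Rpower_gt0 s sigma); split.
- apply Rdiv_lt_0_compat; lra.
- apply Rlt_div_l; lra.
Qed.

Lemma is_derive_Rpower_l (s : R) :
  0 < s -> is_derive (fun s => Rpower s sigma) s (sigma * Rpower s sigma / s).
Proof.
intros Hs; unfold Rpower; auto_derive; [exact Hs|field; lra].
Qed.

Lemma is_derive_dens_prim (rho s : R) : 0 < rho -> 0 < s ->
  is_derive (dens_prim rho) s (dens rho s).
Proof.
intros Hr Hs; unfold dens_prim, dens; assert (H := Rpower_gt0 s sigma).
unfold Rpower in *; auto_derive; [split; lra|field; lra].
Qed.

Lemma continuous_Rpower (s : R) : 0 < s -> continuous (fun s => Rpower s sigma) s.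
Proof.
intros Hs; apply (ex_derive_continuous (fun s => Rpower s sigma)).
eexists; apply is_derive_Rpower_l, Hs.
Qed.

Lemma continuous_dens (rho s : R) : 0 < rho -> 0 < s -> continuous (dens rho) s.
Proof.
intros Hr Hs; apply (ex_derive_continuous (dens rho)).
unfold dens, Rpower; auto_derive.
assert (H := exp_pos (sigma * ln s)).
repeat split; try lra.
apply Rgt_not_eq, Rmult_lt_0_compat; [lra|].
apply Rmult_lt_0_compat; lra.
Qed.

Lemma is_RInt_dens (rho a b : R) : 0 < rho -> 0 < a -> a <= b ->
  is_RInt (dens rho) a b (dens_prim rho b - dens_prim rho a).
Proof.
intros Hr Ha Hab; apply (is_RInt_derive (dens_prim rho) (dens rho)).
- intros x; rewrite Rmin_left by lra; intros Hx; apply is_derive_dens_prim; lra.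
- intros x; rewrite Rmin_left by lra; intros Hx; apply continuous_dens; lra.
Qed.

Lemma Rpower_lt_small (eps : R) : 0 < eps ->
  exists d : posreal, forall s, 0 < s -> s <= d -> Rpower s sigma < eps.
Proof.
intros He.
assert (Hd : 0 < Rpower (eps / 2) (/ sigma)) by apply Rpower_gt0.
exists (mkposreal _ Hd); intros s Hs Hsd; simpl in Hsd.
apply Rle_lt_trans with (Rpower (Rpower (eps / 2) (/ sigma)) sigma).
- apply Rle_Rpower_l; lra.
- rewrite Rpower_mult, Rinv_l, Rpower_1; lra.
Qed.

Lemma dens_prim_lim_0 (rho eps : R) : 0 < rho -> 0 < eps ->
  exists d : posreal, forall s, 0 < s -> s <= d -> dens_prim rho s < eps.
Proof.
intros Hr He; destruct (Rpower_lt_small (eps * rho)) as [d Hd]; [nra|].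
exists d; intros s Hs Hsd; assert (H := Hd s Hs Hsd); assert (H0 := Rpower_gt0 s sigma).
unfold dens_prim; apply Rlt_div_l; nra.
Qed.

Lemma dens_prim_lim_inf (rho eps : R) : 0 < rho -> 0 < eps ->
  exists M : R, 0 < M /\ forall s, M <= s -> 1 - eps < dens_prim rho s.
Proof.
intros Hr He.
exists (Rpower (rho / eps) (/ sigma)); split; [apply Rpower_gt0|intros s Hs].
assert (H0 := Rpower_gt0 s sigma).
assert (H1 : Rpower (Rpower (rho / eps) (/ sigma)) sigma <= Rpower s sigma).
{ apply Rle_Rpower_l; [lra|split; [apply Rpower_gt0|exact Hs]]. }
assert (H2 : 0 < rho / eps) by (apply Rdiv_lt_0_compat; lra).
rewrite Rpower_mult, Rinv_l, Rpower_1 in H1 by lra.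
unfold dens_prim.
replace (Rpower s sigma / (Rpower s sigma + rho))
  with (1 - rho / (Rpower s sigma + rho)) by (field; lra).
assert (H3 : rho / (Rpower s sigma + rho) < eps); [|lra].
apply Rlt_div_l; [lra|].
assert (H4 : rho / eps * eps <= Rpower s sigma * eps) by (apply Rmult_le_compat_r; lra).
replace (rho / eps * eps) with rho in H4 by (field; lra); nra.
Qed.

Lemma at_right_small (d : posreal) : at_right 0 (fun a => 0 < a <= d).
Proof.
exists d; intros y Hy Hy0; split; [exact Hy0|].
change (Rabs (y - 0) < d) in Hy; apply Rabs_def2 in Hy; lra.
Qed.

Lemma hlint_dens (rho : R) : 0 < rho -> hlint (dens rho) 1.
Proof.
intros Hr; apply (hlint_intro _ _ (fun a b => dens_prim rho b - dens_prim rho a)).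
- intros a b Ha Hab; apply is_RInt_dens; assumption.
- intros P [eps HP].
  destruct (dens_prim_lim_0 rho (eps / 2) Hr) as [d Hd];
    [generalize (cond_pos eps); lra|].
  destruct (dens_prim_lim_inf rho (eps / 2) Hr) as [M [HM0 HM]];
    [generalize (cond_pos eps); lra|].
  exists (fun a => 0 < a <= d) (fun b => M < b); [apply at_right_small|exists M; auto|].
  intros a b [Ha1 Ha2] Hb; apply HP; simpl.
  change (Rabs (dens_prim rho b - dens_prim rho a - 1) < eps).
  assert (H1 := Hd a Ha1 Ha2); assert (H2 := HM b (Rlt_le _ _ Hb)).
  assert (H3 := dens_prim_bounds rho a Hr); assert (H4 := dens_prim_bounds rho b Hr).
  apply Rabs_def1; lra.
Qed.

Lemma hlint_bound {V : NormedModule R_AbsRing} (f : R -> V) (I : V) (M rho : R) :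
  0 < rho -> hlint f I -> (forall s, 0 < s -> norm (f s) <= M * dens rho s) ->
  norm I <= M.
Proof.
intros Hr Hf Hb; apply (hlint_norm_le f (fun s => M * dens rho s)); try assumption.
assert (H := is_RInt_gen_scal (Fa := at_right 0) (Fb := Rbar_locally p_infty)
  (dens rho) M 1 (hlint_dens rho Hr)).
replace (hlint (fun s => M * dens rho s) M)
  with (hlint (fun s => M * dens rho s) (M * 1)) by (f_equal; apply Rmult_1_r).
exact H.
Qed.

(** Cauchy criterion in the two endpoints: moving them changes the integral by at most [M] times the
    increments of [dens_prim], which are small near [0] and near infinity. *)
Lemma hlint_exists (V : CompleteNormedModule R_AbsRing) (f : R -> V) (M rho : R) :
  0 < rho -> (forall s, 0 < s -> continuous f s) ->
  (forall s, 0 < s -> norm (f s) <= M * dens rho s) ->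
  exists I, hlint f I.
Proof.
intros Hr Hc Hb.
assert (Hex : forall a b, 0 < a -> 0 < b -> is_RInt f a b (RInt f a b)).
{ intros a b Ha Hb0; apply (RInt_correct f), ex_RInt_continuous.
  intros z Hz; apply Hc.
  apply Rlt_le_trans with (Rmin a b); [apply Rmin_glb_lt; lra|lra]. }
assert (Hle : forall a b, 0 < a -> a <= b ->
  norm (RInt f a b) <= M * (dens_prim rho b - dens_prim rho a)).
{ intros a b Ha Hab.
  apply (norm_RInt_le f (fun s => M * dens rho s) a b); try assumption.
  - intros x Hx; apply Hb; lra.
  - apply Hex; lra.
  - exact (is_RInt_scal _ a b M _ (is_RInt_dens rho a b Hr Ha Hab)). }
assert (HM : 0 <= M).
{ destruct (Rle_lt_dec 0 M) as [H|H]; [exact H|].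
  assert (H1 := Hb 1 Rlt_0_1); assert (H2 := norm_ge_0 (f 1)).
  assert (H3 := dens_gt0 rho 1 Hr Rlt_0_1).
  nra. }
assert (Hmono : forall a b, 0 < a -> 0 < b -> forall e,
  Rabs (dens_prim rho b - dens_prim rho a) <= e ->
  norm (RInt f a b) <= M * e).
{ intros a b Ha Hb0 e He.
  destruct (Rle_lt_dec a b) as [H|H].
  - eapply Rle_trans; [apply Hle; assumption|].
    apply Rmult_le_compat_l; [exact HM|].
    eapply Rle_trans; [apply Rle_abs|exact He].
  - rewrite <- (opp_RInt_swap f) by (eexists; apply Hex; lra).
    eapply Rle_trans; [right; exact (norm_opp (V := V) _)|].
    eapply Rle_trans; [apply Hle; lra|].
    apply Rmult_le_compat_l; [exact HM|].
    eapply Rle_trans; [apply Rle_abs|rewrite Rabs_minus_sym; exact He]. }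
destruct (proj1 (filterlim_locally_cauchy
   (F := filter_prod (at_right 0) (Rbar_locally p_infty))
   (fun ab => RInt f (fst ab) (snd ab)))) as [I HI].
2: { exists I; apply (hlint_intro f I (RInt f)); [|exact HI].
     intros a b Ha Hab; apply Hex; lra. }
intros eps.
(* Each of the two end pieces costs at most [M * e]; [M + 1] instead of [M] keeps [e] meaningful for
   [M = 0] and the final inequality strict. *)
set (e := eps / (2 * (M + 1))).
assert (He : 0 < e) by (apply Rdiv_lt_0_compat; [apply cond_pos|lra]).
destruct (dens_prim_lim_0 rho e Hr He) as [d Hd].
destruct (dens_prim_lim_inf rho e Hr He) as [N [HN0 HN]].
exists (fun ab => 0 < fst ab <= d /\ N < snd ab); split.
- exists (fun a => 0 < a <= d) (fun b => N < b);
    [apply at_right_small|exists N; auto|auto].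
- intros [a b] [a' b'] [Ha Hb1] [Ha' Hb']; simpl in *.
  apply (norm_compat1 (V := V)).
  assert (E : minus (RInt f a' b') (RInt f a b) =
              plus (RInt f a' a) (RInt f b b')).
  { rewrite <- (RInt_Chasles f a' a b') by (eexists; apply Hex; lra).
    rewrite <- (RInt_Chasles f a b b') by (eexists; apply Hex; lra).
    rewrite plus_assoc; exact (minus_plus_swap (G := V) _ _ _). }
  refine (Rle_lt_trans _ _ _ (Req_le _ _ (f_equal norm E)) _).
  eapply Rle_lt_trans; [exact (norm_triangle (V := V) _ _)|].
  assert (B1 : norm (RInt f a' a) <= M * e).
  { apply Hmono; try lra.
    assert (H1 := Hd a (proj1 Ha) (proj2 Ha)); assert (H2 := Hd a' (proj1 Ha') (proj2 Ha')).
    assert (H3 := dens_prim_bounds rho a Hr); assert (H4 := dens_prim_bounds rho a' Hr).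
    apply Rabs_le; lra. }
  assert (B2 : norm (RInt f b b') <= M * e).
  { apply Hmono; try lra.
    assert (H1 := HN b (Rlt_le _ _ Hb1)); assert (H2 := HN b' (Rlt_le _ _ Hb')).
    assert (H3 := dens_prim_bounds rho b Hr); assert (H4 := dens_prim_bounds rho b' Hr).
    apply Rabs_le; lra. }
  assert (E2 : eps = 2 * (M + 1) * e :> R) by (unfold e; field; lra).
  rewrite E2; nra.
Qed.

End Dominated.

(** * Rademacher sums *)

Section SignSums.

Variable V : NormedModule R_AbsRing.

Fixpoint sign_space (n : nat) : NormedModule R_AbsRing :=
  match n with
  | O => V
  | S n => prod_NormedModule R_AbsRing (sign_space n) (sign_space n)
  end.

(* The family of all [v + e_1 x_1 + ... + e_n x_n], [e_i = 1] or [-1]; the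
   Coquelicot norm of a product is the Euclidean one, so its norm is
   [2 ^ (n/2)] times an L^2 norm over the signs. *)
Fixpoint sign_sums (n : nat) : V -> (nat -> V) -> sign_space n :=
  match n with
  | O => fun v _ => v
  | S n => fun v x =>
      (sign_sums n (plus v (x 1%nat)) (fun k => x (S k)),
       sign_sums n (plus v (opp (x 1%nat))) (fun k => x (S k)))
  end.

Lemma sign_sums_ext (n : nat) (v : V) (x y : nat -> V) :
  (forall k, (1 <= k <= n)%nat -> x k = y k) ->
  sign_sums n v x = sign_sums n v y.
Proof.
revert v x y; induction n as [|n IH]; intros v x y H; [reflexivity|].
simpl; rewrite (H 1%nat) by lia.
rewrite (IH _ (fun k => x (S k)) (fun k => y (S k))) by (intros k Hk; apply H; lia).
f_equal; apply IH; intros k Hk; apply H; lia.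
Qed.

Lemma sign_sums_plus (n : nat) (v w : V) (x y : nat -> V) :
  sign_sums n (plus v w) (fun k => plus (x k) (y k)) =
  plus (sign_sums n v x) (sign_sums n w y).
Proof.
revert v w x y; induction n as [|n IH]; intros v w x y; [reflexivity|].
simpl.
replace (plus (plus v w) (plus (x 1%nat) (y 1%nat)))
  with (plus (plus v (x 1%nat)) (plus w (y 1%nat)))
  by exact (plus_perm4 (G := V) _ _ _ _).
replace (plus (plus v w) (opp (plus (x 1%nat) (y 1%nat))))
  with (plus (plus v (opp (x 1%nat))) (plus w (opp (y 1%nat)))).
2: { replace (opp (plus (x 1%nat) (y 1%nat)))
       with (plus (opp (x 1%nat)) (opp (y 1%nat)))
       by exact (eq_sym (opp_plus (G := V) _ _)).
     exact (plus_perm4 (G := V) _ _ _ _). }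
rewrite (IH _ _ (fun k => x (S k)) (fun k => y (S k))).
rewrite (IH _ _ (fun k => x (S k)) (fun k => y (S k))).
reflexivity.
Qed.

Lemma sign_sums_scal (n : nat) (l : R) (v : V) (x : nat -> V) :
  sign_sums n (scal l v) (fun k => scal l (x k)) = scal l (sign_sums n v x).
Proof.
revert v x; induction n as [|n IH]; intros v x; [reflexivity|].
simpl.
apply (f_equal2 pair);
  (etransitivity; [|exact (IH _ (fun k => x (S k)))]); f_equal; symmetry;
  (etransitivity; [exact (scal_distr_l (V := V) _ _ _)|]); f_equal.
exact (scal_opp_r (V := V) _ _).
Qed.

Lemma norm_sign_sums_S_sq (n : nat) (v : V) (x : nat -> V) :
  norm (sign_sums (S n) v x) ^ 2 =
  norm (sign_sums n (plus v (x 1%nat)) (fun k => x (S k))) ^ 2 +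
  norm (sign_sums n (plus v (opp (x 1%nat))) (fun k => x (S k))) ^ 2.
Proof.
set (a := sign_sums n (plus v (x 1%nat)) _).
set (b := sign_sums n (plus v (opp (x 1%nat))) _).
change (sqrt (norm a ^ 2 + norm b ^ 2) ^ 2 = norm a ^ 2 + norm b ^ 2).
apply pow2_sqrt; generalize (pow2_ge_0 (norm a)) (pow2_ge_0 (norm b)); lra.
Qed.

Lemma le_of_sq_le (a b : R) : 0 <= b -> a ^ 2 <= b ^ 2 -> a <= b.
Proof. intros; nra. Qed.

Lemma sign_sums_map_le (n : nat) (M : R) (B : V -> V) (v : V) (x : nat -> V) :
  (forall x y, B (plus x y) = plus (B x) (B y)) ->
  (forall x, B (opp x) = opp (B x)) ->
  (forall x, norm (B x) <= M * norm x) -> 0 <= M ->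
  norm (sign_sums n (B v) (fun k => B (x k))) <= M * norm (sign_sums n v x).
Proof.
intros Hp Ho Hb HM; revert v x; induction n as [|n IH]; intros v x; [apply Hb|].
apply le_of_sq_le.
{ apply Rmult_le_pos; [exact HM|apply norm_ge_0]. }
rewrite Rpow_mult_distr, !norm_sign_sums_S_sq.
rewrite <- Ho, <- !Hp, Rmult_plus_distr_l, <- !Rpow_mult_distr.
apply Rplus_le_compat; apply pow_incr; (split; [apply norm_ge_0|]).
- exact (IH _ (fun k => x (S k))).
- exact (IH _ (fun k => x (S k))).
Qed.

Lemma scal_add_one (p q : R) (v : V) :
  p + q = 1 -> plus (scal p v) (scal q v) = v.
Proof.
intros H; etransitivity; [exact (eq_sym (scal_distr_r (V := V) p q v))|].
exact (eq_trans (f_equal (fun r => scal r v) H) (scal_one (V := V) v)).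
Qed.

(** Since [p + q = 1], the family [x] is [p x + q x]; linearity in the pair [(v, x)] then reduces
    convexity to the triangle inequality. *)
Lemma sign_sums_convex (n : nat) (v w : V) (x : nat -> V) (p q : R) :
  0 <= p -> 0 <= q -> p + q = 1 ->
  norm (sign_sums n (plus (scal p v) (scal q w)) x) <=
  p * norm (sign_sums n v x) + q * norm (sign_sums n w x).
Proof.
intros Hp Hq Hpq.
replace (sign_sums n (plus (scal p v) (scal q w)) x)
  with (plus (scal p (sign_sums n v x)) (scal q (sign_sums n w x))).
2: { etransitivity; [apply f_equal2; symmetry; apply sign_sums_scal|].
     etransitivity; [symmetry; apply sign_sums_plus|].
     apply sign_sums_ext; intros k _.
     exact (scal_add_one p q (x k) Hpq). }
eapply Rle_trans; [exact (norm_triangle (V := sign_space n) _ _)|].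
apply Rplus_le_compat;
  (eapply Rle_trans; [exact (norm_scal (V := sign_space n) _ _)|]);
  unfold abs; simpl; rewrite Rabs_pos_eq by lra; lra.
Qed.

(* In each coordinate the norm is convex and even, hence largest at the
   endpoints of [-1, 1]. *)
Lemma sign_sums_contraction (n : nat) (a : nat -> R) (v : V) (x : nat -> V) :
  (forall k, (1 <= k <= n)%nat -> Rabs (a k) <= 1) ->
  norm (sign_sums n v (fun k => scal (a k) (x k))) <= norm (sign_sums n v x).
Proof.
revert a v x; induction n as [|n IH]; intros a v x Ha; [apply Rle_refl|].
apply le_of_sq_le; [apply norm_ge_0|].
rewrite !norm_sign_sums_S_sq.
set (al := norm (sign_sums n (plus v (x 1%nat)) (fun k => x (S k)))).
set (be := norm (sign_sums n (plus v (opp (x 1%nat))) (fun k => x (S k)))).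
assert (H1 : Rabs (a 1%nat) <= 1) by (apply Ha; lia).
(* Barycentric coordinates of [a 1] in [[-1, 1]]: [a 1 = p - q] and [p + q = 1], hence
   [v + a x = p (v + x) + q (v - x)]. *)
set (p := (1 + a 1%nat) / 2); set (q := (1 - a 1%nat) / 2).
apply Rabs_le_between in H1.
assert (Hp : 0 <= p) by (unfold p; lra); assert (Hq : 0 <= q) by (unfold q; lra).
assert (Hpq : p + q = 1) by (unfold p, q; lra).
assert (Ea : p - q = a 1%nat) by (unfold p, q; lra).
assert (IH' : forall w, norm (sign_sums n w (fun k => scal (a (S k)) (x (S k))))
   <= norm (sign_sums n w (fun k => x (S k)))).
{ intros w; apply (IH (fun k => a (S k)) w (fun k => x (S k))).
  intros k Hk; apply Ha; lia. }
assert (Ev : forall r s, r + s = 1 -> forall y : V,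
  plus v (scal (r - s) y) = plus (scal r (plus v y)) (scal s (plus v (opp y)))).
{ intros r s Hrs y; symmetry.
  etransitivity.
  { apply f_equal2; [exact (scal_distr_l (V := V) r v y)|].
    exact (scal_distr_l (V := V) s v (opp y)). }
  etransitivity; [exact (plus_perm4 (G := V) _ _ _ _)|].
  f_equal.
  - exact (scal_add_one r s v Hrs).
  - etransitivity.
    { apply f_equal; etransitivity; [exact (scal_opp_r (V := V) s y)|].
      exact (eq_sym (scal_opp_l (V := V) s y)). }
    exact (eq_sym (scal_distr_r (V := V) r (- s) y)). }
assert (B1 : norm (sign_sums n (plus v (scal (a 1%nat) (x 1%nat)))
    (fun k => scal (a (S k)) (x (S k)))) <= p * al + q * be).
{ eapply Rle_trans; [apply IH'|].
  rewrite <- Ea, Ev by exact Hpq; apply sign_sums_convex; assumption. }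
assert (B2 : norm (sign_sums n (plus v (opp (scal (a 1%nat) (x 1%nat))))
    (fun k => scal (a (S k)) (x (S k)))) <= q * al + p * be).
{ eapply Rle_trans; [apply IH'|].
  replace (opp (scal (a 1%nat) (x 1%nat))) with (scal (q - p) (x 1%nat)).
  2: { replace (q - p) with (- a 1%nat) by lra.
       exact (scal_opp_l (V := V) _ _). }
  rewrite Ev by lra; apply sign_sums_convex; lra. }
assert (Ha0 : 0 <= al) by apply norm_ge_0; assert (Hb0 : 0 <= be) by apply norm_ge_0.
apply Rle_trans with ((p * al + q * be) ^ 2 + (q * al + p * be) ^ 2).
- apply Rplus_le_compat; apply pow_incr; (split; [apply norm_ge_0|assumption]).
(* The two squares add up to [al^2 + be^2 - 2 p q (al - be)^2]. *)
- assert (H2 : 0 <= p * q) by (apply Rmult_le_pos; assumption).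
  assert (H3 : 0 <= p * q * (al - be) ^ 2)
    by (apply Rmult_le_pos; [exact H2|apply pow2_ge_0]).
  replace (al ^ 2 + be ^ 2) with ((p + q) ^ 2 * (al ^ 2 + be ^ 2))
    by (rewrite Hpq; ring).
  nra.
Qed.

Lemma hlint_sign_sums (n : nat) (v : R -> V) (f : nat -> R -> V) (I : V)
    (J : nat -> V) :
  hlint v I -> (forall k, (1 <= k <= n)%nat -> hlint (f k) (J k)) ->
  hlint (fun s => sign_sums n (v s) (fun k => f k s)) (sign_sums n I J).
Proof.
revert v f I J; induction n as [|n IH]; intros v f I J Hv Hf; [exact Hv|].
simpl; apply hlint_pair.
- apply (IH _ (fun k => f (S k)) _ (fun k => J (S k))).
  + apply hlint_plus; [exact Hv|apply Hf; lia].
  + intros k Hk; apply Hf; lia.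
- apply (IH _ (fun k => f (S k)) _ (fun k => J (S k))).
  + apply hlint_plus; [exact Hv|].
    refine (hlint_linear opp _ _ is_linear_opp _); apply Hf; lia.
  + intros k Hk; apply Hf; lia.
Qed.

End SignSums.

Arguments sign_sums {V} n v x.

(** * From integrals of Rademacher sums to averages over signs *)

Section Rademacher.

Lemma rademacher_double (k : nat) (t : R) :
  rademacher (S k) t = rademacher k (2 * t).
Proof. unfold rademacher; apply f_equal, f_equal; simpl; ring. Qed.

Lemma rademacher_period (k : nat) (t : R) :
  rademacher (S k) (t - 1) = rademacher (S k) t.
Proof.
unfold rademacher; f_equal.
set (m := (2 ^ k)%nat).
assert (Em : 2 ^ k = INR m).
{ unfold m; rewrite pow_INR; apply f_equal2; [simpl; ring|reflexivity]. }
rewrite <- (sin_period (2 ^ S k * PI * (t - 1)) m), <- Em.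
apply f_equal; simpl; ring.
Qed.

Lemma rademacher_1_left (t : R) : 0 < t < / 2 -> rademacher 1 t = 1.
Proof.
intros Ht; unfold rademacher; apply sign_eq_1, sin_gt_0; generalize PI_RGT_0; nra.
Qed.

Lemma rademacher_1_right (t : R) : / 2 < t < 1 -> rademacher 1 t = -1.
Proof.
intros Ht; unfold rademacher; apply sign_eq_m1, sin_lt_0; generalize PI_RGT_0; nra.
Qed.

Variable X : CompleteNormedModule C_AbsRing.
Let XR := restr_NormedModule X.

(** Self-similarity: on each half of [[0, 1]] the first function is constant, [1] or [-1], and the
    others are Rademacher functions squeezed to half the length, which is the recursion of
    [sign_sums]. The zeros of the first function are endpoints of the halves, which [is_RInt_ext]
    ignores. *)
Lemma is_RInt_rademacher (n : nat) (v : XR) (x : nat -> XR) :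
  is_RInt (fun t => norm (plus v
     (sum_n_m (G := XR) (fun k => scal (rademacher k t) (x k)) 1 n)) ^ 2)
   0 1 (norm (sign_sums n v x) ^ 2 / 2 ^ n).
Proof.
revert v x; induction n as [|n IH]; intros v x.
- apply is_RInt_ext with (fun _ => norm v ^ 2).
  + intros t _; rewrite sum_n_m_zero by lia; f_equal; f_equal.
    exact (eq_sym (plus_zero_r _)).
  + replace (norm (sign_sums 0 v x) ^ 2 / 2 ^ 0)
      with (scal (1 - 0) (norm v ^ 2)); [apply (is_RInt_const (V := R_NormedModule))|].
    unfold scal; simpl; unfold mult; simpl; field.
- set (F := fun (w : XR) t => norm (plus w
     (sum_n_m (G := XR) (fun k => scal (rademacher k t) (x (S k))) 1 n)) ^ 2).
  assert (HF : forall w, is_RInt (F w) 0 1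
     (norm (sign_sums n w (fun k => x (S k))) ^ 2 / 2 ^ n)).
  { intros w; exact (IH w (fun k => x (S k))). }
  rewrite norm_sign_sums_S_sq.
  set (P1 := norm (sign_sums n (plus v (x 1%nat)) (fun k => x (S k))) ^ 2).
  set (P2 := norm (sign_sums n (plus v (opp (x 1%nat))) (fun k => x (S k))) ^ 2).
  replace ((P1 + P2) / 2 ^ S n)
    with (plus (P1 / 2 ^ n / 2) (P2 / 2 ^ n / 2)).
  2: { unfold plus; simpl; field; apply pow_nonzero; lra. }
  assert (Es : forall t, sum_n_m (G := XR) (fun k => scal (rademacher k t) (x k)) 1 (S n)
     = plus (scal (rademacher 1 t) (x 1%nat))
        (sum_n_m (G := XR) (fun k => scal (rademacher (S k) t) (x (S k))) 1 n)).
  { intros t; rewrite sum_Sn_m by lia; f_equal.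
    exact (eq_sym (sum_n_m_S (fun k => scal (rademacher k t) (x k)) 1 n)). }
  refine (is_RInt_Chasles (V := R_NormedModule) _ 0 (/ 2) 1 _ _ _ _).
  (* The inner factor [2] is the one that [is_RInt_comp_lin] asks for in the substitution
     [t -> 2 t]; the outer [/ 2] compensates for it. *)
  + apply is_RInt_ext with (fun t => / 2 * (2 * F (plus v (x 1%nat)) (2 * t + 0))).
    * intros t; rewrite Rmin_left, Rmax_right by lra; intros Ht.
      rewrite Es, rademacher_1_left by lra.
      rewrite <- Rmult_assoc, Rinv_l, Rmult_1_l by lra; unfold F; f_equal; f_equal.
      rewrite <- (plus_assoc v); f_equal; f_equal.
      { exact (eq_sym (scal_one (V := XR) _)). }
      apply sum_n_m_ext; intros k; rewrite Rplus_0_r, rademacher_double; reflexivity.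
    * replace (P1 / 2 ^ n / 2) with (/ 2 * (P1 / 2 ^ n)) by (field; apply pow_nonzero; lra).
      refine (is_RInt_scal (V := R_NormedModule) _ _ _ (/ 2) _ _).
      refine (is_RInt_comp_lin (V := R_NormedModule) _ 2 _ _ _ _ _).
      replace (2 * 0 + 0) with 0 by ring; replace (2 * / 2 + 0) with 1 by field.
      apply HF.
  + apply is_RInt_ext with
      (fun t => / 2 * (2 * F (plus v (opp (x 1%nat))) (2 * t + -1))).
    * intros t; rewrite Rmin_left, Rmax_right by lra; intros Ht.
      rewrite Es, rademacher_1_right by lra.
      rewrite <- Rmult_assoc, Rinv_l, Rmult_1_l by lra; unfold F; f_equal; f_equal.
      rewrite <- (plus_assoc v); f_equal; f_equal.
      { symmetry; etransitivity; [exact (scal_opp_l (V := XR) 1 _)|].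
        f_equal; exact (scal_one (V := XR) _). }
      (* The substitution produces [2 t - 1]. Periodicity removes the [-1] only for indices at least
         [1] ([rademacher 0] changes sign), so summands are compared within the range of
         summation. *)
      apply sum_n_m_ext_loc; intros [|k] Hk; [lia|].
      rewrite (rademacher_double (S k)), <- (rademacher_period k (2 * t)).
      reflexivity.
    * replace (P2 / 2 ^ n / 2) with (/ 2 * (P2 / 2 ^ n)) by (field; apply pow_nonzero; lra).
      refine (is_RInt_scal (V := R_NormedModule) _ _ _ (/ 2) _ _).
      refine (is_RInt_comp_lin (V := R_NormedModule) _ 2 _ _ _ _ _).
      replace (2 * / 2 + -1) with 0 by field; replace (2 * 1 + -1) with 1 by ring.
      apply HF.
Qed.

Lemma L2_norm_rademacher (n : nat) (x : nat -> X) :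
  L2_norm (fun t => sum_n_m (fun k => scal (RtoC (rademacher k t)) (x k)) 1 n)
  = norm (sign_sums (V := XR) n zero x) / sqrt (2 ^ n).
Proof.
unfold L2_norm.
replace (RInt _ 0 1) with (norm (sign_sums (V := XR) n zero x) ^ 2 / 2 ^ n).
- assert (H : 0 < 2 ^ n) by (apply pow_lt; lra).
  rewrite sqrt_div_alt by exact H; f_equal; apply sqrt_pow2, norm_ge_0.
- symmetry; apply is_RInt_unique.
  generalize (is_RInt_rademacher n zero x); apply is_RInt_ext.
  intros t _; apply (f_equal (fun r => r ^ 2)).
  exact (f_equal (norm (V := XR)) (plus_zero_l (G := XR) _)).
Qed.

End Rademacher.

(** * Bounded operators *)

Section Bounded.

Variable X : CompleteNormedModule C_AbsRing.

(** Completeness concerns only the uniform structure, which restriction of scalars leaves unchanged,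
    so the given proof of it is reused as it is. *)
Definition restr_Complete : CompleteNormedModule R_AbsRing :=
  CompleteNormedModule.Pack R_AbsRing X
    (CompleteNormedModule.Class R_AbsRing X
      (NormedModule.class R_AbsRing (restr_NormedModule X))
      (CompleteNormedModule.mixin C_AbsRing X
         (CompleteNormedModule.class C_AbsRing X)))
    X.

Let XR := restr_NormedModule X.

Lemma norm_plus_le (x y : X) : norm (plus x y) <= norm x + norm y.
Proof. exact (norm_triangle (V := X) x y). Qed.

Lemma norm_opp_eq (x : X) : norm (opp x) = norm x.
Proof. exact (norm_opp (V := X) x). Qed.

Lemma norm_minus_le (x y : X) : norm (minus x y) <= norm x + norm y.
Proof.
eapply Rle_trans; [exact (norm_plus_le x (opp y))|]; rewrite norm_opp_eq; lra.
Qed.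

Lemma norm_zero_eq : norm (zero : X) = 0.
Proof. exact (norm_zero (V := X)). Qed.

(** [is_linear] hides its constant and wants it positive; here the constant is visible, so that
    resolvent bounds can be tracked, and it may be [0]. *)
Definition bdd (M : R) (B : X -> X) : Prop :=
  (forall x y, B (plus x y) = plus (B x) (B y)) /\
  (forall (l : C) x, B (scal l x) = scal l (B x)) /\
  0 <= M /\ forall x, norm (B x) <= M * norm x.

Lemma bdd_linear (M : R) (B : X -> X) : bdd M B -> is_linear B.
Proof.
intros [Hp [Hs [HM Hb]]]; constructor; [exact Hp|exact Hs|].
exists (M + 1); split; [lra|]; intros x; eapply Rle_trans; [apply Hb|].
apply Rmult_le_compat_r; [apply norm_ge_0|lra].
Qed.

Lemma linear_bdd (B : X -> X) : is_linear B -> exists M, bdd M B.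
Proof.
intros [Hp Hs [M [HM Hb]]]; exists M; split; [exact Hp|split; [exact Hs|]].
split; [lra|exact Hb].
Qed.

Lemma bdd_zero (M : R) (B : X -> X) : bdd M B -> B zero = zero.
Proof. intros H; apply (linear_zero B), (bdd_linear M), H. Qed.

Lemma bdd_opp (M : R) (B : X -> X) (x : X) : bdd M B -> B (opp x) = opp (B x).
Proof. intros H; exact (linear_opp B x (bdd_linear M B H)). Qed.

Lemma bdd_weaken (M M' : R) (B : X -> X) : bdd M B -> M <= M' -> bdd M' B.
Proof.
intros [Hp [Hs [HM Hb]]] H; repeat split; try assumption; [lra|].
intros x; eapply Rle_trans; [apply Hb|].
apply Rmult_le_compat_r; [apply norm_ge_0|exact H].
Qed.

Lemma bdd_comp (M N : R) (A B : X -> X) :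
  bdd M A -> bdd N B -> bdd (M * N) (fun x => A (B x)).
Proof.
intros [Hp [Hs [HM Hb]]] [Hp' [Hs' [HN Hb']]]; repeat split.
- intros x y; rewrite Hp', Hp; reflexivity.
- intros l x; rewrite Hs', Hs; reflexivity.
- apply Rmult_le_pos; assumption.
- intros x; eapply Rle_trans; [apply Hb|]; rewrite Rmult_assoc.
  apply Rmult_le_compat_l; [exact HM|apply Hb'].
Qed.

Lemma bdd_scal (M : R) (l : C) (A : X -> X) :
  bdd M A -> bdd (Cmod l * M) (fun x => scal l (A x)).
Proof.
intros [Hp [Hs [HM Hb]]]; repeat split.
- intros x y; rewrite Hp; mring X.
- intros m x; rewrite Hs; mring X.
- apply Rmult_le_pos; [apply Cmod_ge_0|exact HM].
- intros x; eapply Rle_trans; [exact (norm_scal l (A x))|].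
  rewrite Rmult_assoc; apply Rmult_le_compat_l; [apply Cmod_ge_0|apply Hb].
Qed.

Lemma bdd_id : bdd 1 (fun x => x).
Proof. repeat split; try lra; intros x; lra. Qed.

Lemma bdd_minus (M N : R) (A B : X -> X) :
  bdd M A -> bdd N B -> bdd (M + N) (fun x => minus (A x) (B x)).
Proof.
intros [Hp [Hs [HM Hb]]] [Hp' [Hs' [HN Hb']]]; repeat split.
- intros x y; rewrite Hp', Hp; mring X.
- intros l x; rewrite Hs', Hs; mring X.
- lra.
- intros x; eapply Rle_trans; [apply norm_minus_le|].
  rewrite Rmult_plus_distr_r; apply Rplus_le_compat; auto.
Qed.

Lemma bdd_continuous (M : R) (B : X -> X) (x : X) : bdd M B -> continuous B x.
Proof. intros H; apply (linear_cont B), (bdd_linear M), H. Qed.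

Lemma bdd_restr_linear (M : R) (B : X -> X) : bdd M B -> is_linear (U := XR) (V := XR) B.
Proof.
intros [Hp [Hs [HM Hb]]]; constructor; [exact Hp|intros k x; apply Hs|].
exists (M + 1); split; [lra|]; intros x; eapply Rle_trans; [apply Hb|].
apply Rmult_le_compat_r; [apply norm_ge_0|lra].
Qed.

Lemma op_norm_le (M : R) (B : X -> X) : bdd M B -> op_norm B <= M /\
  forall x, norm x <= 1 -> norm (B x) <= op_norm B.
Proof.
intros [_ [_ [HM Hb]]].
set (E := fun r => exists x : X, norm x <= 1 /\ r = norm (B x)).
change (op_norm B) with (real (Lub_Rbar E)).
destruct (Lub_Rbar_correct E) as [H1 H2].
assert (H3 : Rbar_le (Lub_Rbar E) M).
{ apply H2; intros r [x [Hx ->]]; simpl.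
  eapply Rle_trans; [apply Hb|]; rewrite <- (Rmult_1_r M) at 2.
  apply Rmult_le_compat_l; assumption. }
assert (H4 : forall x, norm x <= 1 -> Rbar_le (norm (B x)) (Lub_Rbar E))
  by (intros x Hx; apply H1; exists x; auto).
(* The zero vector makes the set nonempty, which excludes minus infinity as its supremum; [H3]
   excludes plus infinity. *)
assert (H5 : norm (zero : X) <= 1) by (rewrite norm_zero_eq; lra).
specialize (H4 _ H5) as H6.
destruct (Lub_Rbar E); simpl in *; [|contradiction..]; split; assumption.
Qed.

(** [norm_scal] is only an inequality; for [l <> 0] the converse is the same inequality for [Cinv l]
    and the vector [scal l x]. *)
Lemma norm_scal_eq (l : C) (x : X) : norm (scal l x) = Cmod l * norm x.
Proof.
apply Rle_antisym; [exact (norm_scal l x)|].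
destruct (Ceq_dec l (RtoC 0)) as [->|Hl].
- rewrite Cmod_0, Rmult_0_l; apply norm_ge_0.
- assert (E : x = scal (Cinv l) (scal l x)).
  { mring_with X ltac:(try ring; try (field; exact Hl)). }
  rewrite E at 1; eapply Rle_trans.
  + apply Rmult_le_compat_l; [apply Cmod_ge_0|exact (norm_scal (Cinv l) _)].
  + change (abs (Cinv l)) with (Cmod (Cinv l)); rewrite Cmod_inv by exact Hl.
    right; field; apply Rgt_not_eq, Cmod_gt_0, Hl.
Qed.

Lemma bdd_op_norm (B : X -> X) : is_linear B -> bdd (op_norm B) B.
Proof.
intros Hl; destruct (linear_bdd B Hl) as [M HB].
destruct (op_norm_le M B HB) as [_ H4]; destruct HB as [Hp [Hs [HM Hb]]].
split; [exact Hp|split; [exact Hs|split]].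
- eapply Rle_trans; [apply (norm_ge_0 (B zero))|apply H4].
  rewrite norm_zero_eq; lra.
- intros x; destruct (Req_dec (norm x) 0) as [H0|H0].
  + rewrite H0, Rmult_0_r; eapply Rle_trans; [apply Hb|]; rewrite H0; lra.
  + assert (Hx : 0 < norm x) by (generalize (norm_ge_0 x); lra).
    assert (H5 := H4 (scal (RtoC (/ norm x)) x)).
    rewrite Hs, !norm_scal_eq, Cmod_R, Rabs_pos_eq in H5
      by (left; apply Rinv_0_lt_compat, Hx).
    rewrite Rinv_l in H5 by lra; specialize (H5 (Rle_refl 1)).
    apply (Rmult_le_compat_r (norm x)) in H5; [|lra].
    replace (/ norm x * norm (B x) * norm x) with (norm (B x)) in H5 by (field; lra).
    exact H5.
Qed.

Definition chlint (f : R -> X) (I : X) : Prop := hlint (V := XR) f I.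

Lemma chlint_ext (f g : R -> X) (I : X) :
  (forall s, 0 < s -> f s = g s) -> chlint f I -> chlint g I.
Proof. exact (hlint_ext (V := XR) f g I). Qed.

Lemma chlint_plus (f g : R -> X) (I J : X) :
  chlint f I -> chlint g J -> chlint (fun s => plus (f s) (g s)) (plus I J).
Proof. exact (hlint_plus (V := XR) f g I J). Qed.

Lemma chlint_bdd (M : R) (B : X -> X) (f : R -> X) (I : X) :
  bdd M B -> chlint f I -> chlint (fun s => B (f s)) (B I).
Proof.
intros HB; exact (hlint_linear (V := XR) (W := XR) B f I (bdd_restr_linear M B HB)).
Qed.

Lemma chlint_scal (l : C) (f : R -> X) (I : X) :
  chlint f I -> chlint (fun s => scal l (f s)) (scal l I).
Proof. exact (chlint_bdd _ (fun x => scal l x) f I (bdd_scal 1 l _ bdd_id)). Qed.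

Lemma chlint_minus (f g : R -> X) (I J : X) :
  chlint f I -> chlint g J -> chlint (fun s => minus (f s) (g s)) (minus I J).
Proof.
intros Hf Hg; apply chlint_plus; [exact Hf|].
apply chlint_ext with (fun s => scal (RtoC (-1)) (g s)).
- intros s _; mring_with X ltac:(try ring; apply injective_projections; simpl; ring).
- replace (opp J) with (scal (RtoC (-1)) J); [apply chlint_scal, Hg|].
  mring_with X ltac:(try ring; apply injective_projections; simpl; ring).
Qed.

Lemma chlint_unique (f : R -> X) (I J : X) : chlint f I -> chlint f J -> I = J.
Proof.
intros HI HJ; transitivity (RInt_gen (V := restr_Complete) f (at_right 0) (Rbar_locally p_infty)).
- symmetry; apply (is_RInt_gen_unique (V := restr_Complete)); exact HI.
- apply (is_RInt_gen_unique (V := restr_Complete)); exact HJ.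
Qed.

Lemma chlint_scale (f : R -> X) (I : X) (r : R) :
  0 < r -> chlint f I -> chlint (fun s => scal (RtoC r) (f (r * s))) I.
Proof. exact (hlint_scale (V := XR) f I r). Qed.

Lemma chlint_exists (sigma : R) (f : R -> X) (M rho : R) :
  0 < sigma < 1 -> 0 < rho ->
  (forall s, 0 < s -> continuous f s) ->
  (forall s, 0 < s -> norm (f s) <= M * dens sigma rho s) ->
  exists I, chlint f I.
Proof. intros Hs; exact (hlint_exists sigma Hs restr_Complete f M rho). Qed.

Lemma chlint_bound (sigma : R) (f : R -> X) (I : X) (M rho : R) :
  0 < sigma < 1 -> 0 < rho -> chlint f I ->
  (forall s, 0 < s -> norm (f s) <= M * dens sigma rho s) -> norm I <= M.
Proof. intros Hs; exact (hlint_bound sigma Hs (V := XR) f I M rho). Qed.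

Lemma chlint_const (g : R -> R) (J : R) (x : X) :
  hlint g J -> chlint (fun s => scal (RtoC (g s)) x) (scal (RtoC J) x).
Proof.
intros Hg; refine (hlint_linear (W := XR) (fun r : R => scal (RtoC r) x : XR) g J _ Hg).
exact (is_linear_scal_l (V := XR) x).
Qed.

Definition rad (n : nat) (x : nat -> X) : R := norm (sign_sums (V := XR) n zero x).

Lemma rad_ge0 (n : nat) (x : nat -> X) : 0 <= rad n x.
Proof. apply norm_ge_0. Qed.

Lemma rad_ext (n : nat) (x y : nat -> X) :
  (forall k, (1 <= k <= n)%nat -> x k = y k) -> rad n x = rad n y.
Proof. intros H; unfold rad; f_equal; apply (sign_sums_ext XR), H. Qed.

Lemma rad_plus (n : nat) (x y : nat -> X) :
  rad n (fun k => plus (x k) (y k)) <= rad n x + rad n y.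
Proof.
unfold rad.
assert (E := sign_sums_plus XR n zero zero x y).
replace (sign_sums (V := XR) n zero (fun k => plus (x k) (y k)))
  with (plus (sign_sums (V := XR) n zero x) (sign_sums (V := XR) n zero y)).
- exact (norm_triangle (V := sign_space XR n) _ _).
- rewrite <- E; f_equal; exact (plus_zero_r (G := XR) zero).
Qed.

Lemma rad_map (n : nat) (M : R) (B : X -> X) (x : nat -> X) :
  bdd M B -> rad n (fun k => B (x k)) <= M * rad n x.
Proof.
intros HB; unfold rad.
replace (sign_sums (V := XR) n zero (fun k => B (x k)))
  with (sign_sums (V := XR) n (B zero) (fun k => B (x k)))
  by (f_equal; exact (bdd_zero M B HB)).
destruct HB as [Hp [Hs [HM Hb]]].
apply (sign_sums_map_le XR n M B); try assumption.
intros y; exact (bdd_opp M B y (conj Hp (conj Hs (conj HM Hb)))).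
Qed.

Lemma rad_scal (n : nat) (l : C) (x : nat -> X) :
  rad n (fun k => scal l (x k)) <= Cmod l * rad n x.
Proof.
replace (Cmod l) with (Cmod l * 1) by ring.
exact (rad_map n _ (fun y => scal l y) x (bdd_scal 1 l _ bdd_id)).
Qed.

Lemma rad_contraction_R (n : nat) (a : nat -> R) (x : nat -> X) :
  (forall k, (1 <= k <= n)%nat -> Rabs (a k) <= 1) ->
  rad n (fun k => scal (RtoC (a k)) (x k)) <= rad n x.
Proof. exact (sign_sums_contraction XR n a zero x). Qed.

Lemma Rabs_Re_le (z : C) : Rabs (Re z) <= Cmod z.
Proof.
eapply Rle_trans; [|apply Rmax_Cmod]; apply Rmax_l.
Qed.

Lemma Rabs_Im_le (z : C) : Rabs (Im z) <= Cmod z.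
Proof.
eapply Rle_trans; [|apply Rmax_Cmod]; apply Rmax_r.
Qed.

(** Kahane's contraction principle for complex coefficients: the real one is applied to the real and
    to the imaginary parts, hence the factor [2]. *)
Lemma rad_contraction (n : nat) (M : R) (a : nat -> C) (x : nat -> X) :
  0 < M -> (forall k, (1 <= k <= n)%nat -> Cmod (a k) <= M) ->
  rad n (fun k => scal (a k) (x k)) <= 2 * M * rad n x.
Proof.
intros HM Ha.
set (u := fun k => Re (a k) / M); set (v := fun k => Im (a k) / M).
assert (Hb : forall r : R, Rabs r <= M -> Rabs (r / M) <= 1).
{ intros r Hr; unfold Rdiv; rewrite Rabs_mult, (Rabs_pos_eq (/ M)).
  - apply (Rmult_le_reg_r M); [exact HM|]; rewrite Rmult_assoc, Rinv_l; lra.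
  - left; apply Rinv_0_lt_compat, HM. }
rewrite (rad_ext n _ (fun k => plus (scal (RtoC M) (scal (RtoC (u k)) (x k)))
   (scal (Cmult (RtoC M) Ci) (scal (RtoC (v k)) (x k))))).
- eapply Rle_trans; [apply rad_plus|].
  replace (2 * M * rad n x) with (M * rad n x + M * rad n x) by ring.
  apply Rplus_le_compat; (eapply Rle_trans; [apply rad_scal|]).
  + rewrite Cmod_R, Rabs_pos_eq by lra.
    apply Rmult_le_compat_l; [lra|]; apply rad_contraction_R.
    intros k Hk; apply Hb; eapply Rle_trans; [apply Rabs_Re_le|apply Ha, Hk].
  + rewrite Cmod_mult, Cmod_R, Rabs_pos_eq by lra.
    replace (Cmod Ci) with 1.
    * rewrite Rmult_1_r; apply Rmult_le_compat_l; [lra|]; apply rad_contraction_R.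
      intros k Hk; apply Hb; eapply Rle_trans; [apply Rabs_Im_le|apply Ha, Hk].
    * unfold Cmod; simpl; rewrite <- sqrt_1 at 1; f_equal; ring.
- intros k _; mring_with X ltac:(try ring).
  unfold u, v, Re, Im; apply injective_projections; simpl; field; lra.
Qed.

(** This is how an [R]-bound passes through an integral: the [n] integrands form one function with
    values in [sign_space XR n], and a Rademacher estimate for each [s] is a bound on its norm. *)
Lemma rad_int (sigma : R) (n : nat) (f : nat -> R -> X) (J : nat -> X) (M rho : R) :
  0 < sigma < 1 -> 0 < rho ->
  (forall k, (1 <= k <= n)%nat -> chlint (f k) (J k)) ->
  (forall s, 0 < s -> rad n (fun k => f k s) <= M * dens sigma rho s) ->
  rad n J <= M.
Proof.
intros Hs Hr Hf Hb.
refine (hlint_bound sigma Hs (V := sign_space XR n)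
  (fun s => sign_sums (V := XR) n zero (fun k => f k s)) _ M rho Hr _ Hb).
apply hlint_sign_sums; [|exact Hf].
(* The starting vector [zero] of [sign_sums] must also be an integral over the half-line; it is
   obtained as the integral of [dens] times [zero]. *)
assert (H := chlint_const (dens sigma 1) 1 zero (hlint_dens sigma Hs 1 Rlt_0_1)).
assert (E : forall r : R, scal (RtoC r) zero = zero :> X) by (intros r; exact (scal_zero_r _)).
rewrite E in H; apply (chlint_ext _ (fun _ => zero)) in H; [exact H|intros; apply E].
Qed.

(** Both L^2 norms carry the same factor [1 / sqrt (2 ^ n)], which cancels. *)
Lemma R_bounded_rad (E : (X -> X) -> Prop) :
  R_bounded E <->
  (forall T, E T -> is_linear T) /\
  exists K : R, 0 < K /\ forall n (T : nat -> X -> X) (x : nat -> X),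
    (forall k, (1 <= k <= n)%nat -> E (T k)) ->
    rad n (fun k => T k (x k)) <= K * rad n x.
Proof.
assert (H : forall n K a b, a / sqrt (2 ^ n) <= K * (b / sqrt (2 ^ n)) <-> a <= K * b).
{ intros n K a b.
  assert (Hn : 0 < sqrt (2 ^ n)) by (apply sqrt_lt_R0, pow_lt; lra).
  replace (K * (b / sqrt (2 ^ n))) with (K * b / sqrt (2 ^ n)) by (field; lra).
  split; intros Hab.
  - apply (Rmult_le_reg_r (/ sqrt (2 ^ n))); [apply Rinv_0_lt_compat, Hn|exact Hab].
  - apply Rmult_le_compat_r; [left; apply Rinv_0_lt_compat, Hn|exact Hab]. }
unfold R_bounded; split; intros [HE [K [HK HR]]]; (split; [exact HE|]);
  exists K; (split; [exact HK|]); intros n T x HT; specialize (HR n T x HT).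
- rewrite (L2_norm_rademacher X n (fun k => T k (x k))), (L2_norm_rademacher X n x) in HR.
  apply H in HR; exact HR.
- rewrite (L2_norm_rademacher X n (fun k => T k (x k))), (L2_norm_rademacher X n x).
  apply H; exact HR.
Qed.

End Bounded.

Arguments bdd {X} M B.
Arguments chlint {X} f I.
Arguments rad {X} n x.

(** * Sectors and the kernel of the fractional power *)

Lemma C_ext (z w : C) : Re z = Re w -> Im z = Im w -> z = w.
Proof. intros H1 H2; apply injective_projections; assumption. Qed.

(** The angle is an arbitrary real number, not a principal value: products add angles exactly, and
    multiplying the angle by [sigma] selects a branch of the power without ambiguity. *)
Definition pol (r t : R) : C := (r * cos t, r * sin t).

Lemma pol_mult (r s a b : R) : Cmult (pol r a) (pol s b) = pol (r * s) (a + b).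
Proof. apply C_ext; simpl; rewrite ?cos_plus, ?sin_plus; ring. Qed.

Lemma pol_scal (r s a : R) : Cmult (RtoC r) (pol s a) = pol (r * s) a.
Proof. apply C_ext; simpl; ring. Qed.

Lemma pol_Cexp_i (r a b : R) : Cmult (pol r a) (Cexp_i b) = pol r (a + b).
Proof. apply C_ext; simpl; rewrite ?cos_plus, ?sin_plus; ring. Qed.

Lemma pol_0 (r : R) : pol r 0 = RtoC r.
Proof. apply C_ext; simpl; rewrite ?cos_0, ?sin_0; ring. Qed.

Lemma sin2_cos2' (t : R) : sin t * sin t + cos t * cos t = 1.
Proof. exact (sin2_cos2 t). Qed.

Lemma Cmod_pol (r t : R) : 0 <= r -> Cmod (pol r t) = r.
Proof.
intros Hr; unfold Cmod, pol; simpl; generalize (sin2_cos2' t); intros H.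
transitivity (sqrt (r * r)); [f_equal|apply sqrt_square, Hr].
transitivity (r * r * (sin t * sin t + cos t * cos t)); [ring|rewrite H; ring].
Qed.

Lemma Cmod_gt_0_neq (z : C) : 0 < Cmod z -> z <> RtoC 0.
Proof. intros H ->; rewrite Cmod_0 in H; lra. Qed.

Lemma pol_neq0 (r t : R) : 0 < r -> pol r t <> RtoC 0.
Proof. intros Hr; apply Cmod_gt_0_neq; rewrite Cmod_pol; lra. Qed.

Lemma Rabs_Carg (z : C) : Rabs (Carg z) = acos (Re z / Cmod z).
Proof.
unfold Carg; destruct (acos_bound (Re z / Cmod z)) as [H _].
destruct (Rle_dec 0 (Im z)); rewrite ?Rabs_Ropp; apply Rabs_pos_eq, H.
Qed.

Lemma cos_Rabs (t : R) : cos (Rabs t) = cos t.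
Proof. unfold Rabs; destruct (Rcase_abs t); [apply cos_neg|reflexivity]. Qed.

Lemma Rabs_Carg_pol (r t : R) : 0 < r -> Rabs t <= PI ->
  Rabs (Carg (pol r t)) = Rabs t.
Proof.
intros Hr Ht; rewrite Rabs_Carg, Cmod_pol by lra.
replace (Re (pol r t) / r) with (cos (Rabs t)).
- apply acos_cos; split; [apply Rabs_pos|exact Ht].
- rewrite cos_Rabs; unfold Re, pol; simpl; field; lra.
Qed.

Lemma Re_Cmod_bound (z : C) : z <> RtoC 0 -> -1 <= Re z / Cmod z <= 1.
Proof.
intros Hz; assert (H := proj1 (Cmod_gt_0 z) Hz).
assert (H1 := Rabs_Re_le z); apply Rabs_le_between in H1.
split; [apply (proj1 (Rle_div_r _ _ _ H))|apply (proj2 (Rle_div_l _ _ _ H))]; lra.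
Qed.

Lemma Cmod_sq (z : C) : Cmod z ^ 2 = Re z ^ 2 + Im z ^ 2.
Proof.
unfold Cmod, Re, Im; apply pow2_sqrt.
generalize (pow2_ge_0 (fst z)) (pow2_ge_0 (snd z)); lra.
Qed.

(** The cosine is right by definition of [Carg], the sine is then right up to its sign, and the case
    distinction in [Carg] fixes the sign. *)
Lemma polar_form (z : C) : z <> RtoC 0 -> z = pol (Cmod z) (Carg z).
Proof.
intros Hz; assert (Hm := proj1 (Cmod_gt_0 z) Hz).
assert (Hb := Re_Cmod_bound z Hz).
assert (Hc : cos (Carg z) = Re z / Cmod z).
{ rewrite <- cos_Rabs, Rabs_Carg; apply cos_acos, Hb. }
apply C_ext; unfold pol; simpl; rewrite ?Hc; [field; lra|].
assert (Hs : (Cmod z * sin (Carg z)) ^ 2 = Im z ^ 2).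
{ rewrite Rpow_mult_distr.
  replace (sin (Carg z) ^ 2) with (1 - cos (Carg z) ^ 2)
    by (generalize (sin2_cos2' (Carg z)); intros; lra).
  rewrite Hc; generalize (Cmod_sq z); intros H.
  transitivity (Cmod z ^ 2 - Re z ^ 2); [field; lra|lra]. }
assert (Hsign : (0 <= Im z -> 0 <= sin (Carg z)) /\ (Im z < 0 -> sin (Carg z) <= 0)).
{ assert (H1 := acos_bound (Re z / Cmod z)); unfold Carg.
  destruct (Rle_dec 0 (Im z)); split; intros; try lra.
  - apply sin_ge_0; lra.
  - rewrite sin_neg; assert (0 <= sin (acos (Re z / Cmod z))); [apply sin_ge_0|]; lra. }
destruct Hsign as [S1 S2].
destruct (Rle_lt_dec 0 (Im z)) as [H|H].
- specialize (S1 H); assert (0 <= Cmod z * sin (Carg z)) by (apply Rmult_le_pos; lra).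
  unfold Im in *; nra.
- specialize (S2 H); assert (0 <= Cmod z * - sin (Carg z)) by (apply Rmult_le_pos; lra).
  unfold Im in *; nra.
Qed.

Lemma sector_pol (theta r t : R) :
  0 < r -> Rabs t <= theta -> theta < PI -> sector theta (pol r t).
Proof.
intros Hr Ht Hth; left; split; [apply pol_neq0, Hr|].
rewrite Rabs_Carg_pol; lra.
Qed.

Lemma sector_Carg (theta : R) (z : C) : sector theta z -> z <> RtoC 0 ->
  Rabs (Carg z) <= theta.
Proof. intros [[_ H]|H] Hz; [exact H|contradiction]. Qed.

(** Monotonicity of the cosine on [[0, PI]] replaces the condition on the argument by an inequality
    linear in [Re z] and [Cmod z], for acute and obtuse angles alike. *)
Lemma sector_Re (theta : R) (z : C) : 0 <= theta < PI -> z <> RtoC 0 ->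
  sector theta z <-> Cmod z * cos theta <= Re z.
Proof.
intros Ht Hz; assert (Hm := proj1 (Cmod_gt_0 z) Hz).
assert (Hb := Re_Cmod_bound z Hz); assert (Hac := acos_bound (Re z / Cmod z)).
assert (E : cos theta <= Re z / Cmod z <-> Cmod z * cos theta <= Re z).
{ rewrite <- (Rle_div_r _ _ _ Hm), Rmult_comm; reflexivity. }
rewrite <- E; split; intros H.
- apply sector_Carg in H; [|exact Hz]; rewrite Rabs_Carg in H.
  rewrite <- (cos_acos (Re z / Cmod z)) by exact Hb.
  apply cos_decr_1; lra.
- left; split; [exact Hz|]; rewrite Rabs_Carg.
  apply cos_decr_0; try lra; rewrite cos_acos by exact Hb; exact H.
Qed.

(** From [|z| cos theta <= Re z], [|z + c|^2] is at least [|z|^2 + c^2 + 2 |z| c cos theta], which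
    is the left-hand side plus [(1 - cos theta) / 2 * (|z| - c)^2]. *)
Lemma Cmod_add_pos_lower (theta c : R) (z : C) :
  0 <= theta < PI -> sector theta z -> z <> RtoC 0 -> 0 <= c ->
  (1 + cos theta) / 2 * (Cmod z + c) ^ 2 <= Cmod (Cplus z (RtoC c)) ^ 2.
Proof.
intros Ht Hs Hz Hc; apply sector_Re in Hs; [|exact Ht|exact Hz].
assert (E := Cmod_sq z); assert (Hm := Cmod_ge_0 z).
rewrite Cmod_sq; simpl (Re _); simpl (Im _).
unfold Re, Im in *; rewrite Rplus_0_r.
assert (H1 : Cmod z * cos theta * c <= fst z * c) by (apply Rmult_le_compat_r; lra).
assert (H2 := COS_bound theta).
assert (H3 : 0 <= (1 - cos theta) * (Cmod z - c) ^ 2)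
  by (apply Rmult_le_pos; [lra|apply pow2_ge_0]).
nra.
Qed.

Lemma sector_add_pos (theta c : R) (z : C) :
  0 <= theta < PI -> sector theta z -> z <> RtoC 0 -> 0 <= c ->
  Cplus z (RtoC c) <> RtoC 0 /\ sector theta (Cplus z (RtoC c)).
Proof.
intros Ht Hs Hz Hc.
assert (Hm := proj1 (Cmod_gt_0 z) Hz).
assert (Hlow := Cmod_add_pos_lower theta c z Ht Hs Hz Hc).
assert (H1 : -1 < cos theta).
{ rewrite <- cos_PI; apply cos_decreasing_1; lra. }
assert (Hw : Cplus z (RtoC c) <> RtoC 0).
{ apply Cmod_gt_0_neq.
  assert (0 < (1 + cos theta) / 2 * (Cmod z + c) ^ 2).
  { apply Rmult_lt_0_compat; [lra|apply pow_lt; lra]. }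
  generalize (Cmod_ge_0 (Cplus z (RtoC c))); intros [H2|H2]; [exact H2|].
  rewrite <- H2 in Hlow; lra. }
split; [exact Hw|].
apply sector_Re in Hs; [|exact Ht|exact Hz].
apply sector_Re; [exact Ht|exact Hw|].
assert (T1 : Cmod (Cplus z (RtoC c)) <= Cmod z + c).
{ eapply Rle_trans; [apply Cmod_triangle|]; rewrite Cmod_R, Rabs_pos_eq; lra. }
assert (T2 : Cmod z <= Cmod (Cplus z (RtoC c)) + c).
{ replace z with (Cplus (Cplus z (RtoC c)) (RtoC (- c))) at 1
    by (apply C_ext; unfold Re, Im; simpl; ring).
  eapply Rle_trans; [apply Cmod_triangle|].
  rewrite Cmod_R, Rabs_Ropp, Rabs_pos_eq; lra. }
change (Re (Cplus z (RtoC c))) with (Re z + c).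
(* The sign of [cos theta] decides which triangle inequality is useful: an upper bound of [|z + c|]
   when it is nonnegative, a lower bound when it is negative. *)
destruct (Rle_lt_dec 0 (cos theta)) as [H|H].
- apply Rle_trans with ((Cmod z + c) * cos theta); [nra|].
  generalize (COS_bound theta); nra.
- nra.
Qed.

Lemma Cmod_real_add_pol_lower (a b psi : R) : 0 <= a -> 0 <= b ->
  (1 + cos psi) / 2 * (a + b) ^ 2 <= Cmod (Cplus (RtoC a) (pol b psi)) ^ 2.
Proof.
intros Ha Hb; rewrite Cmod_sq; unfold Re, Im; simpl.
assert (H := sin2_cos2' psi); assert (H2 := COS_bound psi).
assert (H3 : 0 <= (1 - cos psi) * (a - b) ^ 2)
  by (apply Rmult_le_pos; [lra|apply pow2_ge_0]).
replace ((0 + b * sin psi) * ((0 + b * sin psi) * 1))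
  with (b * b * (1 - cos psi * cos psi)).
- nra.
- replace (1 - cos psi * cos psi) with (sin psi * sin psi) by lra; ring.
Qed.

(** * Continuity of scalar functions, by coordinates *)

Definition rcont (f : R -> R) (s : R) : Prop :=
  continuous (T := R_UniformSpace) (U := R_UniformSpace) f s.

Definition ccont (k : R -> C) (s : R) : Prop :=
  rcont (fun s => Re (k s)) s /\ rcont (fun s => Im (k s)) s.

Lemma rcont_plus (f g : R -> R) (s : R) :
  rcont f s -> rcont g s -> rcont (fun s => f s + g s) s.
Proof. exact (continuous_plus (V := R_NormedModule) f g s). Qed.

Lemma rcont_opp (f : R -> R) (s : R) : rcont f s -> rcont (fun s => - f s) s.
Proof. exact (continuous_opp (V := R_NormedModule) f s). Qed.

Lemma rcont_mult (f g : R -> R) (s : R) :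
  rcont f s -> rcont g s -> rcont (fun s => f s * g s) s.
Proof. exact (continuous_mult (K := R_AbsRing) f g s). Qed.

Lemma rcont_const (c s : R) : rcont (fun _ => c) s.
Proof. apply continuous_const. Qed.

Lemma rcont_inv (f : R -> R) (s : R) :
  f s <> 0 -> rcont f s -> rcont (fun s => / f s) s.
Proof.
intros H Hf; apply (continuous_comp f Rinv); [exact Hf|apply continuous_Rinv, H].
Qed.

Lemma rcont_ext (f g : R -> R) (s : R) :
  (forall s, f s = g s) -> rcont f s -> rcont g s.
Proof. apply continuous_ext. Qed.

Lemma ccont_const (c : C) (s : R) : ccont (fun _ => c) s.
Proof. split; apply rcont_const. Qed.

Lemma ccont_RtoC (f : R -> R) (s : R) : rcont f s -> ccont (fun s => RtoC (f s)) s.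
Proof. intros H; split; [exact H|apply rcont_const]. Qed.

Lemma ccont_plus (f g : R -> C) (s : R) :
  ccont f s -> ccont g s -> ccont (fun s => Cplus (f s) (g s)) s.
Proof.
intros [F1 F2] [G1 G2]; split; [exact (rcont_plus _ _ s F1 G1)|exact (rcont_plus _ _ s F2 G2)].
Qed.

Lemma ccont_mult (f g : R -> C) (s : R) :
  ccont f s -> ccont g s -> ccont (fun s => Cmult (f s) (g s)) s.
Proof.
intros [F1 F2] [G1 G2]; split.
- exact (rcont_plus _ _ s (rcont_mult _ _ s F1 G1)
    (rcont_opp _ s (rcont_mult _ _ s F2 G2))).
- exact (rcont_plus _ _ s (rcont_mult _ _ s F1 G2) (rcont_mult _ _ s F2 G1)).
Qed.

Lemma ccont_inv (f : R -> C) (s : R) :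
  f s <> RtoC 0 -> ccont f s -> ccont (fun s => Cinv (f s)) s.
Proof.
intros H [F1 F2].
assert (F : rcont (fun s => / (Re (f s) ^ 2 + Im (f s) ^ 2)) s).
{ apply rcont_inv.
  - rewrite <- Cmod_sq; apply pow_nonzero, Rgt_not_eq, Cmod_gt_0, H.
  - apply rcont_ext with (fun s => Re (f s) * Re (f s) + Im (f s) * Im (f s));
      [intros; ring|].
    apply rcont_plus; apply rcont_mult; assumption. }
split.
- exact (rcont_mult _ _ s F1 F).
- exact (rcont_mult _ _ s (rcont_opp _ s F2) F).
Qed.

(** A complex scalar acts as a real one plus [Ci] times a real one, which leaves the continuity of
    real scalar multiplication in the restricted module. *)
Lemma cont_scal {X : CompleteNormedModule C_AbsRing} (k : R -> C) (F : R -> X) (s : R) :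
  ccont k s -> continuous F s -> continuous (fun s => scal (k s) (F s)) s.
Proof.
intros [K1 K2] HF.
apply (continuous_ext (fun s => plus (scal (RtoC (Re (k s))) (F s))
   (scal Ci (scal (RtoC (Im (k s))) (F s))))).
{ intros t; mring_with X ltac:(try ring; apply C_ext; unfold Re, Im; simpl; ring). }
apply (continuous_plus (V := X)).
- exact (continuous_scal (K := R_AbsRing) (V := restr_NormedModule X) _ F s K1 HF).
- apply (continuous_comp (fun s => scal (RtoC (Im (k s))) (F s)) (fun x => scal Ci x)).
  + exact (continuous_scal (K := R_AbsRing) (V := restr_NormedModule X) _ F s K2 HF).
  + apply (bdd_continuous X _ _ _ (bdd_scal X 1 Ci _ (bdd_id X))).
Qed.

(** * The kernel: size, continuity and homogeneity *)

Section Kernel.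

Variable sigma : R.
Hypothesis Hsigma : 0 < sigma < 1.

Definition knl (l : C) (s : R) : C := Cmult l (frac_kernel sigma l s).

(* Infimum of [|a + b e^(i psi)|^2 / (a + b)^2] over [|psi| <= PI - delta]. *)
Definition ang (delta : R) : R := (1 - cos delta) / 2.

Lemma ang_gt0 (delta : R) : 0 < delta -> delta < PI -> 0 < ang delta.
Proof.
intros H1 H2; unfold ang.
assert (cos delta < 1); [rewrite <- cos_0; apply cos_decreasing_1|]; lra.
Qed.

Lemma Cmod_den_lower (a b psi delta : R) :
  0 <= a -> 0 <= b -> 0 < delta < PI -> Rabs psi <= PI - delta ->
  ang delta * (a + b) ^ 2 <= Cmod (Cplus (RtoC a) (pol b psi)) ^ 2.
Proof.
intros Ha Hb Hd Hp; eapply Rle_trans; [|apply Cmod_real_add_pol_lower; assumption].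
apply Rmult_le_compat_r; [apply pow2_ge_0|].
assert (E : cos (PI - delta) = - cos delta) by (rewrite cos_minus, cos_PI, sin_PI; ring).
unfold ang; assert (cos (PI - delta) <= cos psi); [|lra].
rewrite <- (cos_Rabs psi); apply cos_decr_1; try lra; apply Rabs_pos.
Qed.

Lemma knl_den (rho al s : R) :
  knl (pol rho al) s =
  Cmult (pol rho al) (Cdiv (RtoC (Rpower s sigma))
    (Cmult (Cplus (RtoC (Rpower s sigma)) (pol rho (al + PI * sigma)))
           (Cplus (RtoC (Rpower s sigma)) (pol rho (al + - (PI * sigma)))))).
Proof. unfold knl, frac_kernel; rewrite !pol_Cexp_i; reflexivity. Qed.

(** The denominator degenerates when one of the angles [al + PI sigma], [al - PI sigma] reaches [PI]
    or [-PI]; a margin [delta] for [al] is the same margin for both. *)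
Lemma knl_angles (delta al : R) : 0 < delta -> Rabs al <= PI * (1 - sigma) - delta ->
  delta < PI /\ Rabs (al + PI * sigma) <= PI - delta /\
  Rabs (al + - (PI * sigma)) <= PI - delta.
Proof.
intros Hd Ha; assert (HP := PI_RGT_0); assert (0 <= Rabs al) by apply Rabs_pos.
assert (0 < PI * sigma) by (apply Rmult_lt_0_compat; lra).
apply Rabs_le_between in Ha.
repeat split; [lra|apply Rabs_le; lra|apply Rabs_le; lra].
Qed.

(** Each factor of the denominator has modulus at least [sqrt (ang delta) * (s^sigma + rho)], and
    the product of these two bounds is the denominator of [dens] up to constants and the factor
    [s]. *)
Lemma knl_bound (delta rho al s : R) :
  0 < delta -> Rabs al <= PI * (1 - sigma) - delta -> 0 < rho -> 0 < s ->
  Cmod (knl (pol rho al) s) <= / (sigma * ang delta) * (s * dens sigma rho s).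
Proof.
intros Hd Ha Hr Hs; destruct (knl_angles _ _ Hd Ha) as [Hd' [H1 H2]].
assert (Hp := Rpower_gt0 s sigma); set (p := Rpower s sigma) in *.
assert (Hk := ang_gt0 delta Hd Hd').
rewrite knl_den; fold p.
assert (L1 := Cmod_den_lower p rho _ delta ltac:(lra) ltac:(lra) (conj Hd Hd') H1).
assert (L2 := Cmod_den_lower p rho _ delta ltac:(lra) ltac:(lra) (conj Hd Hd') H2).
set (z1 := Cplus (RtoC p) (pol rho (al + PI * sigma))) in *.
set (z2 := Cplus (RtoC p) (pol rho (al + - (PI * sigma)))) in *.
assert (Hpos : 0 < ang delta * (p + rho) ^ 2).
{ apply Rmult_lt_0_compat; [exact Hk|apply pow_lt; lra]. }
assert (M1 : 0 < Cmod z1).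
{ destruct (Cmod_ge_0 z1) as [H|H]; [exact H|rewrite <- H in L1; lra]. }
assert (M2 : 0 < Cmod z2).
{ destruct (Cmod_ge_0 z2) as [H|H]; [exact H|rewrite <- H in L2; lra]. }
assert (L : ang delta * (p + rho) ^ 2 <= Cmod z1 * Cmod z2).
{ apply Rsqr_incr_0_var; [|apply Rmult_le_pos; lra].
  unfold Rsqr.
  apply Rle_trans with (Cmod z1 ^ 2 * Cmod z2 ^ 2); [|right; ring].
  apply Rmult_le_compat; lra. }
rewrite Cmod_mult, Cmod_div, Cmod_mult, Cmod_pol, Cmod_R, Rabs_pos_eq by
  (try lra; apply Cmult_neq_0; apply Cmod_gt_0_neq; assumption).
apply Rle_trans with (rho * (p / (ang delta * (p + rho) ^ 2))).
- apply Rmult_le_compat_l; [lra|]; apply Rmult_le_compat_l; [lra|].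
  apply Rinv_le_contravar; assumption.
- right; unfold dens; fold p; field; repeat split; lra.
Qed.

Lemma knl_den_neq0 (delta rho psi s : R) : 0 < delta < PI -> Rabs psi <= PI - delta ->
  0 < rho -> Cplus (RtoC (Rpower s sigma)) (pol rho psi) <> RtoC 0.
Proof.
intros Hd Hpsi Hr E; assert (Hp := Rpower_gt0 s sigma).
assert (L := Cmod_den_lower (Rpower s sigma) rho psi delta ltac:(lra) ltac:(lra) Hd Hpsi).
rewrite E, Cmod_0 in L.
assert (0 < ang delta * (Rpower s sigma + rho) ^ 2); [|lra].
apply Rmult_lt_0_compat; [apply ang_gt0; lra|apply pow_lt; lra].
Qed.

Lemma ccont_knl (delta rho al s : R) :
  0 < delta -> Rabs al <= PI * (1 - sigma) - delta -> 0 < rho -> 0 < s ->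
  ccont (knl (pol rho al)) s.
Proof.
intros Hd Ha Hr Hs; destruct (knl_angles _ _ Hd Ha) as [Hd' [H1 H2]].
assert (HR : ccont (fun s => RtoC (Rpower s sigma)) s).
{ apply ccont_RtoC, continuous_Rpower, Hs. }
assert (Hc : ccont (fun s => Cmult (pol rho al) (Cdiv (RtoC (Rpower s sigma))
    (Cmult (Cplus (RtoC (Rpower s sigma)) (pol rho (al + PI * sigma)))
           (Cplus (RtoC (Rpower s sigma)) (pol rho (al + - (PI * sigma))))))) s).
{ apply ccont_mult; [apply ccont_const|].
  apply ccont_mult; [exact HR|].
  apply ccont_inv; [apply Cmult_neq_0; apply (knl_den_neq0 delta); auto|].
  apply ccont_mult; apply ccont_plus; try exact HR; apply ccont_const. }
destruct Hc as [C1 C2]; split.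
- revert C1; apply rcont_ext; intros t; rewrite knl_den; reflexivity.
- revert C2; apply rcont_ext; intros t; rewrite knl_den; reflexivity.
Qed.

(** Homogeneity of degree [0] under [l -> r^sigma l], [s -> r s]: a factor [r^(2 sigma)] cancels.
    The multiplication by [l] in [knl] is what makes the degree vanish. *)
Lemma knl_scale (delta rho al r s : R) :
  0 < delta -> Rabs al <= PI * (1 - sigma) - delta -> 0 < rho -> 0 < r -> 0 < s ->
  knl (pol (Rpower r sigma * rho) al) (r * s) = knl (pol rho al) s.
Proof.
intros Hd Ha Hr0 Hr Hs; destruct (knl_angles _ _ Hd Ha) as [Hd' [H1 H2]].
assert (N1 := knl_den_neq0 delta rho _ s (conj Hd Hd') H1 Hr0).
assert (N2 := knl_den_neq0 delta rho _ s (conj Hd Hd') H2 Hr0).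
assert (Hq : RtoC (Rpower r sigma) <> RtoC 0).
{ intros E; apply RtoC_inj in E; generalize (Rpower_gt0 r sigma); lra. }
rewrite !knl_den, <- Rpower_mult_distr by assumption.
rewrite <- !pol_scal, RtoC_mult.
set (q := RtoC (Rpower r sigma)) in *; set (p := RtoC (Rpower s sigma)) in *.
rewrite <- !Cmult_plus_distr_l; field; repeat split; assumption.
Qed.

End Kernel.

(** * Resolvents *)

Section Resolvents.

Variable X : CompleteNormedModule C_AbsRing.

(** A relational form of [S = (A + w)^-1]: it can be verified for an operator built by hand and
    avoids the description operator in [op_inv]. *)
Definition inverse_at (A : lin_op X) (w : C) (S : X -> X) : Prop :=
  (forall y, dom A (S y) /\ plus (app A (S y)) (scal w (S y)) = y) /\
  (forall x, dom A x -> S (plus (app A x) (scal w x)) = x).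

Lemma inverse_at_shift (A : lin_op X) (c w : C) (S : X -> X) :
  inverse_at (op_shift A c) w S <-> inverse_at A (Cplus w c) S.
Proof.
assert (E : forall x, plus (app (op_shift A c) x) (scal w x) =
              plus (app A x) (scal (Cplus w c) x)).
{ intros x; simpl; mring X. }
unfold inverse_at; split; intros [H1 H2]; split.
- intros y; rewrite <- E; apply H1.
- intros x; rewrite <- E; apply H2.
- intros y; rewrite E; apply H1.
- intros x; rewrite E; apply H2.
Qed.

Lemma inverse_unique (A : lin_op X) (w : C) (S : X -> X) (x y : X) :
  inverse_at A w S -> dom A x -> plus (app A x) (scal w x) = y -> x = S y.
Proof. intros [_ H] Hx <-; symmetry; apply H, Hx. Qed.

(** The second operator is there because [resolvent_set (op_opp A)] speaks of [op_opp (op_opp A)],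
    which is compared with [A] pointwise. *)
Lemma op_inv_eq (A B : lin_op X) (w : C) (S : X -> X) (y : X) :
  (forall x, dom A x <-> dom B x) -> (forall x, app A x = app B x) ->
  inverse_at A w S -> op_inv (op_shift B w) y = S y.
Proof.
intros Hd Ha HS; unfold op_inv; apply (iota_unique (V := X)).
- intros x [H1 H2]; apply (inverse_unique A w); [exact HS|apply Hd, H1|].
  rewrite Ha; exact H2.
- destruct (proj1 HS y) as [H1 H2]; split; [apply Hd, H1|].
  simpl; rewrite <- Ha; exact H2.
Qed.

Lemma op_inv_inverse (A : lin_op X) (w : C) (S : X -> X) (y : X) :
  inverse_at A w S -> op_inv (op_shift A w) y = S y.
Proof. apply op_inv_eq; [tauto|reflexivity]. Qed.

Lemma opp_opp_app (A : lin_op X) (x : X) : app A x = app (op_opp (op_opp A)) x.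
Proof. simpl; mring X. Qed.

Lemma resolvent_set_intro (A : lin_op X) (w : C) (M : R) (S : X -> X) :
  bdd M S -> inverse_at A w S -> resolvent_set (op_opp A) w.
Proof.
intros HB HS; split.
- intros y; exists (S y); destruct (proj1 HS y) as [H1 H2]; split.
  + split; [exact H1|]; simpl.
    transitivity (plus (app A (S y)) (scal w (S y))); [mring X|exact H2].
  + intros x [H3 H4]; symmetry; apply (inverse_unique A w); [exact HS|exact H3|].
    rewrite <- H4; simpl; mring X.
- apply is_linear_ext with S; [|apply (bdd_linear X M), HB].
  intros y; symmetry; apply (op_inv_eq A); [tauto|apply opp_opp_app|exact HS].
Qed.

Lemma resolvent_set_elim (A : lin_op X) (w : C) :
  resolvent_set (op_opp A) w ->
  is_linear (op_inv (op_shift A w)) /\ inverse_at A w (op_inv (op_shift A w)).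
Proof.
intros [Hb Hl]; set (S := op_inv (op_shift (op_opp (op_opp A)) w)) in *.
assert (HS : inverse_at A w S).
{ assert (H : forall y, dom A (S y) /\
     app (op_shift (op_opp (op_opp A)) w) (S y) = y).
  { intros y; exact (iota_correct _ (Hb y)). }
  assert (E : forall x, plus (app A x) (scal w x) =
     app (op_shift (op_opp (op_opp A)) w) x) by (intros x; simpl; mring X).
  split; intros y; [rewrite E; apply H|].
  intros Hy; rewrite E; set (z := app (op_shift (op_opp (op_opp A)) w) y).
  destruct (Hb z) as [x [_ Hu]].
  rewrite <- (Hu (S z) (H z)); apply Hu; split; [exact Hy|reflexivity]. }
assert (E : forall y, S y = op_inv (op_shift A w) y).
{ intros y; symmetry; apply op_inv_inverse, HS. }
split.
- apply is_linear_ext with S; assumption.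
- destruct HS as [H1 H2]; split.
  + intros y; rewrite <- E; apply H1.
  + intros x Hx; rewrite <- E; apply H2, Hx.
Qed.

(** Apply [S] to [x = (A + w') S' x = (A + w) S' x + (w' - w) S' x]. *)
Lemma resolvent_identity (A : lin_op X) (w w' : C) (S S' : X -> X) (M : R) (x : X) :
  bdd M S -> inverse_at A w S -> inverse_at A w' S' ->
  S x = plus (S' x) (scal (Cminus w' w) (S (S' x))).
Proof.
intros HB [_ H2] [H1 _]; destruct (H1 x) as [Hd He].
rewrite <- (H2 _ Hd) at 1; destruct HB as [Hp [Hs _]].
rewrite <- Hs, <- Hp; f_equal.
rewrite <- He at 1; mring X.
Qed.

(** For [w <> w'] both products equal the same difference quotient of the two resolvents; for
    [w = w'] the inverse is unique. *)
Lemma resolvent_commute (A : lin_op X) (w w' : C) (S S' : X -> X) (M M' : R) (x : X) :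
  bdd M S -> bdd M' S' -> inverse_at A w S -> inverse_at A w' S' ->
  S (S' x) = S' (S x).
Proof.
intros HB HB' HS HS'; destruct (Ceq_dec w w') as [<-|Hw].
- assert (E : forall y, S y = S' y).
  { intros y; destruct (proj1 HS y) as [H1 H2].
    apply (inverse_unique A w); assumption. }
  rewrite !E; reflexivity.
- assert (E1 := resolvent_identity A w w' S S' M x HB HS HS').
  assert (E2 := resolvent_identity A w' w S' S M' x HB' HS' HS).
  assert (Hn : Cminus w' w <> RtoC 0).
  { intros E; apply Hw; symmetry; transitivity (Cplus w (Cminus w' w)); [ring|].
    rewrite E; ring. }
  transitivity (scal (Cinv (Cminus w' w)) (minus (S x) (S' x))).
  + rewrite E1; mring_with X ltac:(try ring; try (field; exact Hn)).
  + rewrite E2; mring_with X ltac:(try ring; try (field; exact Hn)).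
Qed.

Lemma iter_norm_le (B : X -> X) (y : X) (n : nat) :
  bdd (/ 2) B -> norm (Nat.iter n B y) <= (/ 2) ^ n * norm y.
Proof.
intros [_ [_ [_ Hb]]]; induction n as [|n IH]; simpl; [lra|].
eapply Rle_trans; [apply Hb|]; lra.
Qed.

Lemma contraction_solve (B : X -> X) (y : X) : bdd (/ 2) B ->
  exists! x, minus x (B x) = y.
Proof.
intros HB.
destruct (ex_series_le (V := X) (fun n => Nat.iter n B y) (fun n => (/ 2) ^ n * norm y))
  as [x Hx].
- intros n; apply iter_norm_le, HB.
- apply (ex_series_scal_r (norm y)); eexists; apply is_series_geom.
  rewrite Rabs_pos_eq; lra.
- assert (H1 : filterlim (sum_n (fun n => Nat.iter n B y)) eventually (locally x)) by exact Hx.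
  assert (E : forall n, sum_n (G := X) (fun n => Nat.iter n B y) (S n) =
     plus y (B (sum_n (G := X) (fun n => Nat.iter n B y) n))).
  { induction n as [|n IH].
    - etransitivity; [exact (sum_Sn _ _)|].
      apply f_equal2; [exact (sum_O _)|].
      apply (f_equal B); exact (eq_sym (sum_O _)).
    - etransitivity; [exact (sum_Sn _ _)|].
      etransitivity; [exact (f_equal (fun z => plus z _) IH)|].
      etransitivity; [exact (eq_sym (plus_assoc (G := X) _ _ _))|]; f_equal.
      etransitivity; [exact (eq_sym (proj1 HB _ _))|].
      apply (f_equal B); exact (eq_sym (sum_Sn _ _)). }
  assert (H2 : filterlim (fun n => plus y (B (sum_n (fun n => Nat.iter n B y) n)))
     eventually (locally (plus y (B x)))).
  { apply (filterlim_comp nat X X _ (fun z => plus y (B z)) eventually (locally x)); [exact H1|].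
    apply (continuous_plus (V := X) (fun _ => y) B x);
      [apply continuous_const|apply (bdd_continuous X (/ 2)), HB]. }
  assert (H3 : filterlim (fun n => sum_n (fun n => Nat.iter n B y) (S n))
     eventually (locally x)).
  { eapply filterlim_comp; [apply eventually_subseq; intros n; apply Nat.lt_succ_diag_r|].
    exact H1. }
  assert (Ex : x = plus y (B x)).
  { apply (filterlim_locally_unique (V := X) (F := eventually)
      (fun n => sum_n (fun n => Nat.iter n B y) (S n))); [exact H3|].
    revert H2; apply filterlim_ext; intros n; symmetry; apply E. }
  exists x; split.
  + rewrite Ex at 1; mring X.
  + intros x' Hx'.
    assert (Hz : minus x x' = B (minus x x')).
    { unfold minus; rewrite (proj1 HB), (bdd_opp X _ B _ HB).
      rewrite Ex at 1; rewrite <- Hx'; mring X. }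
    assert (N : norm (minus x x') <= / 2 * norm (minus x x')).
    { rewrite Hz at 1; apply HB. }
    assert (N0 : norm (minus x x') = 0).
    { assert (H := norm_ge_0 (minus x x')); lra. }
    assert (Z := norm_eq_zero (V := X) _ N0).
    transitivity (plus x' (minus x x')); [mring X|]; rewrite Z; mring X.
Qed.

Lemma neumann_inverse (B : X -> X) : bdd (/ 2) B ->
  exists N, bdd 2 N /\ (forall y, minus (N y) (B (N y)) = y) /\
    forall x y, minus x (B x) = y -> N y = x.
Proof.
intros HB; set (N := fun y : X => iota (fun x : X => minus x (B x) = y)).
assert (HN : forall y, minus (N y) (B (N y)) = y).
{ intros y; exact (iota_correct _ (contraction_solve B y HB)). }
assert (HU : forall x y, minus x (B x) = y -> N y = x).
{ intros x y Hxy; destruct (contraction_solve B y HB) as [x0 [_ H0]].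
  rewrite <- (H0 x Hxy); symmetry; apply H0, HN. }
exists N; split; [|split; assumption].
repeat split.
- intros x y; apply HU; rewrite <- (HN x) at 3; rewrite <- (HN y) at 3.
  rewrite (proj1 HB); mring X.
- intros l x; apply HU; rewrite <- (HN x) at 3.
  rewrite (proj1 (proj2 HB)); mring X.
- lra.
- intros y.
  assert (H : norm (N y) <= norm y + / 2 * norm (N y)).
  { apply Rle_trans with (norm (plus y (B (N y)))).
    - right; f_equal; rewrite <- (HN y) at 2; mring X.
    - eapply Rle_trans; [apply norm_plus_le|].
      apply Rplus_le_compat_l, HB. }
  lra.
Qed.

(** Since [A + w + d = (1 + d S) (A + w)], the inverse is [S (1 + d S)^-1], and the Neumann series
    bounds the second factor by [2]. *)
Lemma inverse_at_perturb (A : lin_op X) (w d : C) (M : R) (S : X -> X) :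
  bdd M S -> inverse_at A w S -> Cmod d * M <= / 2 ->
  exists S', bdd (2 * M) S' /\ inverse_at A (Cplus w d) S'.
Proof.
intros HM HS Hd.
destruct (neumann_inverse (fun x => scal (Copp d) (S x))) as [N [HN1 [HN2 HN3]]].
{ apply bdd_weaken with (Cmod (Copp d) * M); [apply bdd_scal, HM|].
  rewrite Cmod_opp; exact Hd. }
exists (fun y => S (N y)); split; [|split].
- rewrite Rmult_comm; apply bdd_comp; assumption.
- intros y; destruct (proj1 HS (N y)) as [H1 H2]; split; [exact H1|].
  transitivity (minus (plus (app A (S (N y))) (scal w (S (N y))))
                      (scal (Copp d) (S (N y)))); [mring X|].
  rewrite H2; apply HN2.
- intros x Hx.
  assert (E := proj2 HS x Hx).
  rewrite <- E at 3; f_equal; apply HN3; rewrite E; mring X.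
Qed.

(** Local boundedness and a Lipschitz estimate at [s] in operator norm; this is what keeps
    [B t (F t)] continuous when the vector moves as well. *)
Definition opcont (B : R -> X -> X) (s : R) : Prop :=
  exists M L eta, 0 < eta /\ 0 <= L /\ 
    forall t, Rabs (t - s) < eta -> bdd M (B t) /\
      forall x, norm (minus (B t x) (B s x)) <= L * Rabs (t - s) * norm x.

Lemma opcont_apply (B : R -> X -> X) (F : R -> X) (s : R) :
  opcont B s -> continuous F s -> continuous (fun t => B t (F t)) s.
Proof.
intros [M [L [eta [He [HL HB]]]]] HF; apply filterlim_locally; intros eps.
destruct (HB s) as [HM _]; [rewrite Rminus_diag, Rabs_R0; exact He|].
assert (HM0 : 0 <= M) by apply HM.
set (nf := @norm_factor _ X); assert (Hnf := @norm_factor_gt_0 _ X : 0 < nf).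
assert (Hd1 : 0 < eps / (2 * (M + 1) * nf)).
{ apply Rdiv_lt_0_compat; [apply cond_pos|apply Rmult_lt_0_compat; lra]. }
assert (H1 : locally s (fun t => ball (F s) (mkposreal _ Hd1) (F t))).
{ apply HF, locally_ball. }
assert (Hn := norm_ge_0 (F s)); assert (Hl : 0 <= L * norm (F s)) by (apply Rmult_le_pos; lra).
assert (Hd2 : 0 < Rmin eta (eps / (2 * (L * norm (F s) + 1)))).
{ apply Rmin_glb_lt; [exact He|].
  apply Rdiv_lt_0_compat; [apply cond_pos|lra]. }
assert (H2 : locally s (fun t : R => Rabs (t - s) < Rmin eta (eps / (2 * (L * norm (F s) + 1))))).
{ exists (mkposreal _ Hd2); intros t Ht; exact Ht. }
generalize (filter_and _ _ H1 H2); apply filter_imp; intros t [Ht1 Ht2].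
apply (norm_compat1 (V := X)).
assert (Ht3 : Rabs (t - s) < eta) by (eapply Rlt_le_trans; [exact Ht2|apply Rmin_l]).
assert (Ht4 : Rabs (t - s) < eps / (2 * (L * norm (F s) + 1)))
  by (eapply Rlt_le_trans; [exact Ht2|apply Rmin_r]).
destruct (HB t Ht3) as [HMt HLt].
assert (Ht5 : norm (minus (F t) (F s)) < nf * (eps / (2 * (M + 1) * nf))).
{ exact (norm_compat2 (V := X) _ _ _ Ht1). }
replace (nf * (eps / (2 * (M + 1) * nf))) with (eps / (2 * (M + 1))) in Ht5 by (field; lra).
assert (E : minus (B t (F t)) (B s (F s)) =
  plus (B t (minus (F t) (F s))) (minus (B t (F s)) (B s (F s)))).
{ unfold minus; rewrite (proj1 HMt), (bdd_opp X _ _ _ HMt); mring X. }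
refine (Rle_lt_trans _ _ _ (Req_le _ _ (f_equal norm E)) _).
eapply Rle_lt_trans; [apply norm_plus_le|].
assert (P1 := proj2 (proj2 (proj2 HMt)) (minus (F t) (F s))).
assert (P2 := HLt (F s)).
assert (P3 : M * norm (minus (F t) (F s)) <= M * (eps / (2 * (M + 1))))
  by (apply Rmult_le_compat_l; lra).
assert (P4 : M * (eps / (2 * (M + 1))) <= eps / 2).
{ replace (eps / 2) with ((M + 1) * (eps / (2 * (M + 1)))) by (field; lra).
  apply Rmult_le_compat_r; [|lra].
  left; apply Rdiv_lt_0_compat; [apply cond_pos|lra]. }
assert (P5 : L * Rabs (t - s) * norm (F s) < eps / 2).
{ apply Rle_lt_trans with ((L * norm (F s)) * Rabs (t - s)); [right; ring|].
  apply Rle_lt_trans with ((L * norm (F s)) * (eps / (2 * (L * norm (F s) + 1)))).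
  - apply Rmult_le_compat_l; lra.
  - replace (eps / 2) with ((L * norm (F s) + 1) * (eps / (2 * (L * norm (F s) + 1))))
      by (field; lra).
    apply Rmult_lt_compat_r; [|lra].
    apply Rdiv_lt_0_compat; [apply cond_pos|lra]. }
lra.
Qed.

Lemma Rabs_sin_le (x : R) : Rabs (sin x) <= Rabs x.
Proof.
destruct (MVT_gen sin 0 x cos) as [c [_ E]].
- intros y _; apply is_derive_sin.
- intros y _; apply continuity_sin.
- rewrite sin_0, !Rminus_0_r in E; rewrite E, Rabs_mult.
  assert (H : Rabs (cos c) <= 1) by (apply Rabs_le, COS_bound).
  generalize (Rabs_pos x); nra.
Qed.

(** The left-hand side is the squared chord of the unit circle for the angle [x], equal to
    [4 sin^2 (x / 2)]. *)
Lemma cos_lower (x : R) : 2 - 2 * cos x <= x ^ 2.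
Proof.
assert (H := Rsqr_le_abs_1 _ _ (Rabs_sin_le (x / 2))); unfold Rsqr in H.
assert (E := cos_2a_sin (x / 2)); replace (2 * (x / 2)) with x in E by field.
rewrite E; nra.
Qed.

Lemma Cmod_pol_minus_le (s a b : R) : 0 <= s ->
  Cmod (Cminus (pol s a) (pol s b)) <= s * Rabs (a - b).
Proof.
intros Hs; apply Rsqr_incr_0_var;
  [|apply Rmult_le_pos; [exact Hs|apply Rabs_pos]].
unfold Rsqr; rewrite <- (Rmult_1_r (Cmod _ )) at 1.
replace (Cmod (Cminus (pol s a) (pol s b)) * 1 * Cmod (Cminus (pol s a) (pol s b)))
  with (Cmod (Cminus (pol s a) (pol s b)) ^ 2) by ring.
rewrite Cmod_sq; unfold Re, Im; simpl.
replace (s * Rabs (a - b) * (s * Rabs (a - b))) with (s * s * (Rabs (a - b) * Rabs (a - b))) by ring.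
replace (Rabs (a - b) * Rabs (a - b)) with ((a - b) * (a - b))
  by exact (Rsqr_abs (a - b)).
assert (H := cos_lower (a - b)); rewrite cos_minus in H.
assert (Ha := sin2_cos2' a); assert (Hb := sin2_cos2' b).
apply Rle_trans with (s * s * ((sin a * sin a + cos a * cos a) +
  (sin b * sin b + cos b * cos b) - 2 * (cos a * cos b + sin a * sin b))).
- right; ring.
- rewrite Ha, Hb; apply Rmult_le_compat_l; [nra|]; lra.
Qed.

Lemma Cmod_pol_pol_minus (s t a : R) :
  Cmod (Cminus (pol s a) (pol t a)) = Rabs (s - t).
Proof.
replace (Cminus (pol s a) (pol t a)) with (Cmult (RtoC (s - t)) (pol 1 a))
  by (apply C_ext; unfold Re, Im; simpl; ring).
rewrite Cmod_mult, Cmod_R, Cmod_pol by lra; ring.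
Qed.

Definition resolv (A : lin_op X) (w : C) : X -> X := op_inv (op_shift A w).

Definition resolvents (A : lin_op X) (phi0 K : R) : Prop :=
  forall s phi, 0 < s -> Rabs phi <= phi0 ->
    bdd (K / s) (resolv A (pol s phi)) /\
    inverse_at A (pol s phi) (resolv A (pol s phi)).

Lemma resolv_intro (A : lin_op X) (w : C) (M : R) (S : X -> X) :
  bdd M S -> inverse_at A w S -> bdd M (resolv A w) /\ inverse_at A w (resolv A w).
Proof.
intros HB HS; assert (E : forall y, S y = resolv A w y).
{ intros y; symmetry; apply op_inv_inverse, HS. }
split.
- destruct HB as [H1 [H2 [H3 H4]]]; split; [|split; [|split; [exact H3|]]].
  + intros x y; rewrite <- !E; apply H1.
  + intros l x; rewrite <- !E; apply H2.
  + intros x; rewrite <- E; apply H4.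
- destruct HS as [H1 H2]; split; intros y; rewrite <- E; auto.
Qed.

(** Projection of the angle onto [[- theta, theta]]. It supplies the nearby known ray when bounds
    are extended to a larger sector, in each step of the continuation, and in the final choice of
    rays. *)
Lemma clamp_exists (theta phi eps : R) : 0 <= theta -> 0 <= eps ->
  Rabs phi <= theta + eps ->
  exists psi, Rabs psi <= theta /\ Rabs (phi - psi) <= eps.
Proof.
intros Ht He Hp; apply Rabs_le_between in Hp.
destruct (Rle_lt_dec phi theta) as [H|H].
- destruct (Rle_lt_dec (- theta) phi) as [H'|H'].
  + exists phi; split; [apply Rabs_le; lra|rewrite Rminus_diag, Rabs_R0; exact He].
  + exists (- theta); split; apply Rabs_le; lra.
- exists theta; split; apply Rabs_le; lra.
Qed.

Lemma sectorial_resolvents (A : lin_op X) (theta : R) : 0 <= theta < PI ->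
  sectorial theta A -> exists K, 1 <= K /\ resolvents A theta K.
Proof.
intros Ht [_ [_ [Hr [K [HK1 HK]]]]]; exists K; split; [exact HK1|].
intros s phi Hs Hphi.
assert (Hsec : sector theta (pol s phi)) by (apply sector_pol; lra).
assert (Hn := pol_neq0 s phi Hs).
destruct (resolvent_set_elim A _ (Hr _ Hsec Hn)) as [Hl Hi].
split; [|exact Hi].
apply bdd_weaken with (op_norm (resolv A (pol s phi))); [apply bdd_op_norm, Hl|].
specialize (HK _ Hsec Hn); rewrite Cmod_pol in HK by lra.
apply (proj1 (Rle_div_r _ _ _ Hs)); rewrite Rmult_comm; exact HK.
Qed.

(** A rotation by at most [eps] moves a point of modulus [s] by at most [s * eps], while the
    resolvent there is bounded by [K / s]: the smallness condition does not involve [s]. *)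
Lemma resolvents_extend (A : lin_op X) (theta K eps : R) :
  0 <= theta -> 0 < K -> 0 <= eps -> eps * K <= / 2 ->
  resolvents A theta K -> resolvents A (theta + eps) (2 * K).
Proof.
intros Ht HK He HeK HR s phi Hs Hphi.
destruct (clamp_exists theta phi eps Ht He Hphi) as [psi [H1 H2]].
destruct (HR s psi Hs H1) as [HB HS].
destruct (inverse_at_perturb A (pol s psi) (Cminus (pol s phi) (pol s psi)) _ _ HB HS)
  as [S' [HB' HS']].
- apply Rle_trans with (s * eps * (K / s)).
  + apply Rmult_le_compat_r; [apply Rlt_le, Rdiv_lt_0_compat; lra|].
    eapply Rle_trans; [apply Cmod_pol_minus_le; lra|].
    apply Rmult_le_compat_l; lra.
  + replace (s * eps * (K / s)) with (eps * K) by (field; lra); exact HeK.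
- replace (Cplus (pol s psi) (Cminus (pol s phi) (pol s psi))) with (pol s phi) in HS' by ring.
  apply (resolv_intro A _ _ S'); [|exact HS'].
  replace (2 * K / s) with (2 * (K / s)) by (field; lra); exact HB'.
Qed.

(** * The operators [w (A + w)^-1] along a ray *)

Section Family.

Variables (A : lin_op X) (phi0 K : R).
Hypothesis HK : 0 < K.
Hypothesis HA : resolvents A phi0 K.

Definition hres (w : C) (x : X) : X := scal w (resolv A w x).

Lemma hres_bdd (s phi : R) : 0 < s -> Rabs phi <= phi0 -> bdd K (hres (pol s phi)).
Proof.
intros Hs Hp; destruct (HA s phi Hs Hp) as [HB _].
replace K with (Cmod (pol s phi) * (K / s)).
- apply bdd_scal, HB.
- rewrite Cmod_pol by lra; field; lra.
Qed.

Lemma resolv_diff (s t phi : R) (x : X) : 0 < s -> 0 < t -> Rabs phi <= phi0 ->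
  norm (minus (resolv A (pol t phi) x) (resolv A (pol s phi) x)) <=
  K / t * (K / s) * Rabs (t - s) * norm x.
Proof.
intros Hs Ht Hp; destruct (HA s phi Hs Hp) as [HB HS]; destruct (HA t phi Ht Hp) as [HB' HS'].
rewrite (resolvent_identity A _ _ _ _ _ x HB' HS' HS).
replace (minus (plus (resolv A (pol s phi) x)
   (scal (Cminus (pol s phi) (pol t phi)) (resolv A (pol t phi) (resolv A (pol s phi) x))))
   (resolv A (pol s phi) x))
  with (scal (Cminus (pol s phi) (pol t phi)) (resolv A (pol t phi) (resolv A (pol s phi) x)))
  by mring X.
rewrite norm_scal_eq, Cmod_pol_pol_minus, Rabs_minus_sym.
assert (H1 := proj2 (proj2 (proj2 HB)) x).
assert (H2 := proj2 (proj2 (proj2 HB')) (resolv A (pol s phi) x)).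
assert (H3 := Rabs_pos (t - s)).
assert (H4 : 0 < K / t) by (apply Rdiv_lt_0_compat; lra).
apply Rle_trans with (Rabs (t - s) * (K / t * (K / s * norm x))); [|right; ring].
apply Rmult_le_compat_l; [exact H3|].
eapply Rle_trans; [exact H2|]; apply Rmult_le_compat_l; lra.
Qed.

Lemma resolv_opcont (s phi r : R) : 0 < s -> 0 < r -> Rabs phi <= phi0 ->
  opcont (fun t => resolv A (pol (t * r) phi)) s.
Proof.
intros Hs Hr Hp.
(* For [|t - s| < s / 2] one has [t > s / 2], so [K / (t * r)] is at most twice [K / (s * r)]; the
   Lipschitz constant comes from the resolvent identity. *)
exists (2 * (K / (s * r))), (2 * (K / (s * r)) * (K / (s * r)) * r), (s / 2).
assert (Hsr : 0 < s * r) by (apply Rmult_lt_0_compat; lra).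
assert (Hk : 0 < K / (s * r)) by (apply Rdiv_lt_0_compat; lra).
assert (HL : 0 < 2 * (K / (s * r)) * (K / (s * r)) * r)
  by (apply Rmult_lt_0_compat; [apply Rmult_lt_0_compat; lra|lra]).
split; [lra|split; [lra|]]; intros t Ht.
apply Rabs_def2 in Ht.
assert (Ht0 : 0 < t) by lra; assert (Htr : 0 < t * r) by (apply Rmult_lt_0_compat; lra).
assert (HKt : K / (t * r) <= 2 * (K / (s * r))).
{ apply (proj2 (Rle_div_l _ _ _ Htr)).
  replace (2 * (K / (s * r)) * (t * r)) with (K * (2 * t / s)) by (field; lra).
  rewrite <- (Rmult_1_r K) at 1; apply Rmult_le_compat_l; [lra|].
  apply (proj1 (Rle_div_r _ _ _ Hs)); lra. }
split.
- apply bdd_weaken with (K / (t * r)); [|exact HKt].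
  apply HA; assumption.
- intros x; eapply Rle_trans; [apply resolv_diff; assumption|].
  replace (t * r - s * r) with ((t - s) * r) by ring.
  rewrite Rabs_mult, (Rabs_pos_eq r) by lra.
  assert (H3 := Rabs_pos (t - s)); assert (H4 := norm_ge_0 x).
  apply Rmult_le_compat_r; [exact H4|].
  replace (2 * (K / (s * r)) * (K / (s * r)) * r * Rabs (t - s))
    with (2 * (K / (s * r)) * (K / (s * r)) * (Rabs (t - s) * r)) by ring.
  apply Rmult_le_compat_r; [apply Rmult_le_pos; lra|].
  apply Rmult_le_compat_r; lra.
Qed.

Lemma ccont_pol (s r phi : R) : ccont (fun t => pol (t * r) phi) s.
Proof.
assert (H : rcont (fun t => t * r) s).
{ apply rcont_mult; [apply continuous_id|apply rcont_const]. }
split; apply rcont_mult; try exact H; apply rcont_const.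
Qed.

Lemma hres_cont (F : R -> X) (s r phi : R) : 0 < s -> 0 < r -> Rabs phi <= phi0 ->
  continuous F s -> continuous (fun t => hres (pol (t * r) phi) (F t)) s.
Proof.
intros Hs Hr Hp HF; apply cont_scal; [apply ccont_pol|].
apply (opcont_apply (fun t => resolv A (pol (t * r) phi))); [apply resolv_opcont; assumption|exact HF].
Qed.

End Family.

End Resolvents.

Arguments inverse_at {X} A w S.
Arguments resolv {X} A w _.
Arguments resolvents {X} A phi0 K.
Arguments hres {X} A w x.

(** * Analytic continuation *)

Section UniformlyAnalytic.

Variable X : CompleteNormedModule C_AbsRing.
Variable I : Type.
Variables (D : I -> Prop) (d : I -> C).

(** A Taylor expansion with all its remainders: [f = a_0 + d a_1 + ... + d^(n-1) a_(n-1) + d^n F_n].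
    It replaces complex differentiability. The index [i] only has to provide a number [d i], so
    points can be given in logarithmic coordinates. *)
Definition divided_differences (f : I -> X) (C R : R) (F : nat -> I -> X)
    (a : nat -> X) : Prop :=
  (forall i, D i -> F O i = f i) /\
  (forall n i, D i -> F n i = plus (a n) (scal (d i) (F (S n) i))) /\
  (forall n i, D i -> norm (F n i) <= C * R ^ n).

Definition ua (f : I -> X) (C R : R) : Prop :=
  0 <= C /\ exists F a, divided_differences f C R F a.

Lemma le_epsilon_mult (a b : R) : 0 <= b -> (forall eta, 0 < eta -> a <= eta * b) -> a <= 0.
Proof.
intros Hb H; apply le_epsilon; intros eps He.
assert (He' : 0 < eps / (b + 1)) by (apply Rdiv_lt_0_compat; lra).
apply Rle_trans with (eps / (b + 1) * b); [apply H, He'|].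
apply Rle_trans with (eps / (b + 1) * (b + 1)); [apply Rmult_le_compat_l; lra|].
right; field; lra.
Qed.

Lemma norm_le_0 (x : X) : norm x <= 0 -> x = zero.
Proof.
intros H; apply (norm_eq_zero (V := X)); apply Rle_antisym; [exact H|apply norm_ge_0].
Qed.

Lemma scal_eq_zero (l : C) (x : X) : l <> RtoC 0 -> scal l x = zero -> x = zero.
Proof.
intros Hl E; transitivity (scal (Cinv l) (scal l x)).
- mring_with X ltac:(try ring; try (field; exact Hl)).
- rewrite E; mring X.
Qed.

(** Identity theorem: zeros of [f] with nonzero [d] tending to [0] force [a_0 = 0]; after division
    by [d] the same points are zeros of [F_1], and so on. Thus [f = d^n F_n] for all [n], which
    tends to [0] when [|d| R < 1]. *)
Lemma ua_identity (f : I -> X) (C R : R) : ua f C R -> 0 <= R ->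
  (forall eta, 0 < eta ->
     exists i, D i /\ 0 < Cmod (d i) < eta /\ f i = zero) ->
  forall i, D i -> Cmod (d i) * R < 1 -> f i = zero.
Proof.
intros [HC [F [a [H0 [HS Hb]]]]] HR Hz.
assert (HCR : forall n, 0 <= C * R ^ n).
{ intros n; apply Rmult_le_pos; [exact HC|apply pow_le, HR]. }
assert (Ha : forall n, (forall i, D i -> 0 < Cmod (d i) -> f i = zero -> F n i = zero) ->
   a n = zero).
{ intros n HF; apply norm_le_0, (le_epsilon_mult _ (C * R ^ S n)); [apply HCR|].
  intros eta Heta; destruct (Hz eta Heta) as [i [Hi [[Hd1 Hd2] Hf]]].
  assert (E := HS n i Hi); rewrite (HF i Hi Hd1 Hf) in E.
  assert (E2 : a n = opp (scal (d i) (F (S n) i))).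
  { transitivity (minus (plus (a n) (scal (d i) (F (S n) i)))
       (scal (d i) (F (S n) i))); [mring X|rewrite <- E; mring X]. }
  rewrite E2, norm_opp_eq, norm_scal_eq.
  apply Rmult_le_compat; [lra|apply norm_ge_0|lra|apply Hb, Hi]. }
assert (HF : forall n i, D i -> 0 < Cmod (d i) -> f i = zero -> F n i = zero).
{ induction n as [|n IH]; intros i Hi Hd Hf; [rewrite H0; assumption|].
  assert (E := HS n i Hi); rewrite (IH i Hi Hd Hf), (Ha n IH) in E.
  apply (scal_eq_zero (d i)); [apply Cmod_gt_0_neq, Hd|].
  etransitivity; [|exact (eq_sym E)]; mring X. }
intros i Hi Hdi.
assert (E : forall n, norm (f i) <= Cmod (d i) ^ n * norm (F n i)).
{ induction n as [|n IH]; [rewrite H0 by exact Hi; simpl; lra|].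
  eapply Rle_trans; [exact IH|]; right.
  rewrite (HS n i Hi), (Ha n (HF n)).
  transitivity (Cmod (d i) ^ n * norm (scal (d i) (F (S n) i))).
  - f_equal; f_equal; mring X.
  - rewrite norm_scal_eq; simpl; ring. }
apply norm_le_0, (le_epsilon_mult _ C HC); intros eta Heta.
assert (Hq : 0 <= Cmod (d i) * R) by (apply Rmult_le_pos; [apply Cmod_ge_0|exact HR]).
destruct (pow_lt_1_zero (Cmod (d i) * R)) with (y := eta) as [N HN];
  [rewrite Rabs_pos_eq; lra|exact Heta|].
specialize (HN N (Nat.le_refl N)).
rewrite Rabs_pos_eq in HN by (apply pow_le, Hq).
eapply Rle_trans; [apply (E N)|].
apply Rle_trans with (Cmod (d i) ^ N * (C * R ^ N)).
- apply Rmult_le_compat_l; [apply pow_le, Cmod_ge_0|apply Hb, Hi].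
- rewrite Rpow_mult_distr in HN.
  replace (Cmod (d i) ^ N * (C * R ^ N)) with (Cmod (d i) ^ N * R ^ N * C) by ring.
  apply Rmult_le_compat_r; lra.
Qed.

Lemma ua_const (x : X) (R : R) : 0 <= R -> ua (fun _ => x) (norm x) R.
Proof.
intros HR; split; [apply norm_ge_0|].
exists (fun n _ => match n with O => x | _ => zero end),
  (fun n => match n with O => x | _ => zero end).
split; [reflexivity|split].
- intros [|n] i Hi; mring X.
- intros [|n] i Hi; [simpl; lra|].
  rewrite norm_zero_eq.
  apply Rmult_le_pos; [apply norm_ge_0|apply pow_le, HR].
Qed.

Lemma ua_minus (f g : I -> X) (C C' R : R) :
  ua f C R -> ua g C' R -> ua (fun i => minus (f i) (g i)) (C + C') R.
Proof.
intros [HC [F [a [F0 [FS Fb]]]]] [HC' [G [b [G0 [GS Gb]]]]]; split; [lra|].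
exists (fun n i => minus (F n i) (G n i)), (fun n => minus (a n) (b n)).
split; [|split].
- intros i Hi; rewrite F0, G0 by exact Hi; reflexivity.
- intros n i Hi; rewrite FS, GS by exact Hi; mring X.
- intros n i Hi; eapply Rle_trans; [apply norm_minus_le|].
  rewrite Rmult_plus_distr_r; apply Rplus_le_compat; auto.
Qed.

Lemma ua_bdd (M : R) (B : X -> X) (f : I -> X) (C R : R) :
  bdd M B -> ua f C R -> ua (fun i => B (f i)) (M * C) R.
Proof.
intros [Hp [Hs [HM HB]]] [HC [F [a [F0 [FS Fb]]]]]; split;
  [apply Rmult_le_pos; assumption|].
exists (fun n i => B (F n i)), (fun n => B (a n)).
split; [|split].
- intros i Hi; rewrite F0 by exact Hi; reflexivity.
- intros n i Hi; rewrite FS at 1 by exact Hi; rewrite Hp, Hs; reflexivity.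
- intros n i Hi; eapply Rle_trans; [apply HB|].
  rewrite Rmult_assoc; apply Rmult_le_compat_l; auto.
Qed.

Fixpoint conv (F : nat -> C) (a : nat -> X) (n : nat) : X :=
  match n with
  | O => zero
  | S n => plus (scal (F 1%nat) (a n)) (conv (fun m => F (S m)) a n)
  end.

Lemma conv_step (F phi : nat -> C) (z : C) (a : nat -> X) (n : nat) :
  (forall m, F m = Cplus (phi m) (Cmult z (F (S m)))) ->
  conv F a n = plus (conv phi a n) (scal z (conv (fun m => F (S m)) a n)).
Proof.
revert F phi; induction n as [|n IH]; intros F phi HF; simpl; [mring X|].
rewrite (IH (fun m => F (S m)) (fun m => phi (S m))) by (intros m; apply HF).
rewrite (HF 1%nat) at 1; mring X.
Qed.

Lemma conv_bound (F : nat -> C) (a : nat -> X) (A B R : R) (n : nat) :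
  0 <= R -> 0 <= A -> (forall m, Cmod (F m) <= A * R ^ m) ->
  (forall m, norm (a m) <= B * R ^ m) ->
  norm (conv F a n) <= INR n * (A * B * R ^ n).
Proof.
intros HR; revert F A; induction n as [|n IH]; intros F A HA HF Ha.
- simpl; rewrite norm_zero_eq; lra.
- simpl conv; eapply Rle_trans; [apply norm_plus_le|].
  rewrite S_INR, norm_scal_eq.
  assert (H1 : Cmod (F 1%nat) * norm (a n) <= (A * R ^ 1) * (B * R ^ n)).
  { apply Rmult_le_compat; [apply Cmod_ge_0|apply norm_ge_0|apply HF|apply Ha]. }
  assert (H2 : norm (conv (fun m => F (S m)) a n) <= INR n * (A * R * B * R ^ n)).
  { apply IH; [apply Rmult_le_pos; assumption| |exact Ha].
    intros m; eapply Rle_trans; [apply HF|]; simpl; lra. }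
  simpl pow in *; lra.
Qed.

(** The [n]-th divided difference of a product has [n + 1] terms; in [ua_mult] this linear growth is
    absorbed by replacing [R] with [2 * R]. *)
Lemma pow2_ge_linear (n : nat) : 2 * INR n + 1 <= 2 * 2 ^ n.
Proof.
induction n as [|n IH]; [simpl; lra|].
rewrite S_INR; simpl pow; assert (H := pow_R1_Rle 2 n ltac:(lra)); lra.
Qed.

(* Leibniz rule for divided differences: the [n]-th one of [g f] is
   [g F_n + sum_(j < n) G_(n - j) a_j]. *)
Lemma ua_mult (g : I -> C) (G : nat -> I -> C) (b : nat -> C) (A : R)
    (f : I -> X) (C R : R) :
  0 <= A -> 0 <= R -> (exists i, D i) ->
  (forall i, D i -> G O i = g i) ->
  (forall n i, D i -> G n i = Cplus (b n) (Cmult (d i) (G (S n) i))) ->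
  (forall n i, D i -> Cmod (G n i) <= A * R ^ n) ->
  (forall i, D i -> Cmod (d i) * R <= 1) ->
  ua f C R -> ua (fun i => scal (g i) (f i)) (2 * A * C) (2 * R).
Proof.
intros HA HR [i0 Hi0] G0 GS Gb Hd [HC [F [a [F0 [FS Fb]]]]].
assert (HA2 : 0 <= 2 * A * C) by (apply Rmult_le_pos; lra).
split; [exact HA2|].
(* A coefficient is the difference of a remainder and [d] times the next one; as [|d| R <= 1], both
   have size at most [C * R ^ n]. *)
assert (Ha : forall n, norm (a n) <= 2 * C * R ^ n).
{ intros n.
  assert (E : a n = minus (F n i0) (scal (d i0) (F (S n) i0))).
  { rewrite (FS n i0 Hi0); mring X. }
  rewrite E; eapply Rle_trans; [apply norm_minus_le|]; rewrite norm_scal_eq.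
  assert (H1 := Fb n i0 Hi0).
  assert (H2 : Cmod (d i0) * norm (F (S n) i0) <= Cmod (d i0) * (C * R ^ S n)).
  { apply Rmult_le_compat_l; [apply Cmod_ge_0|apply Fb, Hi0]. }
  assert (H3 : Cmod (d i0) * R * (C * R ^ n) <= 1 * (C * R ^ n)).
  { apply Rmult_le_compat_r; [apply Rmult_le_pos; [exact HC|apply pow_le, HR]|].
    apply Hd, Hi0. }
  simpl pow in H2; lra. }
exists (fun n i => plus (conv (fun m => G m i) a n) (scal (g i) (F n i))),
  (fun n => plus (conv b a n) (scal (b O) (a n))).
split; [|split].
- intros i Hi; rewrite F0 by exact Hi; simpl; mring X.
- intros n i Hi; simpl conv.
  rewrite (conv_step (fun m => G m i) b (d i) a n) by (intros m; apply GS, Hi).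
  rewrite <- (G0 i Hi), (FS n i Hi).
  assert (E := GS O i Hi); rewrite E; mring X.
- intros n i Hi; eapply Rle_trans; [apply norm_plus_le|].
  assert (H1 := conv_bound (fun m => G m i) a A (2 * C) R n HR HA
    (fun m => Gb m i Hi) Ha).
  assert (H2 : norm (scal (g i) (F n i)) <= A * (C * R ^ n)).
  { rewrite norm_scal_eq; apply Rmult_le_compat;
      [apply Cmod_ge_0|apply norm_ge_0| |apply Fb, Hi].
    rewrite <- G0 by exact Hi; eapply Rle_trans; [apply Gb, Hi|]; simpl; lra. }
  rewrite Rpow_mult_distr.
  assert (H3 := pow2_ge_linear n).
  assert (H4 : 0 <= A * C * R ^ n).
  { apply Rmult_le_pos; [apply Rmult_le_pos; assumption|apply pow_le, HR]. }
  assert (H5 := Rmult_le_compat_r _ _ _ H4 H3); lra.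
Qed.

End UniformlyAnalytic.

Arguments ua {X I} D d f C R.

(** * Complex functions of a real variable and estimates for [e^(u + i v) - 1] *)

Definition cder (f : R -> C) (t : R) (l : C) : Prop :=
  is_derive (fun t => Re (f t)) t (Re l) /\ is_derive (fun t => Im (f t)) t (Im l).

Lemma cder_const (c : C) (t : R) : cder (fun _ => c) t (RtoC 0).
Proof. split; exact (is_derive_const (V := R_NormedModule) _ t). Qed.

Lemma cder_minus (f g : R -> C) (t : R) (l m : C) :
  cder f t l -> cder g t m -> cder (fun t => Cminus (f t) (g t)) t (Cminus l m).
Proof.
intros [F1 F2] [G1 G2]; split.
- exact (is_derive_minus (V := R_NormedModule) _ _ t _ _ F1 G1).
- exact (is_derive_minus (V := R_NormedModule) _ _ t _ _ F2 G2).
Qed.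

Lemma cder_mult (f g : R -> C) (t : R) (l m : C) :
  cder f t l -> cder g t m ->
  cder (fun t => Cmult (f t) (g t)) t (Cplus (Cmult l (g t)) (Cmult (f t) m)).
Proof.
assert (P : forall (u v : R -> R) (a b c : R), is_derive u t a -> is_derive v t b ->
  c = a * v t + u t * b -> is_derive (fun t => u t * v t) t c).
{ intros u v a b c Hu Hv ->.
  exact (is_derive_mult u v t a b Hu Hv (fun x y => Rmult_comm x y)). }
intros [F1 F2] [G1 G2]; split.
- apply (is_derive_ext (fun t => minus (Re (f t) * Re (g t)) (Im (f t) * Im (g t))));
    [reflexivity|].
  replace (Re (Cplus (Cmult l (g t)) (Cmult (f t) m)))
    with (minus (Re l * Re (g t) + Re (f t) * Re m) (Im l * Im (g t) + Im (f t) * Im m)).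
  + apply (is_derive_minus (V := R_NormedModule)); eapply P; eauto.
  + unfold minus, plus, opp, Re, Im; simpl; ring.
- apply (is_derive_ext (fun t => plus (Re (f t) * Im (g t)) (Im (f t) * Re (g t))));
    [reflexivity|].
  replace (Im (Cplus (Cmult l (g t)) (Cmult (f t) m)))
    with (plus (Re l * Im (g t) + Re (f t) * Im m) (Im l * Re (g t) + Im (f t) * Re m)).
  + apply (is_derive_plus (V := R_NormedModule)); eapply P; eauto.
  + unfold minus, plus, opp, Re, Im; simpl; ring.
Qed.

Lemma cder_eq (f : R -> C) (t : R) (l m : C) : l = m -> cder f t l -> cder f t m.
Proof. intros <-; auto. Qed.

Lemma cder_pol_exp (u v t : R) :
  cder (fun t => pol (exp (t * u)) (t * v)) t (Cmult (u, v) (pol (exp (t * u)) (t * v))).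
Proof.
split; unfold Re, Im; simpl; auto_derive; try exact I; ring.
Qed.

Lemma Cmod_le_Re_Im (z : C) (M : R) :
  Rabs (Re z) <= M -> Rabs (Im z) <= M -> Cmod z <= 2 * M.
Proof.
intros H1 H2; eapply Rle_trans; [apply Cmod_2Rmax|].
assert (H3 : Rmax (Rabs (fst z)) (Rabs (snd z)) <= M) by (apply Rmax_lub; assumption).
assert (H4 : sqrt 2 <= 2).
{ rewrite <- (sqrt_square 2) at 2 by lra; apply sqrt_le_1_alt; lra. }
assert (0 <= Rmax (Rabs (fst z)) (Rabs (snd z))).
{ eapply Rle_trans; [apply Rabs_pos|apply Rmax_l]. }
apply Rmult_le_compat; try lra; apply sqrt_pos.
Qed.

(** The mean value inequality is applied to each coordinate; recombining the two costs the factor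
    [2]. *)
Lemma cder_bound (f f' : R -> C) (M : R) :
  (forall t, Rabs t <= 1 -> cder f t (f' t) /\ Cmod (f' t) <= M) ->
  f 0 = RtoC 0 -> Cmod (f 1) <= 2 * M.
Proof.
intros H H0; apply Cmod_le_Re_Im.
- replace (Re (f 1)) with (Re (f 1) - Re (f 0)) by (rewrite H0; simpl; ring).
  replace M with (M * Rabs (1 - 0)) by (rewrite Rminus_0_r, Rabs_R1; ring).
  apply (bounded_variation (fun t => Re (f t)) (fun t => Re (f' t))).
  intros t; rewrite !Rminus_0_r, Rabs_R1; intros Ht; destruct (H t Ht) as [[H1 _] H2].
  split; [exact H1|eapply Rle_trans; [apply Rabs_Re_le|exact H2]].
- replace (Im (f 1)) with (Im (f 1) - Im (f 0)) by (rewrite H0; simpl; ring).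
  replace M with (M * Rabs (1 - 0)) by (rewrite Rminus_0_r, Rabs_R1; ring).
  apply (bounded_variation (fun t => Im (f t)) (fun t => Im (f' t))).
  intros t; rewrite !Rminus_0_r, Rabs_R1; intros Ht; destruct (H t Ht) as [[_ H1] H2].
  split; [exact H1|eapply Rle_trans; [apply Rabs_Im_le|exact H2]].
Qed.

(** Everything follows from [1 + y <= exp y] at [x] and [- x] together with
    [exp x * exp (- x) = 1]. *)
Lemma exp_small (x : R) : Rabs x <= / 2 ->
  / 2 <= exp x <= 2 /\ Rabs (exp x - 1) <= 2 * Rabs x /\
  Rabs x <= 2 * Rabs (exp x - 1).
Proof.
intros Hx; assert (H1 := exp_ineq1_le x); assert (H2 := exp_ineq1_le (- x)).
assert (H3 : exp x * exp (- x) = 1) by (rewrite <- exp_plus, Rplus_opp_r; apply exp_0).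
assert (H4 := exp_pos x); assert (H5 := exp_pos (- x)).
apply Rabs_le_between in Hx.
assert (H6 : exp x * (1 - x) <= 1) by nra.
destruct (Rle_lt_dec 0 x) as [H|H].
- rewrite (Rabs_pos_eq x), (Rabs_pos_eq (exp x - 1)) by lra; nra.
- rewrite (Rabs_left x), (Rabs_left1 (exp x - 1)) by nra; nra.
Qed.

Lemma sin_lower (y : R) : Rabs y <= 1 -> Rabs y <= 2 * Rabs (sin y).
Proof.
intros Hy; destruct (MVT_gen sin 0 y cos) as [c [Hc E]].
- intros x _; apply is_derive_sin.
- intros x _; apply continuity_sin.
- rewrite sin_0, !Rminus_0_r in E; rewrite E, Rabs_mult.
  assert (Hc1 : c * c <= 1).
  { apply Rabs_le_between in Hy.
    assert (-1 <= c <= 1); [|nra].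
    unfold Rmin, Rmax in Hc; destruct (Rle_dec 0 y); lra. }
  assert (H := cos_lower c).
  rewrite (Rabs_pos_eq (cos c)) by nra.
  assert (H1 := Rabs_pos y); nra.
Qed.

(* The point [e^(u + i v)], written [1 + d] in what follows. *)
Definition cpow_pt (p : R * R) : C := pol (exp (fst p)) (snd p).

Lemma cpow_pt_upper (u v : R) : Rabs u <= / 2 ->
  Cmod (Cminus (cpow_pt (u, v)) (RtoC 1)) <= 2 * (Rabs u + Rabs v).
Proof.
intros Hu; unfold cpow_pt; simpl.
replace (Cminus (pol (exp u) v) (RtoC 1))
  with (Cplus (Cminus (pol (exp u) v) (pol 1 v)) (Cminus (pol 1 v) (pol 1 0)))
  by (rewrite pol_0; ring).
eapply Rle_trans; [apply Cmod_triangle|].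
rewrite Cmod_pol_pol_minus.
assert (H1 := Cmod_pol_minus_le 1 v 0 ltac:(lra)); rewrite Rminus_0_r in H1.
destruct (exp_small u Hu) as [_ [H2 _]]; assert (Hv := Rabs_pos v); lra.
Qed.

(** [|e^(u + i v) - 1|^2 = (e^u - 1)^2 + 4 e^u sin^2 (v / 2)]; with [m] the distance, the first term
    gives [|u| <= 2 m] and the second [|v| <= 4 m]. Estimates in [u] and [v] thereby become
    estimates in [d]. *)
Lemma cpow_pt_lower (u v : R) : Rabs u <= / 2 -> Rabs v <= / 2 ->
  Rabs u + Rabs v <= 6 * Cmod (Cminus (cpow_pt (u, v)) (RtoC 1)).
Proof.
intros Hu Hv; set (m := Cmod (Cminus (cpow_pt (u, v)) (RtoC 1))).
destruct (exp_small u Hu) as [[E1 _] [_ E2]].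
assert (Hs := sin_lower (v / 2)).
assert (Hv2 : Rabs (v / 2) = Rabs v / 2).
{ unfold Rdiv; rewrite Rabs_mult, (Rabs_pos_eq (/ 2)); lra. }
rewrite Hv2 in Hs; specialize (Hs ltac:(lra)).
assert (E : m ^ 2 = (exp u - 1) ^ 2 + 4 * exp u * sin (v / 2) ^ 2).
{ unfold m; rewrite Cmod_sq; unfold cpow_pt, Re, Im; simpl.
  assert (Hc := cos_2a_sin (v / 2)); replace (2 * (v / 2)) with v in Hc by field.
  assert (Hsc := sin2_cos2' v).
  transitivity (exp u * exp u * (sin v * sin v + cos v * cos v) - 2 * exp u * cos v + 1); [ring|].
  rewrite Hsc, Hc; ring. }
assert (Hd : 0 <= m) by apply Cmod_ge_0.
assert (S1 : Rabs (exp u - 1) ^ 2 = (exp u - 1) ^ 2)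
  by (rewrite RPow_abs; apply Rabs_pos_eq, pow2_ge_0).
assert (S2 : Rabs (sin (v / 2)) ^ 2 = sin (v / 2) ^ 2)
  by (rewrite RPow_abs; apply Rabs_pos_eq, pow2_ge_0).
rewrite <- S1, <- S2 in E.
assert (P1 := Rabs_pos (exp u - 1)); assert (P2 := Rabs_pos (sin (v / 2))).
set (x := Rabs (exp u - 1)) in *; set (y := Rabs (sin (v / 2))) in *.
assert (B0 : 2 * y ^ 2 <= 4 * exp u * y ^ 2).
{ apply Rmult_le_compat_r; [apply pow2_ge_0|lra]. }
assert (B1 : x <= m) by (apply le_of_sq_le; [exact Hd|nra]).
assert (B2 : y <= m) by (apply le_of_sq_le; [exact Hd|nra]).
lra.
Qed.

Lemma cpow_pt_neq (u v : R) : Rabs u <= / 2 -> Rabs v <= / 2 -> u <> 0 ->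
  0 < Cmod (Cminus (cpow_pt (u, v)) (RtoC 1)).
Proof.
intros Hu Hv Hn; assert (H := cpow_pt_lower u v Hu Hv).
assert (0 < Rabs u) by (apply Rabs_pos_lt, Hn); generalize (Rabs_pos v); lra.
Qed.

(** * Binomial expansion of [(1 + d)^sigma] with remainders *)

Section Binomial.

Variable sigma : R.
Hypothesis Hsigma : 0 < sigma < 1.

Fixpoint binom (n : nat) : R :=
  match n with
  | O => 1
  | S n => binom n * (sigma - INR n) / INR (S n)
  end.

Lemma binom_bound (n : nat) : Rabs (binom n) <= 1.
Proof.
induction n as [|n IH]; [simpl; rewrite Rabs_R1; lra|].
change (binom (S n)) with (binom n * (sigma - INR n) / INR (S n)).
assert (Hn := pos_INR n); assert (HS : 0 < INR (S n)) by (rewrite S_INR; lra).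
unfold Rdiv; rewrite !Rabs_mult, (Rabs_pos_eq (/ INR (S n)))
  by (left; apply Rinv_0_lt_compat, HS).
assert (H : Rabs (sigma - INR n) <= INR (S n)) by (rewrite S_INR; apply Rabs_le; lra).
apply (proj2 (Rle_div_l _ _ _ HS)); rewrite Rmult_1_l.
rewrite <- (Rmult_1_l (INR (S n))).
apply Rmult_le_compat; try apply Rabs_pos; assumption.
Qed.

Section Remainder.

Variables u v : R.
Hypotheses (Hu : Rabs u <= / 2) (Hv : Rabs v <= / 2).

Let e (t : R) : C := pol (exp (t * u)) (t * v).
Let d (t : R) : C := Cminus (e t) (RtoC 1).
Let om : C := (u, v).

(** The remainder of order [n] of the binomial series of [(1 + d)^sigma], followed along the path
    [t -> e^(t (u + i v))] that starts at [1]; on this path the power has a closed form and no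
    complex logarithm is involved. *)
Fixpoint binom_rem (n : nat) (t : R) : C :=
  match n with
  | O => pol (exp (t * (sigma * u))) (t * (sigma * v))
  | S n => Cminus (binom_rem n t) (Cmult (RtoC (binom n)) (Cpow (d t) n))
  end.

Let r (n : nat) (t : R) : C :=
  match n with
  | O => RtoC 0
  | S n => Cmult (RtoC ((sigma - INR n) * binom n)) (Cpow (d t) n)
  end.

Lemma cder_d (t : R) : cder d t (Cmult om (e t)).
Proof.
apply (cder_eq _ _ (Cminus (Cmult om (e t)) (RtoC 0))); [ring|].
apply cder_minus; [apply cder_pol_exp|apply cder_const].
Qed.

Lemma cder_pow_d (n : nat) (t : R) : cder (fun t => Cpow (d t) n) t
  (Cmult om (Cmult (RtoC (INR n)) (Cplus (Cpow (d t) n)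
     match n with O => RtoC 0 | S m => Cpow (d t) m end))).
Proof.
induction n as [|n IH].
- apply (cder_eq _ _ (RtoC 0)); [simpl INR; ring|].
  apply (cder_const (RtoC 1)).
- assert (E : e t = Cplus (RtoC 1) (d t)) by (unfold d; ring).
  apply (cder_eq _ _ (Cplus (Cmult (Cmult om (e t)) (Cpow (d t) n))
     (Cmult (d t) (Cmult om (Cmult (RtoC (INR n)) (Cplus (Cpow (d t) n)
       match n with O => RtoC 0 | S m => Cpow (d t) m end)))))).
  + rewrite E, S_INR, RtoC_plus, Cpow_S; destruct n as [|n].
    * simpl INR; simpl Cpow; ring.
    * rewrite !Cpow_S; ring.
  + apply (cder_mult d (fun t => Cpow (d t) n)); [apply cder_d|exact IH].
Qed.

(** Along the path the power solves [f' = sigma om f]. The truncated series solves the same equation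
    up to a multiple of its last term, which is the source term [r]. *)
Lemma cder_binom_rem (n : nat) (t : R) : cder (binom_rem n) t
  (Cmult om (Cplus (Cmult (RtoC sigma) (binom_rem n t)) (r n t))).
Proof.
induction n as [|n IH].
- eapply cder_eq; [|apply (cder_pol_exp (sigma * u) (sigma * v))].
  unfold om, r; apply C_ext; unfold Re, Im; simpl; ring.
- eapply cder_eq; [|apply cder_minus; [exact IH|
    apply (cder_mult (fun _ => RtoC (binom n)));
      [apply cder_const|apply cder_pow_d]]].
  simpl binom_rem; unfold r.
  destruct n as [|n].
  + simpl INR; simpl binom; simpl Cpow; rewrite Rminus_0_r, Rmult_1_r; ring.
  + change (binom (S n)) with (binom n * (sigma - INR n) / INR (S n)).
    assert (HS : RtoC (INR (S n)) <> RtoC 0).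
    { intros E; apply RtoC_inj in E; rewrite S_INR in E; generalize (pos_INR n); lra. }
    assert (HS' : INR (S n) <> 0) by (intros E; apply HS; rewrite E; reflexivity).
    rewrite !RtoC_mult, RtoC_div, !RtoC_minus, !RtoC_mult, !RtoC_minus by exact HS'.
    field; exact HS.
Qed.

Lemma binom_rem_0 (n : nat) : binom_rem (S n) 0 = RtoC 0.
Proof.
assert (Ed : d 0 = RtoC 0).
{ unfold d, e; rewrite !Rmult_0_l, exp_0, pol_0; ring. }
induction n as [|n IH].
- simpl; rewrite !Rmult_0_l, exp_0, pol_0; ring.
- change (binom_rem (S (S n)) 0) with
    (Cminus (binom_rem (S n) 0) (Cmult (RtoC (binom (S n))) (Cpow (d 0) (S n)))).
  rewrite IH, Ed, Cpow_S; ring.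
Qed.

Lemma Cmod_d_upper (t : R) : Rabs t <= 1 -> Cmod (d t) <= 2 * (Rabs u + Rabs v).
Proof.
intros Ht; assert (Hp := Rabs_pos u); assert (Hq := Rabs_pos v); assert (Hr := Rabs_pos t).
assert (H := cpow_pt_upper (t * u) (t * v)); rewrite !Rabs_mult in H.
eapply Rle_trans; [apply H|]; nra.
Qed.

Lemma Cmod_d_lower : Rabs u + Rabs v <= 6 * Cmod (d 1).
Proof.
assert (H := cpow_pt_lower u v Hu Hv).
unfold d, e; rewrite !Rmult_1_l; exact H.
Qed.

Lemma INR_le_pow2 (n : nat) : INR n <= 2 ^ n.
Proof. generalize (pow2_ge_linear n) (pos_INR n); lra. Qed.

(** Variation of constants. On the path the increment is at most [12 |d 1|], and [|om| <= 6 |d 1|];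
    for [n >= 1] this gives [4 n (12 |d 1|)^n], and [n <= 2^n] turns [12] into [24]. *)
Lemma binom_rem_bound (n : nat) :
  Cmod (binom_rem n 1) <= 4 * (24 * Cmod (d 1)) ^ n.
Proof.
assert (Hsu : forall t, Rabs t <= 1 -> Rabs (t * (sigma * u)) <= / 2).
{ intros t Ht; rewrite !Rabs_mult, (Rabs_pos_eq sigma) by lra.
  assert (H1 := Rabs_pos u); assert (H2 := Rabs_pos t).
  assert (sigma * Rabs u <= / 2) by nra; nra. }
assert (H1 : Rabs 1 <= 1) by (rewrite Rabs_R1; lra).
destruct n as [|n].
{ simpl; rewrite Cmod_pol by (left; apply exp_pos).
  destruct (exp_small _ (Hsu 1 H1)) as [[_ H] _]; lra. }
set (D := Cmod (d 1)); assert (HD : 0 <= D) by apply Cmod_ge_0.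
(* Integrating factor [e^(- sigma t om)]: it removes the term [sigma * binom_rem], so the derivative
   of the product is [em * om * r]. *)
set (em := fun t => pol (exp (t * (- sigma * u))) (t * (- sigma * v))).
assert (Hem : forall t, Rabs t <= 1 -> Cmod (em t) <= 2).
{ intros t Ht; unfold em; rewrite Cmod_pol by (left; apply exp_pos).
  destruct (exp_small (t * (- sigma * u))) as [[_ H] _]; [|exact H].
  replace (t * (- sigma * u)) with (- (t * (sigma * u))) by ring.
  rewrite Rabs_Ropp; apply Hsu, Ht. }
assert (Hr : forall t, Rabs t <= 1 -> Cmod (r (S n) t) <= INR (S n) * (12 * D) ^ n).
{ intros t Ht; unfold r; rewrite Cmod_mult, Cmod_R, Cmod_pow, Rabs_mult.
  assert (B := binom_bound n); assert (P := pos_INR n).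
  apply Rmult_le_compat; [apply Rmult_le_pos; apply Rabs_pos|apply pow_le, Cmod_ge_0| |].
  - assert (Rabs (sigma - INR n) <= INR (S n)) by (rewrite S_INR; apply Rabs_le; lra).
    rewrite <- (Rmult_1_r (INR (S n))).
    apply Rmult_le_compat; try apply Rabs_pos; assumption.
  - apply pow_incr; split; [apply Cmod_ge_0|].
    assert (L := Cmod_d_upper t Ht); assert (L2 := Cmod_d_lower); fold D in L2; lra. }
assert (Hom : Cmod om <= 6 * D).
{ eapply Rle_trans; [|apply Cmod_d_lower].
  replace om with (Cplus (RtoC u) (Cmult Ci (RtoC v)))
    by (apply C_ext; unfold om, Re, Im; simpl; ring).
  eapply Rle_trans; [apply Cmod_triangle|].
  rewrite Cmod_mult, !Cmod_R; replace (Cmod Ci) with 1; [lra|].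
  unfold Cmod; simpl; rewrite <- sqrt_1 at 1; f_equal; ring. }
assert (Hw : Cmod (Cmult (em 1) (binom_rem (S n) 1)) <=
   2 * (2 * (6 * D) * (INR (S n) * (12 * D) ^ n))).
{ apply (cder_bound (fun t => Cmult (em t) (binom_rem (S n) t))
    (fun t => Cmult (Cmult (em t) om) (r (S n) t))).
  - intros t Ht; split.
    + eapply cder_eq; [|apply cder_mult; [apply cder_pol_exp|apply cder_binom_rem]].
      replace ((- sigma * u, - sigma * v) : C) with (Cmult (RtoC (- sigma)) om)
        by (apply C_ext; unfold om, Re, Im; simpl; ring).
      rewrite RtoC_opp; fold (em t); ring.
    + rewrite !Cmod_mult; apply Rmult_le_compat; try apply Cmod_ge_0;
        [apply Rmult_le_pos; apply Cmod_ge_0| |apply Hr, Ht].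
      apply Rmult_le_compat; try apply Cmod_ge_0; [apply Hem, Ht|exact Hom].
  - rewrite binom_rem_0; ring. }
rewrite Cmod_mult in Hw.
assert (Hem1 : / 2 <= Cmod (em 1)).
{ unfold em; rewrite Cmod_pol by (left; apply exp_pos).
  destruct (exp_small (1 * (- sigma * u))) as [[H _] _]; [|exact H].
  replace (1 * (- sigma * u)) with (- (1 * (sigma * u))) by ring.
  rewrite Rabs_Ropp; apply Hsu, H1. }
assert (HQ := Cmod_ge_0 (binom_rem (S n) 1)).
assert (HP : 0 <= (12 * D) ^ S n) by (apply pow_le; lra).
assert (HN := INR_le_pow2 (S n)).
assert (HPN := Rmult_le_compat_r _ _ _ HP HN).
replace ((24 * D) ^ S n) with (2 ^ S n * (12 * D) ^ S n)
  by (rewrite <- Rpow_mult_distr; f_equal; ring).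
replace (2 * (2 * (6 * D) * (INR (S n) * (12 * D) ^ n)))
  with (2 * (INR (S n) * (12 * D) ^ S n)) in Hw by (simpl pow; ring).
nra.
Qed.

End Remainder.

(* [(1 + d)^sigma], [1 + d = e^(u + i v)], has bounded divided differences at
   [d = 0]. *)
Lemma power_divided_differences :
  exists (G : nat -> R * R -> C) (b : nat -> C),
  (forall p, G O p = pol (exp (sigma * fst p)) (sigma * snd p)) /\
  (forall n p, Rabs (fst p) <= / 2 -> Rabs (snd p) <= / 2 ->
     G n p = Cplus (b n) (Cmult (Cminus (cpow_pt p) (RtoC 1)) (G (S n) p))) /\
  (forall n p, Rabs (fst p) <= / 2 -> Rabs (snd p) <= / 2 ->
     Cmod (G n p) <= 4 * 24 ^ n).
Proof.
set (d := fun p : R * R => Cminus (cpow_pt p) (RtoC 1)).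
(* At [d = 0] the quotient has no meaning; there the recursion for [G] leaves no choice but the
   coefficient itself. *)
set (G := fun n (p : R * R) => match n with
  | O => pol (exp (sigma * fst p)) (sigma * snd p)
  | S _ => if Ceq_dec (d p) (RtoC 0) then RtoC (binom n)
           else Cdiv (binom_rem (fst p) (snd p) n 1) (Cpow (d p) n) end).
exists G, (fun n => RtoC (binom n)).
assert (Ed : forall u v, Cminus (pol (exp (1 * u)) (1 * v)) (RtoC 1) = d (u, v)).
{ intros u v; rewrite !Rmult_1_l; reflexivity. }
assert (EG : forall n p, d p <> RtoC 0 ->
  G n p = Cdiv (binom_rem (fst p) (snd p) n 1) (Cpow (d p) n)).
{ intros [|n] p Hp; unfold G.
  - simpl; rewrite !Rmult_1_l; field.
  - destruct (Ceq_dec (d p) (RtoC 0)); [contradiction|reflexivity]. }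
assert (H0 : forall p, Rabs (fst p) <= / 2 -> Rabs (snd p) <= / 2 ->
  d p = RtoC 0 -> fst p = 0 /\ snd p = 0).
{ intros [u v] Hu Hv Hd; simpl in *; assert (L := cpow_pt_lower u v Hu Hv); fold (d (u, v)) in L.
  rewrite Hd, Cmod_0 in L.
  assert (P1 := Rabs_pos u); assert (P2 := Rabs_pos v).
  split; apply Rabs_eq_0; lra. }
split; [reflexivity|split].
- intros n [u v] Hu Hv; simpl in Hu, Hv; fold (d (u, v)).
  destruct (Ceq_dec (d (u, v)) (RtoC 0)) as [Hd|Hd].
  + destruct (H0 (u, v) Hu Hv Hd) as [E1 E2]; simpl in E1, E2; subst u v.
    destruct n as [|n]; unfold G; rewrite Hd.
    * simpl; rewrite !Rmult_0_r, exp_0, pol_0; ring.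
    * destruct (Ceq_dec (RtoC 0) (RtoC 0)); [ring|congruence].
  + rewrite !EG by exact Hd; simpl binom_rem; rewrite Ed, Cpow_S.
    simpl fst; simpl snd; field; split; [apply Cpow_nz|]; exact Hd.
- intros n [u v] Hu Hv; simpl in Hu, Hv.
  destruct (Ceq_dec (d (u, v)) (RtoC 0)) as [Hd|Hd].
  + assert (1 <= 24 ^ n) by (apply pow_R1_Rle; lra).
    destruct (H0 (u, v) Hu Hv Hd) as [E1 E2]; simpl in E1, E2; subst u v.
    destruct n as [|n]; unfold G.
    * simpl; rewrite !Rmult_0_r, exp_0, pol_0, Cmod_1; lra.
    * destruct (Ceq_dec _ _); [|contradiction].
      rewrite Cmod_R; generalize (binom_bound (S n)); lra.
  + rewrite EG, Cmod_div, Cmod_pow by first [exact Hd|apply Cpow_nz, Hd].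
    assert (Hm : 0 < Cmod (d (u, v)) ^ n) by (apply pow_lt, Cmod_gt_0, Hd).
    apply (proj2 (Rle_div_l _ _ _ Hm)).
    assert (L := binom_rem_bound u v Hu Hv n); cbv zeta beta in L; rewrite Ed in L; simpl fst; simpl snd.
    rewrite Rpow_mult_distr in L; lra.
Qed.

End Binomial.

(** * Resolvents of the fractional power *)

Section KernelIntegral.

Variable X : CompleteNormedModule C_AbsRing.
Variables (sigma delta rho al : R).
Hypotheses (Hsigma : 0 < sigma < 1) (Hdelta : 0 < delta)
  (Hal : Rabs al <= PI * (1 - sigma) - delta) (Hrho : 0 < rho).

Definition chlint_val (f : R -> X) : X :=
  RInt_gen (V := restr_Complete X) f (at_right 0) (Rbar_locally p_infty).

Lemma chlint_val_eq (f : R -> X) (J : X) : chlint f J -> chlint_val f = J.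
Proof. exact (is_RInt_gen_unique (V := restr_Complete X) f J). Qed.

(** The factor [1 / s] compensates for the [s] in [s (A + s)^-1]: the integrand becomes a kernel
    dominated by [dens] times a bounded family. *)
Definition kap (l : C) (s : R) : C := Cmult (RtoC (/ s)) (knl sigma l s).

Definition kbd : R := / (sigma * ang delta).

Lemma kbd_gt0 : 0 < kbd.
Proof.
destruct (knl_angles sigma Hsigma delta al Hdelta Hal) as [Hd _].
apply Rinv_0_lt_compat, Rmult_lt_0_compat; [lra|apply ang_gt0; assumption].
Qed.

Lemma kap_bound (s : R) : 0 < s -> Cmod (kap (pol rho al) s) <= kbd * dens sigma rho s.
Proof.
intros Hs; unfold kap; rewrite Cmod_mult, Cmod_R, Rabs_pos_eq
  by (left; apply Rinv_0_lt_compat, Hs).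
assert (H := knl_bound sigma Hsigma delta rho al s Hdelta Hal Hrho Hs).
apply Rle_trans with (/ s * (kbd * (s * dens sigma rho s))).
- apply Rmult_le_compat_l; [left; apply Rinv_0_lt_compat, Hs|exact H].
- right; field; lra.
Qed.

Lemma ccont_kap (s : R) : 0 < s -> ccont (kap (pol rho al)) s.
Proof.
intros Hs; apply ccont_mult.
- apply ccont_RtoC; apply rcont_inv; [lra|apply continuous_id].
- apply (ccont_knl sigma Hsigma delta); assumption.
Qed.

Definition kint (l : C) (F : R -> X) : X := chlint_val (fun s => scal (kap l s) (F s)).

Lemma kint_correct (F : R -> X) (M : R) :
  (forall s, 0 < s -> continuous F s) -> (forall s, 0 < s -> norm (F s) <= M) ->
  chlint (fun s => scal (kap (pol rho al) s) (F s)) (kint (pol rho al) F) /\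
  norm (kint (pol rho al) F) <= kbd * M.
Proof.
intros HF HM; set (f := fun s => scal (kap (pol rho al) s) (F s)).
assert (Hf : forall s, 0 < s -> norm (f s) <= kbd * M * dens sigma rho s).
{ intros s Hs; unfold f; rewrite norm_scal_eq.
  replace (kbd * M * dens sigma rho s) with (kbd * dens sigma rho s * M) by ring.
  apply Rmult_le_compat; [apply Cmod_ge_0|apply norm_ge_0|apply kap_bound, Hs|auto]. }
destruct (chlint_exists X sigma f (kbd * M) rho Hsigma Hrho) as [J HJ].
- intros s Hs; apply cont_scal; [apply ccont_kap, Hs|auto].
- exact Hf.
- unfold kint; fold f; rewrite (chlint_val_eq f J HJ); split; [exact HJ|].
  exact (chlint_bound X sigma f J (kbd * M) rho Hsigma Hrho HJ Hf).
Qed.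

End KernelIntegral.

Arguments chlint_val {X} f.
Arguments kint {X} sigma l F.

(** * Continuation of the resolvent of [A^sigma] in the angle [phi] *)

Section Continuation.

Variable X : CompleteNormedModule C_AbsRing.
Variables (A As : lin_op X) (phi0 K sigma : R).
Hypotheses (HK : 0 < K) (Hphi0 : 0 <= phi0) (HA : resolvents A phi0 K)
  (Hsigma : 0 < sigma < 1) (Has : is_frac_power A sigma As).

Let c : C := RtoC (sin (PI * sigma) / PI).

Let win (al : R) : Prop := Rabs al < PI * (1 - sigma).

Lemma win_0 : win 0.
Proof. unfold win; rewrite Rabs_R0; apply Rmult_lt_0_compat; [apply PI_RGT_0|lra]. Qed.

Lemma frac_power_resolvent (rho al : R) : 0 < rho -> win al ->
  is_linear (resolv As (pol rho al)) /\ inverse_at As (pol rho al) (resolv As (pol rho al)) /\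
  forall x, exists J,
    chlint (fun s => scal (frac_kernel sigma (pol rho al) s) (resolv A (RtoC s) x)) J /\
    resolv As (pol rho al) x = scal c J.
Proof.
intros Hr Ha; destruct Has as [_ H].
assert (HP := PI_RGT_0).
destruct (H (pol rho al)) as [H1 H2].
- apply pol_neq0, Hr.
- assert (Rabs al < PI * (1 - sigma)) by exact Ha.
  rewrite Rabs_Carg_pol; [exact Ha|exact Hr|nra].
- destruct (resolvent_set_elim X As _ H1) as [H3 H4].
  split; [exact H3|split; [exact H4|exact H2]].
Qed.

Section FixedKernel.

Variables (delta rho al : R).
Hypotheses (Hdelta : 0 < delta) (Hal : Rabs al <= PI * (1 - sigma) - delta)
  (Hrho : 0 < rho).

Lemma al_win : win al.
Proof. unfold win; lra. Qed.

Let l : C := pol rho al.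
Let C0 : R := kbd sigma delta.

Lemma C0_gt0 : 0 < C0.
Proof. exact (kbd_gt0 sigma delta al Hsigma Hdelta Hal). Qed.

Lemma kint_ok (F : R -> X) (M : R) :
  (forall s, 0 < s -> continuous F s) -> (forall s, 0 < s -> norm (F s) <= M) ->
  chlint (fun s => scal (kap sigma l s) (F s)) (kint sigma l F) /\
  norm (kint sigma l F) <= C0 * M.
Proof. exact (kint_correct X sigma delta rho al Hsigma Hdelta Hal Hrho F M). Qed.

Lemma kint_unique (F : R -> X) (J : X) :
  chlint (fun s => scal (kap sigma l s) (F s)) J -> kint sigma l F = J.
Proof. apply chlint_val_eq. Qed.

Definition fint (r phi : R) (x : X) : X :=
  scal c (kint sigma l (fun s => hres A (pol (s * r) phi) x)).

Lemma fint_chlint (r phi : R) (x : X) : 0 < r -> Rabs phi <= phi0 ->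
  chlint (fun s => scal (kap sigma l s) (hres A (pol (s * r) phi) x))
    (kint sigma l (fun s => hres A (pol (s * r) phi) x)) /\
  norm (kint sigma l (fun s => hres A (pol (s * r) phi) x)) <= C0 * (K * norm x).
Proof.
intros Hr Hp; apply kint_ok.
- intros s Hs; apply (hres_cont X A phi0 K HK HA); try assumption.
  apply continuous_const.
- intros s Hs; apply (hres_bdd X A phi0 K HA); [apply Rmult_lt_0_compat|]; assumption.
Qed.

Lemma fint_bdd (r phi : R) : 0 < r -> Rabs phi <= phi0 ->
  bdd (Cmod c * (C0 * K)) (fint r phi).
Proof.
intros Hr Hp; unfold fint.
assert (HB : forall s, 0 < s -> bdd K (hres A (pol (s * r) phi))).
{ intros s Hs; apply (hres_bdd X A phi0 K HA); [apply Rmult_lt_0_compat|]; assumption. }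
apply (bdd_scal X (C0 * K) c (fun x => kint sigma l (fun s => hres A (pol (s * r) phi) x))).
repeat split.
- intros x y; apply kint_unique.
  generalize (chlint_plus X _ _ _ _ (proj1 (fint_chlint r phi x Hr Hp))
     (proj1 (fint_chlint r phi y Hr Hp))).
  apply chlint_ext; intros s Hs; rewrite (proj1 (HB s Hs)); mring X.
- intros m x; apply kint_unique.
  generalize (chlint_scal X m _ _ (proj1 (fint_chlint r phi x Hr Hp))).
  apply chlint_ext; intros s Hs; rewrite (proj1 (proj2 (HB s Hs))); mring X.
- apply Rmult_le_pos; [apply Rlt_le, C0_gt0|lra].
- intros x; rewrite Rmult_assoc; apply fint_chlint; assumption.
Qed.

(** This is [w = l z^sigma] with [z = r e^(i phi)], the point for which [fint r phi] will turn out
    to be [w (A^sigma + w)^-1]. *)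
Definition fpt (r phi : R) : C := pol (rho * Rpower r sigma) (al + sigma * phi).

Lemma fpt_neq0 (r phi : R) : fpt r phi <> RtoC 0.
Proof. apply pol_neq0, Rmult_lt_0_compat; [exact Hrho|apply Rpower_gt0]. Qed.

Lemma fint_real_ray (r : R) (x : X) : 0 < r ->
  fint r 0 x = scal (fpt r 0) (resolv As (fpt r 0) x).
Proof.
intros Hr.
assert (Hq := Rpower_gt0 r sigma).
assert (Hrq : 0 < rho * Rpower r sigma) by (apply Rmult_lt_0_compat; assumption).
assert (El : fpt r 0 = pol (rho * Rpower r sigma) al).
{ unfold fpt; rewrite Rmult_0_r, Rplus_0_r; reflexivity. }
destruct (frac_power_resolvent _ al Hrq al_win) as [_ [_ H]].
destruct (H x) as [J [HJ1 HJ2]].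
rewrite El, HJ2; unfold fint.
rewrite (kint_unique _ (scal (pol (rho * Rpower r sigma) al) J)).
- mring X.
- apply (chlint_scale X _ _ r Hr) in HJ1.
  apply (chlint_scal X (pol (rho * Rpower r sigma) al)) in HJ1.
  revert HJ1; apply chlint_ext; intros s Hs.
  unfold hres; rewrite pol_0, (Rmult_comm s r).
  assert (E : knl sigma (pol (rho * Rpower r sigma) al) (r * s) = knl sigma l s).
  { rewrite Rmult_comm.
    exact (knl_scale sigma Hsigma delta rho al r s Hdelta Hal Hrho Hr Hs). }
  unfold kap; rewrite <- E; unfold knl.
  assert (Hs0 : RtoC s <> RtoC 0) by (intros E0; apply RtoC_inj in E0; lra).
  rewrite RtoC_mult, RtoC_inv by lra.
  mring_with X ltac:(try ring; try (field; exact Hs0)).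
Qed.

Let R1 : X -> X := resolv As (pol 1 0).

Lemma R1_props : exists M, bdd M R1 /\ inverse_at As (RtoC 1) R1.
Proof.
destruct (frac_power_resolvent 1 0 Rlt_0_1 win_0) as [H1 [H2 _]].
destruct (linear_bdd X _ H1) as [M HM]; exists M; split; [exact HM|].
rewrite pol_0 in H2; unfold R1; rewrite pol_0; exact H2.
Qed.

(* Vanishes when [fint r phi / fpt r phi] is the resolvent of [As] at
   [fpt r phi]. *)
Definition defect (r phi : R) (x : X) : X :=
  minus (minus (fint r phi x) (R1 (fint r phi x)))
    (scal (fpt r phi) (minus (R1 x) (R1 (fint r phi x)))).

(** For [phi = 0] the operator [fint] comes from the definition of [A^sigma], and the claim is the
    resolvent identity between the points [1] and [fpt r 0]. *)
Lemma defect_real_ray (r : R) (x : X) : 0 < r -> defect r 0 x = zero.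
Proof.
intros Hr; destruct R1_props as [M [HM1 HM2]].
assert (Hq := Rpower_gt0 r sigma).
assert (Hrq : 0 < rho * Rpower r sigma) by (apply Rmult_lt_0_compat; assumption).
assert (El : fpt r 0 = pol (rho * Rpower r sigma) al).
{ unfold fpt; rewrite Rmult_0_r, Rplus_0_r; reflexivity. }
destruct (frac_power_resolvent _ al Hrq al_win) as [_ [HS _]]; rewrite <- El in HS.
unfold defect; rewrite (fint_real_ray r x Hr).
set (S := resolv As (fpt r 0)) in *.
assert (E := resolvent_identity X As (RtoC 1) (fpt r 0) R1 S M x HM1 HM2 HS).
rewrite (proj1 (proj2 HM1)), E; mring X.
Qed.

Section Step.

Variables (r phi1 : R) (x : X).
Hypotheses (Hr : 0 < r) (Hphi1 : Rabs phi1 <= phi0)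
  (Hgood : forall r, 0 < r -> defect r phi1 x = zero).

(** [K] is the growth rate of the iterated resolvents, [24] that of the remainders of the power.
    With [eta] as below, points of [D] have [|d| <= 4 eta], hence [|d| * (2 R0) <= 1 / 2], as
    required after forming a product. *)
Let R0 : R := Rmax K 24.
Let eta : R := / (16 * R0).

Let D (p : R * R) : Prop :=
  Rabs (fst p) <= eta /\ Rabs (snd p) <= eta /\ Rabs (phi1 + snd p) <= phi0.

Let d (p : R * R) : C := Cminus (cpow_pt p) (RtoC 1).

Lemma R0_bounds : K <= R0 /\ 24 <= R0.
Proof. split; [apply Rmax_l|apply Rmax_r]. Qed.

Lemma eta_bounds : 0 < eta /\ eta <= / 2 /\ 16 * eta * R0 = 1.
Proof.
destruct R0_bounds as [_ H]; unfold eta; repeat split.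
- apply Rinv_0_lt_compat; lra.
- apply Rinv_le_contravar; lra.
- field; lra.
Qed.

Lemma D_small (p : R * R) : D p -> Rabs (fst p) <= / 2 /\ Rabs (snd p) <= / 2.
Proof. destruct eta_bounds as [_ [H _]]; intros [H1 [H2 _]]; split; lra. Qed.

Lemma d_small (p : R * R) : D p -> Cmod (d p) * (2 * R0) <= / 2.
Proof.
intros Hp; destruct (D_small p Hp) as [H1 H2]; destruct Hp as [H3 [H4 _]].
assert (H := cpow_pt_upper (fst p) (snd p) H1).
destruct R0_bounds as [_ HR]; destruct eta_bounds as [He [_ E]].
assert (B : Cmod (d p) <= 4 * eta).
{ unfold d; destruct p; simpl in *; lra. }
apply Rle_trans with (4 * eta * (2 * R0)); [|lra].
apply Rmult_le_compat_r; lra.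
Qed.

Let hp (p : R * R) (s : R) : X -> X := hres A (pol (s * (r * exp (fst p))) (phi1 + snd p)).
Let nh (s : R) (y : X) : X := opp (hres A (pol (s * r) phi1) y).

Lemma nh_bdd (s : R) : 0 < s -> bdd K (nh s).
Proof.
intros Hs; assert (H := hres_bdd X A phi0 K HA (s * r) phi1
  (Rmult_lt_0_compat _ _ Hs Hr) Hphi1).
replace K with (Cmod (RtoC (-1)) * K).
- destruct (bdd_scal X K (RtoC (-1)) _ H) as [H1 [H2 [H3 H4]]].
  assert (E : forall y, nh s y = scal (RtoC (-1)) (hres A (pol (s * r) phi1) y)).
  { intros y; unfold nh; mring_with X ltac:(try ring; apply C_ext; unfold Re, Im; simpl; ring). }
  repeat split; try assumption.
  + intros y z; rewrite !E; apply H1.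
  + intros m y; rewrite !E; apply H2.
  + intros y; rewrite E; apply H4.
- rewrite Cmod_R, Rabs_left by lra; ring.
Qed.

Lemma iter_nh_bdd (n : nat) (s : R) : 0 < s -> bdd (K ^ n) (fun y => Nat.iter n (nh s) y).
Proof.
intros Hs; induction n as [|n IH].
- exact (bdd_id X).
- exact (bdd_comp X _ _ _ _ (nh_bdd s Hs) IH).
Qed.

Lemma hp_bdd (p : R * R) (s : R) : D p -> 0 < s -> bdd K (hp p s).
Proof.
intros [_ [_ Hp]] Hs; apply (hres_bdd X A phi0 K HA); [|exact Hp].
apply Rmult_lt_0_compat; [exact Hs|apply Rmult_lt_0_compat; [exact Hr|apply exp_pos]].
Qed.

Lemma iter_nh_cont (n : nat) (F : R -> X) (s : R) : 0 < s -> continuous F s ->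
  continuous (fun s => Nat.iter n (nh s) (F s)) s.
Proof.
intros Hs HF; induction n as [|n IH]; [exact HF|]; simpl.
apply (continuous_opp (V := X) (fun t => hres A (pol (t * r) phi1) (Nat.iter n (nh t) (F t)))).
apply (hres_cont X A phi0 K HK HA); assumption.
Qed.

Lemma hp_cont (p : R * R) (s : R) : D p -> 0 < s -> continuous (fun s => hp p s x) s.
Proof.
intros [_ [_ Hp]] Hs; apply (hres_cont X A phi0 K HK HA); try assumption.
- apply Rmult_lt_0_compat; [exact Hr|apply exp_pos].
- apply continuous_const.
Qed.

(** By the resolvent identity for [w = (1 + d) w1], the function [1 - H(w)] reappears in its own
    remainder; its divided differences are therefore [(- H(w1))^n (1 - H(w))]. This is why the
    complement of [H] is expanded. *)
Lemma hp_step (p : R * R) (s : R) : D p -> 0 < s ->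
  minus x (hp p s x) =
  plus (plus x (nh s x)) (scal (d p) (nh s (minus x (hp p s x)))).
Proof.
intros Hp Hs.
assert (Hsr : 0 < s * r) by (apply Rmult_lt_0_compat; assumption).
assert (Hsr' : 0 < s * (r * exp (fst p))).
{ apply Rmult_lt_0_compat; [exact Hs|apply Rmult_lt_0_compat; [exact Hr|apply exp_pos]]. }
destruct (HA _ phi1 Hsr Hphi1) as [HB1 HS1].
destruct (HA _ (phi1 + snd p) Hsr' (proj2 (proj2 Hp))) as [HB HS].
assert (E := resolvent_identity X A _ _ _ _ _ x HB1 HS1 HS).
assert (Ew : pol (s * (r * exp (fst p))) (phi1 + snd p) =
  Cmult (pol (s * r) phi1) (Cplus (RtoC 1) (d p))).
{ replace (Cplus (RtoC 1) (d p)) with (cpow_pt p) by (unfold d; ring).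
  unfold cpow_pt; rewrite pol_mult; f_equal; ring. }
unfold nh, hp, hres.
set (w1 := pol (s * r) phi1) in *.
set (G1 := resolv A w1) in *.
set (w := pol (s * (r * exp (fst p))) (phi1 + snd p)) in *.
set (G := resolv A w) in *.
assert (EG : G1 (minus x (scal w (G x))) = minus (G1 x) (scal w (G1 (G x)))).
{ unfold minus; rewrite (proj1 HB1), (bdd_opp X _ G1 _ HB1), (proj1 (proj2 HB1)); reflexivity. }
rewrite EG, E, Ew; mring X.
Qed.

Let Cx : R := C0 * ((1 + K) * norm x).

(** The recursion is integrated against the kernel. The iterates of [- H(w1)] are bounded by [K^n]
    for every [s], so one radius serves the whole integrand. *)
Lemma ua_kint : ua D d (fun p => kint sigma l (fun s => minus x (hp p s x))) Cx R0.
Proof.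
assert (HCx : 0 <= Cx).
{ assert (H := C0_gt0); assert (Hn := norm_ge_0 x).
  apply Rmult_le_pos; [lra|apply Rmult_le_pos; lra]. }
split; [exact HCx|].
exists (fun n p => kint sigma l (fun s => Nat.iter n (nh s) (minus x (hp p s x)))),
  (fun n => kint sigma l (fun s => Nat.iter n (nh s) (plus x (nh s x)))).
assert (Hok : forall n F, (forall s, 0 < s -> continuous F s) ->
  (forall s, 0 < s -> norm (F s) <= (1 + K) * norm x) ->
  chlint (fun s => scal (kap sigma l s) (Nat.iter n (nh s) (F s)))
    (kint sigma l (fun s => Nat.iter n (nh s) (F s))) /\
  norm (kint sigma l (fun s => Nat.iter n (nh s) (F s))) <= Cx * R0 ^ n).
{ intros n F HF HFb; replace (Cx * R0 ^ n) with (C0 * (R0 ^ n * ((1 + K) * norm x)))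
    by (unfold Cx; ring).
  apply kint_ok; intros s Hs; [apply iter_nh_cont; auto|].
  eapply Rle_trans; [apply (iter_nh_bdd n s Hs)|].
  apply Rmult_le_compat; [apply pow_le; lra|apply norm_ge_0| |auto].
  apply pow_incr; destruct R0_bounds; lra. }
assert (Hy : forall p, D p -> forall s, 0 < s -> continuous (fun s => minus x (hp p s x)) s /\
  norm (minus x (hp p s x)) <= (1 + K) * norm x).
{ intros p Hp s Hs; split.
  - apply (continuous_minus (V := X) (fun _ => x)); [apply continuous_const|].
    apply hp_cont; assumption.
  - eapply Rle_trans; [apply norm_minus_le|].
    assert (H := proj2 (proj2 (proj2 (hp_bdd p s Hp Hs))) x); lra. }
assert (Ha : forall s, 0 < s -> continuous (fun s => plus x (nh s x)) s /\
  norm (plus x (nh s x)) <= (1 + K) * norm x).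
{ intros s Hs; split.
  - apply (continuous_plus (V := X) (fun _ => x)); [apply continuous_const|].
    apply (iter_nh_cont 1 (fun _ => x) s Hs), continuous_const.
  - eapply Rle_trans; [apply norm_plus_le|].
    assert (H := proj2 (proj2 (proj2 (nh_bdd s Hs))) x); lra. }
assert (Oy := fun n p Hp => Hok n _ (fun s Hs => proj1 (Hy p Hp s Hs))
  (fun s Hs => proj2 (Hy p Hp s Hs))).
assert (Oa := fun n => Hok n _ (fun s Hs => proj1 (Ha s Hs)) (fun s Hs => proj2 (Ha s Hs))).
split; [reflexivity|split].
- intros n p Hp; apply kint_unique.
  generalize (chlint_plus X _ _ _ _ (proj1 (Oa n)) (chlint_scal X (d p) _ _ (proj1 (Oy (S n) p Hp)))).
  apply chlint_ext; intros s Hs.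
  destruct (iter_nh_bdd n s Hs) as [Hp1 [Hp2 _]].
  rewrite (hp_step p s Hp Hs) at 2.
  rewrite (Hp1 (plus x (nh s x)) (scal (d p) _)), Hp2, Nat.iter_succ_r; mring X.
- intros n p Hp; apply (Oy n p Hp).
Qed.

Lemma fint_minus_form (p : R * R) : D p ->
  fint (r * exp (fst p)) (phi1 + snd p) x =
  minus (scal c (kint sigma l (fun _ => x)))
    (scal c (kint sigma l (fun s => minus x (hp p s x)))).
Proof.
intros Hp; unfold fint.
assert (Hre : 0 < r * exp (fst p)) by (apply Rmult_lt_0_compat; [exact Hr|apply exp_pos]).
assert (H1 := proj1 (kint_ok (fun _ => x) (norm x)
  (fun s _ => continuous_const _ _) (fun s _ => Rle_refl _))).
assert (H2 := proj1 (fint_chlint (r * exp (fst p)) (phi1 + snd p) x Hre (proj2 (proj2 Hp)))).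
assert (H3 : kint sigma l (fun s => minus x (hp p s x)) =
  minus (kint sigma l (fun _ => x))
    (kint sigma l (fun s => hres A (pol (s * (r * exp (fst p))) (phi1 + snd p)) x))).
{ apply kint_unique; generalize (chlint_minus X _ _ _ _ H1 H2).
  apply chlint_ext; intros s Hs; unfold hp; mring X. }
rewrite H3; mring X.
Qed.

Lemma ua_mono (f : R * R -> X) (C R R' : R) : 0 <= R -> R <= R' ->
  ua D d f C R -> ua D d f C R'.
Proof.
intros HR HRR' [HC [F [a [F0 [FS Fb]]]]]; split; [exact HC|]; exists F, a.
split; [exact F0|split; [exact FS|]].
intros n p Hp; eapply Rle_trans; [apply Fb, Hp|].
apply Rmult_le_compat_l; [exact HC|apply pow_incr; lra].
Qed.

Lemma ua_ext (f g : R * R -> X) (C R : R) : (forall p, D p -> f p = g p) ->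
  ua D d f C R -> ua D d g C R.
Proof.
intros E [HC [F [a [F0 H]]]]; split; [exact HC|]; exists F, a; split; [|exact H].
intros p Hp; rewrite F0, E by exact Hp; reflexivity.
Qed.

(** Near the ray [phi1] the defect is assembled from [fint] and [(1 + d)^sigma], both expandable in
    [d]; it vanishes on the ray itself, and the identity theorem carries this to neighbouring
    angles. *)
Lemma defect_step (phi : R) : Rabs phi <= phi0 -> Rabs (phi - phi1) <= eta ->
  defect r phi x = zero.
Proof.
intros Hphi Hd.
destruct R1_props as [M [HM1 _]]; destruct R0_bounds as [HR0 HR24].
destruct eta_bounds as [He1 [He2 He3]].
set (T := fun p : R * R => fint (r * exp (fst p)) (phi1 + snd p) x).
assert (UT : exists C, ua D d T C R0).
{ assert (U1 := ua_const X _ D d (scal c (kint sigma l (fun _ => x))) R0 ltac:(lra)).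
  assert (U2 := ua_bdd X _ D d _ (fun y => scal c y) _ _ _
    (bdd_scal X 1 c _ (bdd_id X)) ua_kint).
  eexists; exact (ua_ext _ _ _ _ (fun p Hp => eq_sym (fint_minus_form p Hp))
    (ua_minus X _ D d _ _ _ _ _ U1 U2)). }
destruct UT as [CT UT].
set (l1 := fpt r phi1).
destruct (power_divided_differences sigma Hsigma) as [G [b [G0 [GS Gb]]]].
(* The point [fpt] at [(r e^u, phi1 + v)] is [l1 (1 + d)^sigma], which exhibits the second term of
   the defect as a product accessible to [ua_mult]. *)
assert (ED : forall p, D p ->
  minus (minus (T p) (R1 (T p))) (scal (G O p) (scal l1 (R1 (minus x (T p))))) =
  defect (r * exp (fst p)) (phi1 + snd p) x).
{ intros p Hp; unfold defect; fold (T p).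
  replace (fpt (r * exp (fst p)) (phi1 + snd p)) with (Cmult l1 (G O p)).
  - assert (E : R1 (minus x (T p)) = minus (R1 x) (R1 (T p))).
    { unfold minus; rewrite (proj1 HM1), (bdd_opp X _ R1 _ HM1); reflexivity. }
    rewrite E; mring X.
  - rewrite G0; unfold l1, fpt; rewrite pol_mult; f_equal; [|ring].
    rewrite <- Rpower_mult_distr by (try exact Hr; apply exp_pos).
    unfold Rpower at 3; rewrite ln_exp; ring. }
assert (UE : exists C, ua D d (fun p => defect (r * exp (fst p)) (phi1 + snd p) x) C (2 * R0)).
{ assert (U1 := ua_mono _ _ R0 (2 * R0) ltac:(lra) ltac:(lra)
    (ua_bdd X _ D d (1 + M) (fun y => minus y (R1 y)) T _ _
      (bdd_minus X _ _ _ _ (bdd_id X) HM1) UT)).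
  assert (U2 := ua_bdd X _ D d (Cmod l1 * M) (fun y => scal l1 (R1 y)) _ _ _
    (bdd_scal X _ l1 _ HM1)
    (ua_minus X _ D d _ _ _ _ _ (ua_const X _ D d x R0 ltac:(lra)) UT)).
  assert (U3 : ua D d (fun p => scal (G O p) (scal l1 (R1 (minus x (T p)))))
    (2 * 4 * (Cmod l1 * M * (norm x + CT))) (2 * R0)).
  { apply (ua_mult X _ D d (G O) G b 4 (fun p => scal l1 (R1 (minus x (T p))))
      (Cmod l1 * M * (norm x + CT)) R0); [lra|lra| | | | | |exact U2].
    - exists (0, 0); unfold D; simpl; rewrite Rabs_R0, Rplus_0_r; repeat split; lra.
    - reflexivity.
    - intros n p Hp; destruct (D_small p Hp); apply GS; assumption.
    - intros n p Hp; destruct (D_small p Hp) as [H1 H2].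
      eapply Rle_trans; [apply Gb; assumption|].
      apply Rmult_le_compat_l; [lra|apply pow_incr; lra].
    - intros p Hp; assert (H := d_small p Hp); assert (H1 := Cmod_ge_0 (d p)); nra. }
  eexists; exact (ua_ext _ _ _ _ ED (ua_minus X _ D d _ _ _ _ _ U1 U3)). }
destruct UE as [CE UE].
assert (Hp : D (0, phi - phi1)).
{ unfold D; simpl; rewrite Rabs_R0; replace (phi1 + (phi - phi1)) with phi by ring.
  repeat split; try assumption; lra. }
assert (HR2 : 0 <= 2 * R0) by lra.
assert (Z1 : defect (r * exp (fst (0, phi - phi1))) (phi1 + snd (0, phi - phi1)) x = zero).
{ refine (ua_identity X _ D d _ CE (2 * R0) UE HR2 _ (0, phi - phi1) Hp _).
  - intros e Hepos.
    (* The zeros accumulating at [d = 0] are taken on the ray itself, [v = 0], where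
       [|d| <= 2 u <= e / 2]. *)
    set (u := Rmin eta (e / 4)).
    assert (Hu1 : u <= eta) by apply Rmin_l; assert (Hu2 : u <= e / 4) by apply Rmin_r.
    assert (Hu0 : 0 < u) by (apply Rmin_glb_lt; lra).
    assert (Hu : Rabs u = u) by (apply Rabs_pos_eq; lra).
    exists (u, 0); split; [|split].
    + unfold D; simpl; rewrite Hu, Rabs_R0, Rplus_0_r; repeat split; lra.
    + split.
      * apply cpow_pt_neq; rewrite ?Rabs_R0; lra.
      * assert (H := cpow_pt_upper u 0 ltac:(lra)).
        rewrite Rabs_R0 in H; unfold d; lra.
    + simpl; rewrite Rplus_0_r; apply Hgood, Rmult_lt_0_compat; [exact Hr|apply exp_pos].
  - assert (H := d_small _ Hp); lra. }
simpl in Z1; rewrite exp_0, Rmult_1_r in Z1.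
replace (phi1 + (phi - phi1)) with phi in Z1 by ring; exact Z1.
Qed.

End Step.

(** [eta] depends neither on [r] nor on the ray, so finitely many steps of width [eta] reach every
    angle. The induction covers all [r] at once because a step uses other radii on the previous
    ray. *)
Lemma defect_zero (r phi : R) (x : X) : 0 < r -> Rabs phi <= phi0 -> defect r phi x = zero.
Proof.
set (eta := / (16 * Rmax K 24)).
assert (He : 0 < eta).
{ apply Rinv_0_lt_compat; generalize (Rmax_r K 24); lra. }
assert (Hind : forall (n : nat) r phi, 0 < r -> Rabs phi <= phi0 ->
  Rabs phi <= INR n * eta -> defect r phi x = zero).
{ induction n as [|n IH]; intros r' phi' Hr Hphi Hn.
  - simpl in Hn; rewrite Rmult_0_l in Hn.
    assert (E : phi' = 0) by (apply Rabs_eq_0, Rle_antisym; [exact Hn|apply Rabs_pos]).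
    rewrite E; apply defect_real_ray, Hr.
  - assert (Hnpos := pos_INR n).
    assert (Hmin : 0 <= Rmin phi0 (INR n * eta)).
    { apply Rmin_glb; [exact Hphi0|apply Rmult_le_pos; lra]. }
    (* The previous ray must satisfy the bound of the induction hypothesis and stay within [phi0],
       hence the minimum. *)
    destruct (clamp_exists (Rmin phi0 (INR n * eta)) phi' eta Hmin ltac:(lra)) as [psi [H1 H2]].
    + rewrite S_INR in Hn; unfold Rmin; destruct (Rle_dec phi0 (INR n * eta)); lra.
    + apply (defect_step r' psi x Hr).
      * eapply Rle_trans; [exact H1|apply Rmin_l].
      * intros r'' Hr''; apply IH; [exact Hr''| |];
          (eapply Rle_trans; [exact H1|]); [apply Rmin_l|apply Rmin_r].
      * exact Hphi.
      * exact H2. }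
intros Hr Hphi; destruct (archimed_cor1 (eta / (phi0 + 1))) as [N [HN1 HN2]].
{ apply Rdiv_lt_0_compat; lra. }
apply (Hind N); try assumption.
assert (HNpos : 0 < INR N) by (apply lt_0_INR; exact HN2).
apply (Rmult_lt_compat_l (INR N * (phi0 + 1))) in HN1; [|apply Rmult_lt_0_compat; lra].
replace (INR N * (phi0 + 1) * / INR N) with (phi0 + 1) in HN1 by (field; lra).
replace (INR N * (phi0 + 1) * (eta / (phi0 + 1))) with (INR N * eta) in HN1 by (field; lra).
lra.
Qed.

(** Resolvents of [A] commute with one another, hence with the integral that defines
    [(A^sigma + 1)^-1]. *)
Lemma resolv_R1_commute (s phi : R) (x : X) : 0 < s -> Rabs phi <= phi0 ->
  R1 (resolv A (pol s phi) x) = resolv A (pol s phi) (R1 x).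
Proof.
intros Hs Hphi.
destruct (HA s phi Hs Hphi) as [HB HS].
destruct (frac_power_resolvent 1 0 Rlt_0_1 win_0) as [_ [_ H]].
destruct (H x) as [J [HJ1 HJ2]].
destruct (H (resolv A (pol s phi) x)) as [J' [HJ1' HJ2']].
unfold R1; rewrite HJ2, HJ2', (proj1 (proj2 HB)); f_equal.
apply (chlint_unique X _ _ _ HJ1').
generalize (chlint_bdd X _ _ _ _ HB HJ1); apply chlint_ext; intros t Ht.
rewrite (proj1 (proj2 HB)); f_equal.
destruct (HA t 0 Ht) as [HBt HSt]; [rewrite Rabs_R0; exact Hphi0|].
rewrite pol_0 in HBt, HSt.
exact (resolvent_commute X A _ _ _ _ _ _ x HB HBt HS HSt).
Qed.

Lemma fint_R1_commute (r phi : R) (x : X) : 0 < r -> Rabs phi <= phi0 ->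
  fint r phi (R1 x) = R1 (fint r phi x).
Proof.
intros Hr Hphi; destruct R1_props as [M [HM _]].
unfold fint; rewrite (proj1 (proj2 HM)); f_equal; apply kint_unique.
generalize (chlint_bdd X _ _ _ _ HM (proj1 (fint_chlint r phi x Hr Hphi))).
apply chlint_ext; intros s Hs; rewrite (proj1 (proj2 HM)); f_equal.
unfold hres; rewrite (proj1 (proj2 HM)); f_equal.
apply resolv_R1_commute; [apply Rmult_lt_0_compat|]; assumption.
Qed.

(** With [t = fint r phi x], the vanishing defect reads [t = R1 (t + l' (x - t))]: so [t] lies in
    the domain and [(A^sigma + l') t = l' x]. That is the right inverse; the left one uses that
    [fint] commutes with [R1]. *)
Lemma fint_inverse (r phi : R) : 0 < r -> Rabs phi <= phi0 ->
  inverse_at As (fpt r phi) (fun x => scal (Cinv (fpt r phi)) (fint r phi x)).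
Proof.
intros Hr Hphi; destruct R1_props as [M [HM [HR HL]]].
assert (Hn := fpt_neq0 r phi); set (l' := fpt r phi) in *.
assert (HE : forall x, fint r phi x =
  R1 (plus (fint r phi x) (scal l' (minus x (fint r phi x))))).
{ intros x; assert (Z := defect_zero r phi x Hr Hphi); unfold defect in Z; fold l' in Z.
  transitivity (plus (fint r phi x) (opp (minus (minus (fint r phi x) (R1 (fint r phi x)))
    (scal l' (minus (R1 x) (R1 (fint r phi x))))))).
  - rewrite Z; mring X.
  - assert (E : R1 (minus x (fint r phi x)) = minus (R1 x) (R1 (fint r phi x))).
    { unfold minus; rewrite (proj1 HM), (bdd_opp X _ R1 _ HM); reflexivity. }
    rewrite (proj1 HM), (proj1 (proj2 HM)), E; mring X. }
split.
- intros x; set (t := fint r phi x).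
  destruct (HR (plus t (scal l' (minus x t)))) as [H1 H2].
  unfold t in H1, H2; rewrite <- (HE x) in H1, H2; fold t in H1, H2.
  split; [exact (dom_scal As _ t H1)|].
  assert (E0 : app As (scal (Cinv l') t) = scal (Cinv l') (app As t))
    by exact (app_scal As _ t H1).
  rewrite E0.
  assert (E : app As t = minus (plus t (scal l' (minus x t))) (scal (RtoC 1) t)).
  { rewrite <- H2; mring X. }
  rewrite E; mring_with X ltac:(try ring; try (field; exact Hn)).
(* Two expressions of [fint r phi x], one through [x = R1 (y + (1 - l') x)] and one through the
   defect, are compared. They give [R1 (fint r phi y) = R1 (l' x)], and [R1] is injective. *)
- intros x Hx; set (y := plus (app As x) (scal l' x)).
  assert (Ex : x = R1 (plus y (scal (Cminus (RtoC 1) l') x))).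
  { rewrite <- (HL x Hx) at 1; f_equal; unfold y; mring X. }
  assert (E1 : fint r phi x = plus (R1 (fint r phi y))
     (scal (Cminus (RtoC 1) l') (R1 (fint r phi x)))).
  { rewrite Ex at 1; rewrite fint_R1_commute by assumption.
    destruct (fint_bdd r phi Hr Hphi) as [F1 [F2 _]].
    rewrite F1, F2, (proj1 HM), (proj1 (proj2 HM)); reflexivity. }
  assert (E2 : fint r phi x = plus (scal (Cminus (RtoC 1) l') (R1 (fint r phi x)))
     (scal l' (R1 x))).
  { rewrite (HE x) at 1; unfold minus.
    rewrite (proj1 HM), (proj1 (proj2 HM)), (proj1 HM), (bdd_opp X _ R1 _ HM); mring X. }
  assert (E3 : R1 (fint r phi y) = R1 (scal l' x)).
  { rewrite (proj1 (proj2 HM)).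
    transitivity (minus (fint r phi x) (scal (Cminus (RtoC 1) l') (R1 (fint r phi x)))).
    - rewrite E1 at 1; mring X.
    - rewrite E2 at 1; mring X. }
  assert (E4 : fint r phi y = scal l' x).
  { rewrite <- (proj2 (HR (fint r phi y))), <- (proj2 (HR (scal l' x))), E3; reflexivity. }
  rewrite E4; mring_with X ltac:(try ring; try (field; exact Hn)).
Qed.

End FixedKernel.

End Continuation.

(** * Density of the domain *)

Section Density.

Variable X : CompleteNormedModule C_AbsRing.
Variables (A As : lin_op X) (phi0 K sigma : R).
Hypotheses (HK : 0 < K) (Hphi0 : 0 <= phi0) (HA : resolvents A phi0 K)
  (Hsigma : 0 < sigma < 1) (Has : is_frac_power A sigma As).

Let del : R := PI * (1 - sigma).

Lemma del_gt0 : 0 < del.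
Proof. apply Rmult_lt_0_compat; [apply PI_RGT_0|lra]. Qed.

Lemma zero_del : Rabs 0 <= PI * (1 - sigma) - del.
Proof. rewrite Rabs_R0; unfold del; lra. Qed.

Let g (s : R) : R :=
  / s * (Rpower s sigma / (Rpower s sigma ^ 2 + 2 * Rpower s sigma * cos (PI * sigma) + 1)).

Lemma g_den_pos (p : R) : 0 < p -> 0 < p ^ 2 + 2 * p * cos (PI * sigma) + 1.
Proof.
intros Hp; assert (HP := PI_RGT_0).
assert (H : -1 < cos (PI * sigma)).
{ rewrite <- cos_PI; apply cos_decreasing_1; nra. }
assert (0 <= (p - 1) ^ 2) by apply pow2_ge_0; nra.
Qed.

(** At [l = 1] the two factors of the denominator are complex conjugates, so the kernel is real. *)
Lemma kap_one (s : R) : 0 < s -> kap sigma (pol 1 0) s = RtoC (g s).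
Proof.
intros Hs; assert (Hp := Rpower_gt0 s sigma); assert (HD := g_den_pos _ Hp).
unfold kap, g; rewrite knl_den, !Rplus_0_l, pol_0.
set (p := Rpower s sigma) in *.
replace (Cmult (Cplus (RtoC p) (pol 1 (PI * sigma))) (Cplus (RtoC p) (pol 1 (- (PI * sigma)))))
  with (RtoC (p ^ 2 + 2 * p * cos (PI * sigma) + 1)).
- rewrite RtoC_mult, RtoC_div by lra; ring.
- assert (H := sin2_cos2' (PI * sigma)).
  apply C_ext; unfold Re, Im; simpl; rewrite cos_neg, sin_neg.
  + transitivity (p * p + 2 * p * cos (PI * sigma) +
      (sin (PI * sigma) * sin (PI * sigma) + cos (PI * sigma) * cos (PI * sigma)));
      [rewrite H; ring|ring].
  + ring.
Qed.

(** The total mass [gam] of the kernel is not computed; it is positive because [p^2 + 2 p cos (PI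
    sigma) + 1 <= (p + 1)^2] bounds the kernel below by [dens / sigma]. *)
Lemma kint_const : exists gam, 0 < gam /\
  forall x : X, kint sigma (pol 1 0) (fun _ => x) = scal (RtoC gam) x.
Proof.
assert (Hg : forall s, 0 < s -> 0 <= g s /\ g s <= kbd sigma del * dens sigma 1 s /\
   / sigma * dens sigma 1 s <= g s).
{ intros s Hs; assert (Hp := Rpower_gt0 s sigma); assert (HD := g_den_pos _ Hp).
  assert (Hc := COS_bound (PI * sigma)).
  assert (H0 : 0 <= g s).
  { unfold g; apply Rmult_le_pos; [left; apply Rinv_0_lt_compat, Hs|].
    left; apply Rdiv_lt_0_compat; assumption. }
  split; [exact H0|split].
  - rewrite <- (Rabs_pos_eq (g s)) by exact H0; rewrite <- Cmod_R, <- kap_one by exact Hs.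
    exact (kap_bound sigma del 1 0 Hsigma del_gt0 zero_del Rlt_0_1 s Hs).
  - unfold g, dens; set (p := Rpower s sigma) in *.
    apply Rle_trans with (/ s * (p / (p + 1) ^ 2)); [right; field; split; lra|].
    apply Rmult_le_compat_l; [left; apply Rinv_0_lt_compat, Hs|].
    apply Rmult_le_compat_l; [lra|apply Rinv_le_contravar; [exact HD|nra]]. }
destruct (hlint_exists sigma Hsigma R_CompleteNormedModule g (kbd sigma del) 1 Rlt_0_1)
  as [gam Hgam].
- intros s Hs.
  destruct (ccont_kap sigma del 1 0 Hsigma del_gt0 zero_del Rlt_0_1 s Hs) as [H _].
  apply (continuous_ext_loc g (fun s => Re (kap sigma (pol 1 0) s)) s); [|exact H].
  exists (mkposreal s Hs); intros t Ht.
  rewrite kap_one; [reflexivity|].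
  change (Rabs (t - s) < s) in Ht; apply Rabs_def2 in Ht; lra.
- intros s Hs; destruct (Hg s Hs) as [H1 [H2 _]].
  unfold norm; simpl; unfold abs; simpl; rewrite Rabs_pos_eq; assumption.
- exists gam; split.
  + assert (Hd : 0 < / sigma) by (apply Rinv_0_lt_compat; lra).
    assert (H := hlint_norm_le (V := R_NormedModule) (fun s => scal (/ sigma) (dens sigma 1 s)) g
      (scal (/ sigma) 1) gam).
    assert (N : norm (scal (/ sigma) 1 : R_NormedModule) <= gam).
    { apply H.
      - exact (is_RInt_gen_scal _ (/ sigma) 1 (hlint_dens sigma Hsigma 1 Rlt_0_1)).
      - exact Hgam.
      - intros s Hs; destruct (Hg s Hs) as [H1 [_ H3]].
        unfold norm, scal; simpl; unfold abs, mult; simpl; rewrite Rabs_pos_eq; [exact H3|].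
        apply Rmult_le_pos; [lra|left; apply (dens_gt0 sigma Hsigma); lra]. }
    unfold norm, scal in N; simpl in N; unfold abs, mult in N; simpl in N.
    rewrite Rmult_1_r, Rabs_pos_eq in N by lra; lra.
  + intros x; unfold kint; apply chlint_val_eq.
    generalize (chlint_const X g gam x Hgam); apply chlint_ext.
    intros s Hs; rewrite kap_one by exact Hs; reflexivity.
Qed.

(** Takes the place of dominated convergence as [r] tends to infinity. The half-line is split where
    [s^sigma = e]: below, [(s^sigma + e)^2 <= 4 e^2] makes the mass of order [e]; above,
    [1 / (s r) <= e^(- 1 / sigma) / r]. *)
Lemma dens_min_bound (e r s : R) : 0 < e -> 0 < r -> 0 < s ->
  dens sigma 1 s * Rmin 1 (/ (s * r)) <=
  4 * e * dens sigma e s + Rpower e (- / sigma) / r * dens sigma 1 s.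
Proof.
intros He Hr Hs; assert (Hp := Rpower_gt0 s sigma).
assert (H1 := dens_gt0 sigma Hsigma 1 s Rlt_0_1 Hs).
assert (He1 := dens_gt0 sigma Hsigma e s He Hs).
assert (Hq := Rpower_gt0 e (- / sigma)).
assert (Hqr : 0 < Rpower e (- / sigma) / r) by (apply Rdiv_lt_0_compat; assumption).
destruct (Rle_lt_dec (Rpower s sigma) e) as [H|H].
- apply Rle_trans with (dens sigma 1 s * 1);
    [apply Rmult_le_compat_l; [lra|apply Rmin_l]|].
  assert (dens sigma 1 s <= 4 * e * dens sigma e s).
  { unfold dens; set (p := Rpower s sigma) in *.
    apply Rle_trans with (sigma * p / s * / (p + 1) ^ 2); [right; field; split; lra|].
    apply Rle_trans with (sigma * p / s * (4 * e ^ 2 / (p + e) ^ 2)); [|right; field; split; lra].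
    apply Rmult_le_compat_l.
    - left; apply Rdiv_lt_0_compat; [apply Rmult_lt_0_compat; lra|exact Hs].
    - apply Rle_trans with 1.
      + rewrite <- Rinv_1; apply Rinv_le_contravar; nra.
      + assert (Hpe : 0 < (p + e) ^ 2) by (apply pow_lt; lra).
        apply (proj1 (Rle_div_r _ _ _ Hpe)); nra. }
  assert (0 <= Rpower e (- / sigma) / r * dens sigma 1 s) by (apply Rmult_le_pos; lra).
  lra.
- assert (Hs2 : / (s * r) <= Rpower e (- / sigma) / r).
  { assert (L : Rpower e (/ sigma) < Rpower (Rpower s sigma) (/ sigma)).
    { apply Rlt_Rpower_l; [apply Rinv_0_lt_compat; lra|lra]. }
    rewrite Rpower_mult, Rinv_r, Rpower_1 in L by lra.
    rewrite Rpower_Ropp, Rinv_mult; unfold Rdiv.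
    apply Rmult_le_compat_r; [left; apply Rinv_0_lt_compat, Hr|].
    apply Rinv_le_contravar; [apply Rpower_gt0|lra]. }
  apply Rle_trans with (dens sigma 1 s * (Rpower e (- / sigma) / r)).
  + apply Rmult_le_compat_l; [lra|].
    eapply Rle_trans; [apply Rmin_r|exact Hs2].
  + assert (0 <= 4 * e * dens sigma e s) by (apply Rmult_le_pos; lra); lra.
Qed.

(** For [x] in the domain, [w (A + w)^-1 x - x = - (A + w)^-1 A x] decays like [1 / |w|]; for small
    [|w|] the trivial bound takes over. *)
Lemma hres_near_id (r s : R) (x : X) : 0 < s -> 0 < r -> dom A x ->
  norm (minus (hres A (pol (s * r) 0) x) x) <=
  (K + 1) * (norm x + norm (app A x)) * Rmin 1 (/ (s * r)).
Proof.
intros Hs Hr Hx.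
assert (Hsr : 0 < s * r) by (apply Rmult_lt_0_compat; assumption).
assert (Z : Rabs 0 <= phi0) by (rewrite Rabs_R0; exact Hphi0).
assert (Nx := norm_ge_0 x); assert (NAx := norm_ge_0 (app A x)).
destruct (HA _ 0 Hsr Z) as [HB HS].
assert (B1 : norm (minus (hres A (pol (s * r) 0) x) x) <= (K + 1) * norm x).
{ eapply Rle_trans; [apply norm_minus_le|].
  assert (H := proj2 (proj2 (proj2 (hres_bdd X A phi0 K HA _ 0 Hsr Z))) x); lra. }
assert (B2 : norm (minus (hres A (pol (s * r) 0) x) x) <= K / (s * r) * norm (app A x)).
{ assert (E : minus (hres A (pol (s * r) 0) x) x = opp (resolv A (pol (s * r) 0) (app A x))).
  { assert (E0 := proj2 HS x Hx).
    rewrite (proj1 HB), (proj1 (proj2 HB)) in E0; unfold hres.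
    transitivity (minus (scal (pol (s * r) 0) (resolv A (pol (s * r) 0) x))
      (plus (resolv A (pol (s * r) 0) (app A x))
         (scal (pol (s * r) 0) (resolv A (pol (s * r) 0) x)))).
    - rewrite E0; reflexivity.
    - mring X. }
  rewrite E, norm_opp_eq; apply HB. }
assert (Hi : 0 < / (s * r)) by (apply Rinv_0_lt_compat, Hsr).
unfold Rmin; destruct (Rle_dec 1 (/ (s * r))) as [H|H].
- assert (0 <= (K + 1) * norm (app A x)) by (apply Rmult_le_pos; lra); lra.
- eapply Rle_trans; [exact B2|].
  apply Rle_trans with (K * norm (app A x) * / (s * r)); [right; unfold Rdiv; ring|].
  apply Rmult_le_compat_r; [lra|].
  assert (0 <= K * norm x) by (apply Rmult_le_pos; lra); lra.
Qed.

Lemma fint_limit (x : X) (eps : R) : dom A x -> 0 < eps ->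
  exists r, 0 < r /\
  norm (minus (kint sigma (pol 1 0) (fun s => hres A (pol (s * r) 0) x))
              (kint sigma (pol 1 0) (fun _ => x))) <= eps.
Proof.
intros Hx Heps.
set (B := (K + 1) * (norm x + norm (app A x)) + 1).
assert (HB : 0 < B).
{ assert (Nx := norm_ge_0 x); assert (NAx := norm_ge_0 (app A x)).
  assert (0 <= (K + 1) * (norm x + norm (app A x))) by (apply Rmult_le_pos; lra).
  unfold B; lra. }
set (k := kbd sigma del).
assert (Hk : 0 < k) by exact (kbd_gt0 sigma del 0 Hsigma del_gt0 zero_del).
assert (HkB : 0 < k * B) by (apply Rmult_lt_0_compat; assumption).
(* First [e] and then [r] are chosen so that each of the two terms of [dens_min_bound], multiplied
   by [k * B], integrates to [eps / 2]. *)
set (e := eps / (8 * (k * B))).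
assert (He : 0 < e) by (apply Rdiv_lt_0_compat; lra).
set (q := Rpower e (- / sigma)); assert (Hq : 0 < q) by apply Rpower_gt0.
set (r := 2 * (k * B) * q / eps).
assert (Hr : 0 < r).
{ apply Rdiv_lt_0_compat; [apply Rmult_lt_0_compat; lra|exact Heps]. }
exists r; split; [exact Hr|].
assert (Z : Rabs 0 <= phi0) by (rewrite Rabs_R0; exact Hphi0).
assert (H1 := proj1 (fint_chlint X A phi0 K sigma HK HA Hsigma del 1 0 del_gt0 zero_del
  Rlt_0_1 r 0 x Hr Z)).
assert (H2 := proj1 (kint_correct X sigma del 1 0 Hsigma del_gt0 zero_del Rlt_0_1
  (fun _ => x) (norm x) (fun s _ => continuous_const _ _) (fun s _ => Rle_refl _))).
assert (H3 := chlint_minus X _ _ _ _ H1 H2).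
assert (Hd1 := is_RInt_gen_scal (Fa := at_right 0) (Fb := Rbar_locally p_infty)
  _ (k * B * (4 * e)) _ (hlint_dens sigma Hsigma e He)).
assert (Hd2 := is_RInt_gen_scal (Fa := at_right 0) (Fb := Rbar_locally p_infty)
  _ (k * B * (q / r)) _ (hlint_dens sigma Hsigma 1 Rlt_0_1)).
assert (Hd := hlint_plus _ _ _ _ Hd1 Hd2).
assert (N := hlint_norm_le (V := restr_NormedModule X) _ _ _ _ H3 Hd).
eapply Rle_trans; [apply N|].
- intros s Hs.
  change (norm (minus (scal (kap sigma (pol 1 0) s) (hres A (pol (s * r) 0) x))
    (scal (kap sigma (pol 1 0) s) x)) <=
    k * B * (4 * e) * dens sigma e s + k * B * (q / r) * dens sigma 1 s).
  replace (minus (scal (kap sigma (pol 1 0) s) (hres A (pol (s * r) 0) x))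
    (scal (kap sigma (pol 1 0) s) x))
    with (scal (kap sigma (pol 1 0) s) (minus (hres A (pol (s * r) 0) x) x)) by mring X.
  rewrite norm_scal_eq.
  assert (K1 := kap_bound sigma del 1 0 Hsigma del_gt0 zero_del Rlt_0_1 s Hs); fold k in K1.
  assert (K2 := hres_near_id r s x Hs Hr Hx).
  assert (K3 := dens_min_bound e r s He Hr Hs); fold q in K3.
  assert (Hsr : 0 < / (s * r)) by (apply Rinv_0_lt_compat, Rmult_lt_0_compat; assumption).
  assert (Hm : 0 <= Rmin 1 (/ (s * r))) by (apply Rmin_glb; lra).
  apply Rle_trans with (k * dens sigma 1 s * (B * Rmin 1 (/ (s * r)))).
  + apply Rmult_le_compat; [apply Cmod_ge_0|apply norm_ge_0|exact K1|].
    eapply Rle_trans; [exact K2|]; apply Rmult_le_compat_r; [exact Hm|unfold B; lra].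
  + apply Rle_trans with (k * B * (dens sigma 1 s * Rmin 1 (/ (s * r)))); [right; ring|].
    apply Rle_trans with (k * B * (4 * e * dens sigma e s + q / r * dens sigma 1 s));
      [apply Rmult_le_compat_l; lra|right; ring].
- change (k * B * (4 * e) * 1 + k * B * (q / r) * 1 <= eps).
  right; unfold r, e; field; repeat split; lra.
Qed.

(* For [x] in the domain of [A], [t (A^sigma + t)^-1 x] tends to a positive
   multiple of [x] as [t] tends to infinity. *)
Lemma frac_power_dense : densely_defined A -> densely_defined As.
Proof.
intros Hd x eps.
destruct kint_const as [gam [Hgam Hconst]].
assert (He2 : 0 < eps / 2) by (generalize (cond_pos eps); lra).
destruct (Hd x (mkposreal _ He2)) as [y [Hy1 Hy2]]; simpl in Hy2.
assert (He3 : 0 < gam * (eps / 4)) by (apply Rmult_lt_0_compat; generalize (cond_pos eps); lra).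
destruct (fint_limit y _ Hy1 He3) as [r [Hr Hlim]].
set (t := kint sigma (pol 1 0) (fun s => hres A (pol (s * r) 0) y)) in *.
rewrite Hconst in Hlim.
assert (Hc : 0 < sin (PI * sigma) / PI).
{ assert (HP := PI_RGT_0); apply Rdiv_lt_0_compat; [|exact HP].
  apply sin_gt_0; [apply Rmult_lt_0_compat; lra|nra]. }
assert (Hc0 : RtoC (sin (PI * sigma) / PI) <> RtoC 0).
{ intros E; apply RtoC_inj in E; lra. }
assert (Hg0 : RtoC gam <> RtoC 0) by (intros E; apply RtoC_inj in E; lra).
(* Up to a nonzero factor, [t] is a value of the resolvent of [As]. *)
assert (Ht : dom As t).
{ assert (Z : Rabs 0 <= phi0) by (rewrite Rabs_R0; exact Hphi0).
  assert (HI := fint_inverse X A As phi0 K sigma HK Hphi0 HA Hsigma Has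
    del 1 0 del_gt0 zero_del Rlt_0_1 r 0 Hr Z).
  destruct (proj1 HI y) as [Hdom _].
  assert (Hn := fpt_neq0 sigma 1 0 Rlt_0_1 r 0).
  assert (Hdom2 := dom_scal As (Cmult (Cinv (RtoC (sin (PI * sigma) / PI))) (fpt sigma 1 0 r 0)) _ Hdom).
  assert (E : scal (Cmult (Cinv (RtoC (sin (PI * sigma) / PI))) (fpt sigma 1 0 r 0))
    (scal (Cinv (fpt sigma 1 0 r 0)) (fint X A sigma 1 0 r 0 y)) = t).
  { unfold fint; fold t; mring_with X ltac:(try ring; try (field; split; assumption)). }
  rewrite <- E; exact Hdom2. }
exists (scal (RtoC (/ gam)) t); split; [exact (dom_scal As _ t Ht)|].
assert (E : minus (scal (RtoC (/ gam)) t) x =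
  plus (scal (RtoC (/ gam)) (minus t (scal (RtoC gam) y))) (minus y x)).
{ rewrite RtoC_inv by lra; mring_with X ltac:(try ring; try (field; exact Hg0)). }
refine (Rle_lt_trans _ _ _ (Req_le _ _ (f_equal norm E)) _).
eapply Rle_lt_trans; [apply norm_plus_le|].
rewrite norm_scal_eq, Cmod_R, Rabs_pos_eq by (left; apply Rinv_0_lt_compat, Hgam).
assert (L : / gam * norm (minus t (scal (RtoC gam) y)) <= / gam * (gam * (eps / 4))).
{ apply Rmult_le_compat_l; [left; apply Rinv_0_lt_compat, Hgam|exact Hlim]. }
replace (/ gam * (gam * (eps / 4))) with (eps / 4) in L by (field; lra).
assert (Heps := cond_pos eps).
assert (Hy3 : norm (minus y x) < eps / 2) by exact Hy2.
lra.
Qed.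

End Density.

Section ClosedShift.

Variable X : CompleteNormedModule C_AbsRing.

(** The graph of [A + c] is the preimage of the graph of [A] under the continuous map
    [(x, y) -> (x, y - c x)]. *)
Lemma closed_op_shift (A : lin_op X) (c : C) : closed_op A -> closed_op (op_shift A c).
Proof.
intros H [x y] Hxy.
set (phi := fun p : X * X => (fst p, plus (snd p) (scal (Copp c) (fst p))) : X * X).
assert (Hl : is_linear (U := prod_NormedModule C_AbsRing X X)
  (V := prod_NormedModule C_AbsRing X X) phi).
{ apply (is_linear_prod (T := prod_NormedModule C_AbsRing X X) (U := X) (V := X)).
  - exact (is_linear_fst (U := X) (V := X)).
  - apply (is_linear_comp (U := prod_NormedModule C_AbsRing X X)
      (V := prod_NormedModule C_AbsRing X X) (W := X)
      (fun p => (snd p, scal (Copp c) (fst p))) (fun p => plus (fst p) (snd p))).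
    + apply (is_linear_prod (T := prod_NormedModule C_AbsRing X X) (U := X) (V := X)).
      * exact (is_linear_snd (U := X) (V := X)).
      * apply (is_linear_comp (U := prod_NormedModule C_AbsRing X X) (V := X) (W := X)
          (fun p => fst p) (fun z => scal (Copp c) z)).
        -- exact (is_linear_fst (U := X) (V := X)).
        -- exact (bdd_linear X _ _ (bdd_scal X 1 (Copp c) _ (bdd_id X))).
    + exact (is_linear_plus (V := X)). }
assert (G : dom A (fst (phi (x, y))) /\ snd (phi (x, y)) = app A (fst (phi (x, y)))).
{ apply H; intros Hloc; apply Hxy.
  generalize (linear_cont phi (x, y) Hl _ Hloc); unfold filtermap; apply filter_imp.
  intros [u v] Huv [H1 H2]; apply Huv; simpl in *; split; [exact H1|].
  rewrite H2; mring X. }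
destruct G as [G1 G2]; simpl in *; split; [exact G1|].
rewrite <- G2; mring X.
Qed.

End ClosedShift.

(** * R-bounds *)

Lemma finite_choice {T : Type} (t0 : T) (n : nat) (P : nat -> T -> Prop) :
  (forall k, (1 <= k <= n)%nat -> exists t, P k t) ->
  exists f, forall k, (1 <= k <= n)%nat -> P k (f k).
Proof.
induction n as [|n IH]; intros H.
- exists (fun _ => t0); intros k Hk; lia.
- destruct IH as [f Hf]; [intros k Hk; apply H; lia|].
  destruct (H (S n)) as [t Ht]; [lia|].
  exists (fun k => if Nat.eqb k (S n) then t else f k); intros k Hk.
  destruct (Nat.eqb_spec k (S n)) as [->|Hn]; [exact Ht|apply Hf; lia].
Qed.

Lemma nat_round (m : nat) (y : R) : 0 <= y <= INR m ->
  exists j, (j <= m)%nat /\ Rabs (y - INR j) <= 1.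
Proof.
induction m as [|m IH]; intros Hy.
- exists O; split; [lia|simpl in *; apply Rabs_le; lra].
- destruct (Rle_lt_dec y (INR m)) as [H|H].
  + destruct IH as [j [Hj1 Hj2]]; [lra|]; exists j; split; [lia|exact Hj2].
  + exists (S m); split; [lia|]; rewrite S_INR in *; apply Rabs_le; lra.
Qed.

Section RBounds.

Variable X : CompleteNormedModule C_AbsRing.

(** Terms with the same operator are grouped: a group is one bounded operator applied to the vectors
    multiplied by [0] or [1], which the contraction principle controls. There are [m + 1] groups. *)
Lemma rad_finite (n m : nat) (M : R) (B : nat -> X -> X) (j : nat -> nat) (x : nat -> X) :
  (forall i, (i <= m)%nat -> bdd M (B i)) -> 0 <= M ->
  (forall k, (1 <= k <= n)%nat -> (j k <= m)%nat) ->
  rad n (fun k => B (j k) (x k)) <= INR (S m) * M * rad n x.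
Proof.
intros HB HM Hj.
assert (H : forall q, (q <= S m)%nat ->
  rad n (fun k => if Nat.ltb (j k) q then B (j k) (x k) else zero) <= INR q * M * rad n x).
{ induction q as [|q IH]; intros Hq.
  - rewrite (rad_ext X n _ (fun k => scal (RtoC 0) (x k))).
    + eapply Rle_trans; [apply rad_scal|]; rewrite Cmod_0; simpl; lra.
    + intros k _; replace (Nat.ltb (j k) 0) with false by (symmetry; apply Nat.ltb_ge; lia).
      mring X.
  - rewrite (rad_ext X n _ (fun k => plus
      (if Nat.ltb (j k) q then B (j k) (x k) else zero)
      (B q (scal (RtoC (if Nat.eqb (j k) q then 1 else 0)) (x k))))).
    + eapply Rle_trans; [apply rad_plus|].
      rewrite S_INR, !Rmult_plus_distr_r, Rmult_1_l; apply Rplus_le_compat; [apply IH; lia|].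
      eapply Rle_trans; [apply (rad_map X n M); apply HB; lia|].
      apply Rmult_le_compat_l; [exact HM|].
      apply (rad_contraction_R X n (fun k => if Nat.eqb (j k) q then 1 else 0)).
      intros k _; destruct (Nat.eqb (j k) q); [rewrite Rabs_R1|rewrite Rabs_R0]; lra.
    + intros k _; assert (HBq : bdd M (B q)) by (apply HB; lia).
      rewrite (proj1 (proj2 HBq)).
      destruct (Nat.eqb_spec (j k) q) as [E|E].
      * replace (Nat.ltb (j k) (S q)) with true by (symmetry; apply Nat.ltb_lt; lia).
        replace (Nat.ltb (j k) q) with false by (symmetry; apply Nat.ltb_ge; lia).
        rewrite E; mring X.
      * replace (Nat.ltb (j k) (S q)) with (Nat.ltb (j k) q).
        -- destruct (Nat.ltb (j k) q); cbv iota; mring X.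
        -- destruct (Nat.ltb_spec (j k) q); symmetry;
             [apply Nat.ltb_lt|apply Nat.ltb_ge]; lia. }
rewrite (rad_ext X n _ (fun k => if Nat.ltb (j k) (S m) then B (j k) (x k) else zero)).
- apply H; lia.
- intros k Hk; replace (Nat.ltb (j k) (S m)) with true; [reflexivity|].
  symmetry; apply Nat.ltb_lt; generalize (Hj k Hk); lia.
Qed.

Definition hres_rbounded (A : lin_op X) (phi0 CR : R) : Prop :=
  forall n (s phi : nat -> R) (x : nat -> X),
    (forall k, (1 <= k <= n)%nat -> 0 < s k /\ Rabs (phi k) <= phi0) ->
    rad n (fun k => hres A (pol (s k) (phi k)) (x k)) <= CR * rad n x.

Lemma R_sectorial_hres (A : lin_op X) (theta : R) : 0 <= theta < PI ->
  R_sectorial theta A -> exists CR, 0 < CR /\ hres_rbounded A theta CR.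
Proof.
intros Ht [_ HR]; apply R_bounded_rad in HR; destruct HR as [_ [CR [HC HR]]].
exists CR; split; [exact HC|]; intros n s phi x H.
apply (HR n (fun k => hres A (pol (s k) (phi k)))); intros k Hk.
destruct (H k Hk) as [H1 H2]; exists (pol (s k) (phi k)); split; [|split].
- apply sector_pol; lra.
- apply pol_neq0, H1.
- reflexivity.
Qed.

(* [H(w) = w (A + w)^-1] satisfies [H(w) = (1 + d) H(w1) - d H(w1) H(w)] for
   [w = (1 + d) w1]; for small [d] the last term is absorbed on the left. *)
Lemma hres_rbounded_extend (A : lin_op X) (theta eps K CR : R) :
  0 <= theta -> 0 < eps -> eps <= 1 -> 0 < CR -> 4 * CR * eps <= 1 ->
  resolvents A (theta + eps) K -> hres_rbounded A theta CR ->
  hres_rbounded A (theta + eps) (8 * CR).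
Proof.
intros Ht He He1 HCR HCe HA HR n s phi x H.
destruct (finite_choice 0 n (fun k psi => Rabs psi <= theta /\ Rabs (phi k - psi) <= eps))
  as [psi Hpsi].
{ intros k Hk; apply clamp_exists; [exact Ht|lra|apply H, Hk]. }
set (y := fun k => hres A (pol (s k) (phi k)) (x k)).
set (d := fun k => Cminus (pol 1 (phi k - psi k)) (RtoC 1)).
assert (Hd : forall k, (1 <= k <= n)%nat -> Cmod (d k) <= eps).
{ intros k Hk; unfold d; rewrite <- (pol_0 1).
  eapply Rle_trans; [apply Cmod_pol_minus_le; lra|].
  rewrite Rmult_1_l, Rminus_0_r; apply Hpsi, Hk. }
assert (E : forall k, (1 <= k <= n)%nat -> y k =
  hres A (pol (s k) (psi k)) (minus (scal (Cplus (RtoC 1) (d k)) (x k)) (scal (d k) (y k)))).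
{ intros k Hk; destruct (H k Hk) as [H1 H2]; destruct (Hpsi k Hk) as [H3 H4].
  destruct (HA _ _ H1 H2) as [HB HS].
  destruct (HA (s k) (psi k) H1 ltac:(lra)) as [HB1 HS1].
  assert (I := resolvent_identity X A _ _ _ _ _ (x k) HB1 HS1 HS).
  assert (Ew : pol (s k) (phi k) = Cmult (pol (s k) (psi k)) (Cplus (RtoC 1) (d k))).
  { replace (Cplus (RtoC 1) (d k)) with (pol 1 (phi k - psi k)) by (unfold d; ring).
    rewrite pol_mult; f_equal; ring. }
  unfold y, hres; set (G1 := resolv A (pol (s k) (psi k))) in *.
  set (G := resolv A (pol (s k) (phi k))) in *.
  unfold minus; rewrite (proj1 HB1), (bdd_opp X _ G1 _ HB1), !(proj1 (proj2 HB1)), I, Ew.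
  mring X. }
(* [4] is twice the bound [2] for [|1 + d|], and [2 * eps] is twice the bound for [|d|]. Since
   [2 * CR * eps <= 1 / 2], half of [rad n y] is absorbed, whence [8 * CR]. *)
assert (B : rad n y <= CR * (4 * rad n x + 2 * eps * rad n y)).
{ rewrite (rad_ext X n y _ E) at 1.
  eapply Rle_trans.
  { apply HR; intros k Hk; split; [apply H, Hk|apply Hpsi, Hk]. }
  apply Rmult_le_compat_l; [lra|].
  rewrite (rad_ext X n _ (fun k => plus (scal (Cplus (RtoC 1) (d k)) (x k))
    (scal (Copp (d k)) (y k)))) by (intros k _; mring X).
  eapply Rle_trans; [apply rad_plus|]; apply Rplus_le_compat.
  - replace 4 with (2 * 2) by ring; apply rad_contraction; [lra|intros k Hk].
    eapply Rle_trans; [apply Cmod_triangle|]; rewrite Cmod_1; generalize (Hd k Hk); lra.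
  - apply rad_contraction; [exact He|intros k Hk]; rewrite Cmod_opp; apply Hd, Hk. }
assert (Hy := rad_ge0 X n y).
assert (CR * (2 * eps) * rad n y <= / 2 * rad n y).
{ apply Rmult_le_compat_r; lra. }
fold y; lra.
Qed.

(** * [R]-bounds for the continued operators *)

Section Transfer.

Variables (A As : lin_op X) (c0 phi0 K sigma CR del0 : R).
Hypotheses (Hc0 : 0 <= c0) (HK : 0 < K) (Hphi0 : 0 <= phi0)
  (HA : resolvents A phi0 K) (HA' : resolvents (op_shift A (RtoC c0)) phi0 K)
  (Hsigma : 0 < sigma < 1) (Has : is_frac_power A sigma As)
  (HCR : 0 < CR) (HR : hres_rbounded (op_shift A (RtoC c0)) phi0 CR)
  (Hdel0 : 0 < del0 <= PI * (1 - sigma)).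

Let A' := op_shift A (RtoC c0).
Let k0 : R := kbd sigma del0.
Let win (al : R) : Prop := Rabs al <= PI * (1 - sigma) - del0.

Lemma k0_gt0 : 0 < k0.
Proof. apply (kbd_gt0 sigma del0 0 Hsigma); [|rewrite Rabs_R0]; lra. Qed.

(** The radius [r] of [fint] is [1] from here on: the modulus of the spectral point is carried by
    [rho], and the ray only contributes to the angle. *)
Lemma kint_hres (B : lin_op X) (rho al phi : R) (x : X) : resolvents B phi0 K ->
  0 < rho -> win al -> Rabs phi <= phi0 ->
  chlint (fun s => scal (kap sigma (pol rho al) s) (hres B (pol (s * 1) phi) x))
    (kint sigma (pol rho al) (fun s => hres B (pol (s * 1) phi) x)).
Proof.
intros HB Hrho Hal Hphi.
exact (proj1 (fint_chlint X B phi0 K sigma HK HB Hsigma del0 rho al (proj1 Hdel0) Hal Hrho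
  1 phi x Rlt_0_1 Hphi)).
Qed.

Lemma kint_rescale (rho al : R) (F : R -> X) (J : X) : 0 < rho -> win al ->
  chlint (fun s => scal (kap sigma (pol rho al) s) (F s)) J ->
  chlint (fun u => scal (kap sigma (pol 1 al) u) (F (Rpower rho (/ sigma) * u))) J.
Proof.
intros Hrho Hal HJ; set (r := Rpower rho (/ sigma)).
assert (Hr : 0 < r) by apply Rpower_gt0.
apply (chlint_scale X _ _ r Hr) in HJ; revert HJ; apply chlint_ext; intros u Hu.
assert (E : knl sigma (pol rho al) (r * u) = knl sigma (pol 1 al) u).
{ rewrite <- (knl_scale sigma Hsigma del0 1 al r u (proj1 Hdel0) Hal Rlt_0_1 Hr Hu).
  unfold r; rewrite Rpower_mult, Rinv_l, Rpower_1, Rmult_1_r by lra; reflexivity. }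
unfold kap; rewrite E.
assert (Hr0 : RtoC r <> RtoC 0) by (intros E0; apply RtoC_inj in E0; lra).
assert (Hu0 : RtoC u <> RtoC 0) by (intros E0; apply RtoC_inj in E0; lra).
rewrite !RtoC_inv, RtoC_mult by nra.
mring_with X ltac:(try ring; try (field; split; assumption)).
Qed.

(** After rescaling, [rho k] survives only inside [hres], where the [R]-bound is uniform in the
    radius; the kernels are all dominated by [k0 * dens sigma 1]. *)
Lemma rad_kint_shift (n : nat) (rho al phi : nat -> R) (x : nat -> X) :
  (forall k, (1 <= k <= n)%nat -> 0 < rho k /\ win (al k) /\ Rabs (phi k) <= phi0) ->
  rad n (fun k => kint sigma (pol (rho k) (al k)) (fun s => hres A' (pol (s * 1) (phi k)) (x k)))
  <= 2 * k0 * CR * rad n x.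
Proof.
intros H; apply (rad_int X sigma n
  (fun k u => scal (kap sigma (pol 1 (al k)) u)
     (hres A' (pol (Rpower (rho k) (/ sigma) * u * 1) (phi k)) (x k))) _ _ 1 Hsigma Rlt_0_1).
- intros k Hk; destruct (H k Hk) as [H1 [H2 H3]].
  apply (kint_rescale (rho k) (al k) (fun s => hres A' (pol (s * 1) (phi k)) (x k)) _ H1 H2).
  exact (kint_hres A' _ _ _ (x k) HA' H1 H2 H3).
- intros u Hu.
  assert (Hd := dens_gt0 sigma Hsigma 1 u Rlt_0_1 Hu).
  assert (Hk0 := k0_gt0).
  eapply Rle_trans.
  { apply (rad_contraction X n (k0 * dens sigma 1 u));
      [apply Rmult_lt_0_compat; lra|intros k Hk]; destruct (H k Hk) as [H1 [H2 H3]].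
    exact (kap_bound sigma del0 1 (al k) Hsigma (proj1 Hdel0) H2 Rlt_0_1 u Hu). }
  apply Rle_trans with (2 * (k0 * dens sigma 1 u) * (CR * rad n x)); [|right; ring].
  apply Rmult_le_compat_l; [apply Rmult_le_pos; [lra|apply Rmult_le_pos; lra]|].
  apply HR; intros k Hk; destruct (H k Hk) as [H1 [H2 H3]]; split; [|exact H3].
  rewrite Rmult_1_r; apply Rmult_lt_0_compat; [apply Rpower_gt0|exact Hu].
Qed.

Definition hres_diff (w : C) (x : X) : X := minus (hres A w x) (hres A' w x).

(** The resolvent identity between [w] and [w + c0]; compared with [hres] itself, a factor of order
    [1 / |w|] is gained. *)
Lemma hres_diff_eq (s phi : R) (x : X) : 0 < s -> Rabs phi <= phi0 ->
  hres_diff (pol s phi) x = scal (RtoC c0) (resolv A (pol s phi) (hres A' (pol s phi) x)).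
Proof.
intros Hs Hphi; destruct (HA s phi Hs Hphi) as [HB HS].
destruct (HA' s phi Hs Hphi) as [HB' HS']; apply inverse_at_shift in HS'.
assert (E := resolvent_identity X A _ _ _ _ _ x HB HS HS').
unfold hres_diff, hres; fold A' in E.
rewrite (proj1 (proj2 HB)), E; mring X.
Qed.

(** [2 * K] bounds the difference for small [|w|], and [c0 * K^2 / |w|] for large [|w|]; the sum
    serves both. *)
Let Bd : R := 2 * K + c0 * (K * K).

Lemma Bd_gt0 : 0 < Bd.
Proof. assert (0 <= c0 * (K * K)) by (apply Rmult_le_pos; nra); unfold Bd; lra. Qed.

Lemma hres_diff_bdd (s phi : R) : 0 < s -> Rabs phi <= phi0 ->
  bdd (Bd * Rmin 1 (/ s)) (hres_diff (pol s phi)).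
Proof.
intros Hs Hphi; destruct (HA s phi Hs Hphi) as [HB HS].
assert (H1 := hres_bdd X A phi0 K HA s phi Hs Hphi).
assert (H2 := hres_bdd X A' phi0 K HA' s phi Hs Hphi).
destruct (bdd_minus X _ _ _ _ H1 H2) as [P1 [P2 [P3 P4]]].
assert (Hi : 0 < / s) by (apply Rinv_0_lt_compat, Hs).
assert (HBd := Bd_gt0).
split; [exact P1|split; [exact P2|split]].
- apply Rmult_le_pos; [lra|apply Rmin_glb; lra].
- intros x; assert (Nx := norm_ge_0 x).
  assert (Q := Rmult_le_pos _ _ Hc0 (Rmult_le_pos _ _ (Rlt_le _ _ HK) (Rlt_le _ _ HK))).
  unfold Rmin; destruct (Rle_dec 1 (/ s)).
  + eapply Rle_trans; [apply P4|].
    apply Rmult_le_compat_r; [exact Nx|unfold Bd; lra].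
  + rewrite hres_diff_eq by assumption.
    rewrite norm_scal_eq, Cmod_R, Rabs_pos_eq by exact Hc0.
    apply Rle_trans with (c0 * (K / s * (K * norm x))).
    * apply Rmult_le_compat_l; [exact Hc0|].
      eapply Rle_trans; [apply HB|]; apply Rmult_le_compat_l; [apply HB|apply H2].
    * replace (c0 * (K / s * (K * norm x))) with (c0 * (K * K) * / s * norm x)
        by (unfold Rdiv; ring).
      apply Rmult_le_compat_r; [exact Nx|].
      apply Rmult_le_compat_r; [lra|unfold Bd; lra].
Qed.

(** For [rho >= 1], [rho / (p + rho)^2 <= 1 / (p + 1)]. This common bound is not integrable at
    infinity; the missing factor of order [1 / (p + 1)] is the decay of [hres_diff], through
    [Rmin_inv_bound]. *)
Lemma dens_large (rho s : R) : 1 <= rho -> 0 < s ->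
  dens sigma rho s <= sigma * Rpower s sigma / (s * (Rpower s sigma + 1)).
Proof.
intros Hrho Hs; unfold dens; assert (Hp := Rpower_gt0 s sigma).
set (p := Rpower s sigma) in *.
apply Rle_trans with (sigma * p / s * (rho / (p + rho) ^ 2)); [right; field; lra|].
apply Rle_trans with (sigma * p / s * / (p + 1)); [|right; field; lra].
apply Rmult_le_compat_l.
- left; apply Rdiv_lt_0_compat; [apply Rmult_lt_0_compat; lra|exact Hs].
- assert (H1 : 0 < (p + rho) ^ 2) by (apply pow_lt; lra).
  apply (proj2 (Rle_div_l _ _ _ H1)).
  replace (/ (p + 1) * (p + rho) ^ 2) with ((p + rho) ^ 2 / (p + 1)) by (unfold Rdiv; ring).
  apply (proj1 (Rle_div_r _ _ (p + 1) ltac:(lra))); nra.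
Qed.

Lemma Rmin_inv_bound (s : R) : 0 < s -> Rmin 1 (/ s) <= 2 / (Rpower s sigma + 1).
Proof.
intros Hs; assert (Hp := Rpower_gt0 s sigma).
apply (proj1 (Rle_div_r _ _ (Rpower s sigma + 1) ltac:(lra))).
destruct (Rle_lt_dec s 1) as [H|H].
- assert (L : Rpower s sigma <= Rpower 1 sigma) by (apply Rle_Rpower_l; lra).
  unfold Rpower at 2 in L; rewrite ln_1, Rmult_0_r, exp_0 in L.
  assert (Rmin 1 (/ s) <= 1) by apply Rmin_l; nra.
- assert (L : Rpower s sigma <= Rpower s 1) by (apply Rle_Rpower; lra).
  rewrite Rpower_1 in L by exact Hs.
  assert (H1 : Rmin 1 (/ s) <= / s) by apply Rmin_r.
  assert (H2 : / s * (Rpower s sigma + 1) <= / s * (2 * s)).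
  { apply Rmult_le_compat_l; [left; apply Rinv_0_lt_compat, Hs|lra]. }
  replace (/ s * (2 * s)) with 2 in H2 by (field; lra).
  assert (H3 := Rmult_le_compat_r (Rpower s sigma + 1) _ _ ltac:(lra) H1); lra.
Qed.

(* For fixed [s] only finitely many operators occur, whatever the [rho k] are,
   and [dens rho s] is bounded uniformly in [rho >= 1]. *)
Lemma rad_kint_diff (n m : nat) (ray : nat -> R) (j : nat -> nat) (rho al : nat -> R)
    (x : nat -> X) :
  (forall i, (i <= m)%nat -> Rabs (ray i) <= phi0) ->
  (forall k, (1 <= k <= n)%nat -> 1 <= rho k /\ win (al k) /\ (j k <= m)%nat) ->
  rad n (fun k => minus
     (kint sigma (pol (rho k) (al k)) (fun s => hres A (pol (s * 1) (ray (j k))) (x k)))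
     (kint sigma (pol (rho k) (al k)) (fun s => hres A' (pol (s * 1) (ray (j k))) (x k))))
  <= 4 * k0 * (INR (S m) * Bd) * rad n x.
Proof.
intros Hray H; apply (rad_int X sigma n
  (fun k s => scal (kap sigma (pol (rho k) (al k)) s)
     (hres_diff (pol s (ray (j k))) (x k))) _ _ 1 Hsigma Rlt_0_1).
- intros k Hk; destruct (H k Hk) as [H1 [H2 H3]].
  generalize (chlint_minus X _ _ _ _
    (kint_hres A (rho k) _ _ (x k) HA ltac:(lra) H2 (Hray _ H3))
    (kint_hres A' (rho k) _ _ (x k) HA' ltac:(lra) H2 (Hray _ H3))).
  apply chlint_ext; intros s Hs; rewrite Rmult_1_r; unfold hres_diff; mring X.
- intros s Hs; assert (Hp := Rpower_gt0 s sigma).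
  set (e := sigma * Rpower s sigma / (s * (Rpower s sigma + 1))).
  assert (He : 0 < e).
  { apply Rdiv_lt_0_compat; [|apply Rmult_lt_0_compat; lra].
    apply Rmult_lt_0_compat; lra. }
  assert (Hk0 := k0_gt0).
  eapply Rle_trans.
  { apply (rad_contraction X n (k0 * e));
      [apply Rmult_lt_0_compat; lra|intros k Hk]; destruct (H k Hk) as [H1 [H2 H3]].
    eapply Rle_trans;
      [exact (kap_bound sigma del0 (rho k) (al k) Hsigma (proj1 Hdel0) H2 ltac:(lra) s Hs)|].
    apply Rmult_le_compat_l; [lra|apply dens_large; assumption]. }
  assert (Hmin : 0 <= Rmin 1 (/ s)).
  { apply Rmin_glb; [lra|left; apply Rinv_0_lt_compat, Hs]. }
  assert (HBd := Bd_gt0).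
  assert (F := rad_finite n m (Bd * Rmin 1 (/ s)) (fun i => hres_diff (pol s (ray i))) j x
    (fun i Hi => hres_diff_bdd s (ray i) Hs (Hray i Hi))
    (Rmult_le_pos _ _ (Rlt_le _ _ HBd) Hmin) (fun k Hk => proj2 (proj2 (H k Hk)))).
  assert (HS : 0 < INR (S m)) by (apply lt_0_INR; lia).
  assert (Hrx := rad_ge0 X n x).
  apply Rle_trans with (2 * (k0 * e) * (INR (S m) * (Bd * (2 / (Rpower s sigma + 1))) * rad n x)).
  + apply Rmult_le_compat_l; [apply Rmult_le_pos; [lra|apply Rmult_le_pos; lra]|].
    eapply Rle_trans; [exact F|]; apply Rmult_le_compat_r; [exact Hrx|].
    apply Rmult_le_compat_l; [lra|]; apply Rmult_le_compat_l; [lra|apply Rmin_inv_bound, Hs].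
  + right; unfold e, dens; field; lra.
Qed.

Lemma rad_fint (n m : nat) (ray : nat -> R) (j : nat -> nat) (rho al : nat -> R)
    (x : nat -> X) :
  (forall i, (i <= m)%nat -> Rabs (ray i) <= phi0) ->
  (forall k, (1 <= k <= n)%nat ->
     0 < rho k /\ win (al k) /\ (j k <= m)%nat /\ (c0 <> 0 -> 1 <= rho k)) ->
  rad n (fun k => fint X A sigma (rho k) (al k) 1 (ray (j k)) (x k)) <=
  Rabs (sin (PI * sigma) / PI) * (2 * k0 * CR + 4 * k0 * (INR (S m) * Bd)) * rad n x.
Proof.
intros Hray H; assert (Hk0 := k0_gt0); unfold fint.
eapply Rle_trans; [apply rad_scal|]; rewrite Cmod_R, Rmult_assoc.
apply Rmult_le_compat_l; [apply Rabs_pos|].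
assert (HBd := Bd_gt0); assert (HS : 0 < INR (S m)) by (apply lt_0_INR; lia).
assert (Hrx := rad_ge0 X n x).
assert (S1 := rad_kint_shift n rho al (fun k => ray (j k)) x
  (fun k Hk => conj (proj1 (H k Hk)) (conj (proj1 (proj2 (H k Hk)))
     (Hray _ (proj1 (proj2 (proj2 (H k Hk)))))))).
destruct (Req_dec c0 0) as [E|E].
(* For [c0 = 0] the resolvents of [A] and [A'] agree, so the first estimate alone covers all moduli;
   this is why no shift of [A^sigma] occurs in that case. *)
- rewrite (rad_ext X n _ (fun k => kint sigma (pol (rho k) (al k))
    (fun s => hres A' (pol (s * 1) (ray (j k))) (x k)))).
  + eapply Rle_trans; [exact S1|]; apply Rmult_le_compat_r; [exact Hrx|].
    assert (0 <= 4 * k0 * (INR (S m) * Bd)); [|lra].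
    apply Rmult_le_pos; [lra|apply Rmult_le_pos; lra].
  + intros k Hk; destruct (H k Hk) as [H1 [H2 [H3 _]]].
    apply chlint_val_eq.
    generalize (kint_hres A' _ _ _ (x k) HA' H1 H2 (Hray _ H3)).
    apply chlint_ext; intros s Hs; f_equal.
    assert (D := hres_diff_eq (s * 1) (ray (j k)) (x k) ltac:(lra) (Hray _ H3)).
    unfold hres_diff in D; rewrite E in D.
    transitivity (minus (hres A (pol (s * 1) (ray (j k))) (x k))
      (minus (hres A (pol (s * 1) (ray (j k))) (x k)) (hres A' (pol (s * 1) (ray (j k))) (x k))));
      [mring X|]; rewrite D; mring X.
- assert (S2 := rad_kint_diff n m ray j rho al x Hray
    (fun k Hk => conj (proj2 (proj2 (proj2 (H k Hk))) E) (conj (proj1 (proj2 (H k Hk)))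
       (proj1 (proj2 (proj2 (H k Hk))))))).
  rewrite (rad_ext X n _ (fun k => plus
    (kint sigma (pol (rho k) (al k)) (fun s => hres A' (pol (s * 1) (ray (j k))) (x k)))
    (minus (kint sigma (pol (rho k) (al k)) (fun s => hres A (pol (s * 1) (ray (j k))) (x k)))
      (kint sigma (pol (rho k) (al k)) (fun s => hres A' (pol (s * 1) (ray (j k))) (x k))))))
    by (intros k _; mring X).
  eapply Rle_trans; [apply rad_plus|]; lra.
Qed.

End Transfer.

End RBounds.

(** * Conclusion *)

Lemma finite_net (phi0 eps : R) : 0 < phi0 -> 0 < eps ->
  exists (m : nat) (ray : nat -> R),
    (forall i, (i <= m)%nat -> Rabs (ray i) <= phi0) /\
    forall t, Rabs t <= phi0 -> exists j, (j <= m)%nat /\ Rabs (t - ray j) <= eps.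
Proof.
intros Hp He; destruct (archimed_cor1 (eps / (2 * phi0))) as [m [Hm1 Hm2]].
{ apply Rdiv_lt_0_compat; lra. }
assert (Hm : 0 < INR m) by (apply lt_0_INR; exact Hm2).
assert (Hstep : 2 * phi0 / INR m <= eps).
{ apply (Rmult_lt_compat_l (2 * phi0)) in Hm1; [|lra].
  replace (2 * phi0 * (eps / (2 * phi0))) with eps in Hm1 by (field; lra).
  unfold Rdiv; lra. }
exists m, (fun i => - phi0 + 2 * phi0 * (INR i / INR m)); split.
- intros i Hi; apply le_INR in Hi; assert (H := pos_INR i).
  assert (H1 : 0 <= INR i / INR m <= 1).
  { split; [apply (proj1 (Rle_div_r _ _ _ Hm))|apply (proj2 (Rle_div_l _ _ _ Hm))]; lra. }
  apply Rabs_le; nra.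
- intros t Ht; apply Rabs_le_between in Ht.
  destruct (nat_round m ((t + phi0) / (2 * phi0) * INR m)) as [j [Hj1 Hj2]].
  + assert (H1 : 0 <= (t + phi0) / (2 * phi0) <= 1).
    { split; [apply (proj1 (Rle_div_r _ _ (2 * phi0) ltac:(lra)))|
              apply (proj2 (Rle_div_l _ _ (2 * phi0) ltac:(lra)))]; lra. }
    nra.
  + exists j; split; [exact Hj1|].
    replace (t - (- phi0 + 2 * phi0 * (INR j / INR m)))
      with (2 * phi0 / INR m * ((t + phi0) / (2 * phi0) * INR m - INR j)) by (field; lra).
    assert (H2 : 0 < 2 * phi0 / INR m) by (apply Rdiv_lt_0_compat; lra).
    rewrite Rabs_mult, (Rabs_pos_eq (2 * phi0 / INR m)) by lra; nra.
Qed.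

Lemma resolvents_weaken (X : CompleteNormedModule C_AbsRing) (A : lin_op X) (phi K K' : R) :
  K <= K' -> resolvents A phi K -> resolvents A phi K'.
Proof.
intros H HA s t Hs Ht; destruct (HA s t Hs Ht) as [HB HS]; split; [|exact HS].
apply (bdd_weaken X _ _ _ HB); apply Rmult_le_compat_r;
  [left; apply Rinv_0_lt_compat, Hs|exact H].
Qed.

Section Conclusion.

Variable X : CompleteNormedModule C_AbsRing.
Variables (A As : lin_op X) (theta c0 eps K sigma CR : R).
Hypotheses (Htheta : 0 <= theta < PI) (Hc0 : 0 <= c0) (Heps : 0 < eps) (HK : 0 < K)
  (Hsigma : 0 < sigma < 1) (Heps1 : eps <= PI * (1 - sigma))
  (HA : resolvents A (theta + eps) K)
  (HA' : resolvents (op_shift A (RtoC c0)) (theta + eps) K)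
  (Hdense : densely_defined A)
  (Has : is_frac_power A sigma As) (HCR : 0 < CR)
  (HR : hres_rbounded X (op_shift A (RtoC c0)) (theta + eps) CR).

Let theta' : R := PI - (PI - theta) * sigma.
(** The constant in [|l + c|^2 >= kappa (|l| + c)^2] on the sector. *)
Let kappa : R := (1 + cos theta') / 2.
Let del0 : R := sigma * eps / 2.
(** With [c = 1 / kappa], [|l + c|^2 >= kappa c^2 = 1 / kappa >= 1], which is the range of moduli
    required by [rad_kint_diff]. *)
Let c : R := if Req_dec_T c0 0 then 0 else / kappa.

Lemma theta'_bounds : 0 <= theta' < PI.
Proof.
unfold theta'; assert (HP := PI_RGT_0).
assert (0 < (PI - theta) * sigma) by (apply Rmult_lt_0_compat; lra).
assert ((PI - theta) * sigma <= PI * 1) by (apply Rmult_le_compat; lra); lra.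
Qed.

Lemma kappa_bounds : 0 < kappa <= 1.
Proof.
destruct theta'_bounds as [H1 H2]; assert (H := COS_bound theta').
assert (-1 < cos theta') by (rewrite <- cos_PI; apply cos_decreasing_1; lra).
unfold kappa; lra.
Qed.

Lemma c_ge0 : 0 <= c.
Proof.
unfold c; destruct (Req_dec_T c0 0); [lra|].
left; apply Rinv_0_lt_compat, kappa_bounds.
Qed.

Lemma shifted_point (l : C) : sector theta' l -> l <> RtoC 0 ->
  let l' := Cplus l (RtoC c) in
  l' <> RtoC 0 /\ Rabs (Carg l') <= theta' /\ Cmod l / Cmod l' <= / kappa /\
  (c0 <> 0 -> 1 <= Cmod l').
Proof.
intros Hl Hn l'; destruct kappa_bounds as [Hk1 Hk2]; assert (Hc := c_ge0).
destruct (sector_add_pos theta' c l theta'_bounds Hl Hn Hc) as [Hn' Hs'].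
assert (Hlow := Cmod_add_pos_lower theta' c l theta'_bounds Hl Hn Hc); fold kappa l' in Hlow.
assert (Hm := Cmod_ge_0 l); assert (Hm' := proj1 (Cmod_gt_0 l') Hn').
split; [exact Hn'|split; [apply (sector_Carg _ _ Hs' Hn')|split]].
- apply (proj2 (Rle_div_l _ _ _ Hm')).
  assert (H : kappa * Cmod l <= Cmod l').
  { apply le_of_sq_le; [lra|].
    apply Rle_trans with (kappa * (Cmod l + c) ^ 2); [|exact Hlow].
    assert (0 <= Cmod l * c) by (apply Rmult_le_pos; assumption).
    assert (kappa * kappa <= kappa) by nra.
    assert (0 <= c ^ 2) by apply pow2_ge_0.
    assert (0 <= Cmod l ^ 2) by apply pow2_ge_0.
    assert (Cmod l ^ 2 <= (Cmod l + c) ^ 2) by nra.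
    rewrite Rpow_mult_distr; nra. }
  apply (Rmult_le_compat_l (/ kappa)) in H; [|left; apply Rinv_0_lt_compat, Hk1].
  rewrite <- Rmult_assoc, Rinv_l, Rmult_1_l in H by lra; exact H.
- intros H0; apply le_of_sq_le; [lra|].
  eapply Rle_trans; [|exact Hlow].
  assert (Ec : c = / kappa) by (unfold c; destruct (Req_dec_T c0 0); [contradiction|reflexivity]).
  rewrite Ec.
  assert (Hki : 1 <= / kappa) by (rewrite <- Rinv_1 at 1; apply Rinv_le_contravar; lra).
  apply Rle_trans with (kappa * (/ kappa) ^ 2).
  + replace (kappa * (/ kappa) ^ 2) with (/ kappa) by (field; lra); lra.
  + apply Rmult_le_compat_l; [lra|apply pow_incr; lra].
Qed.

Lemma frac_power_R_sectorial : R_sectorial theta' (op_shift As (RtoC c)).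
Proof.
destruct kappa_bounds as [Hk1 Hk2].
assert (Hphi0 : 0 < theta + eps) by lra.
assert (He2 : 0 < eps / 2) by lra.
destruct (finite_net (theta + eps) (eps / 2) Hphi0 He2) as [m [ray [Hray Hnet]]].
assert (Hdel0 : 0 < del0).
{ unfold del0; assert (0 < sigma * eps) by (apply Rmult_lt_0_compat; lra); lra. }
set (win := fun al => Rabs al <= PI * (1 - sigma) - del0).
assert (Hse : sigma * eps <= PI * (1 - sigma)).
{ assert (sigma * eps <= 1 * eps) by (apply Rmult_le_compat_r; lra); lra. }
(* [theta' = sigma (theta + eps) + (PI (1 - sigma) - sigma eps)]: the angle is split accordingly,
   and the first part, divided by [sigma], is rounded to a ray of the net. Rounding uses up
   [sigma * eps / 2] of the gain [sigma * eps]; the margin [del0] is what remains. *)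
assert (Hgrid : forall al, Rabs al <= theta' ->
  exists j, (j <= m)%nat /\ win (al - sigma * ray j)).
{ intros al Hal.
  destruct (clamp_exists (sigma * (theta + eps)) al (PI * (1 - sigma) - sigma * eps))
    as [t [Ht1 Ht2]].
  - apply Rmult_le_pos; lra.
  - lra.
  - unfold theta' in Hal; lra.
  - destruct (Hnet (t / sigma)) as [j [Hj1 Hj2]].
    + unfold Rdiv; rewrite Rabs_mult, (Rabs_pos_eq (/ sigma))
        by (left; apply Rinv_0_lt_compat; lra).
      apply (proj2 (Rle_div_l _ _ sigma ltac:(lra))); lra.
    + exists j; split; [exact Hj1|]; unfold win, del0.
      replace (al - sigma * ray j) with ((al - t) + sigma * (t / sigma - ray j)) by (field; lra).
      eapply Rle_trans; [apply Rabs_triang|].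
      rewrite Rabs_mult, (Rabs_pos_eq sigma) by lra.
      assert (sigma * Rabs (t / sigma - ray j) <= sigma * (eps / 2))
        by (apply Rmult_le_compat_l; lra).
      lra. }
assert (Hdel1 : del0 <= PI * (1 - sigma)) by (unfold del0; lra).
set (k0 := kbd sigma del0).
assert (Hk0 : 0 < k0) by exact (k0_gt0 sigma del0 Hsigma (conj Hdel0 Hdel1)).
set (M := Cmod (RtoC (sin (PI * sigma) / PI)) * (k0 * K)).
assert (HM : 0 <= M) by (apply Rmult_le_pos; [apply Cmod_ge_0|apply Rmult_le_pos; lra]).
assert (Hres : forall l : C, sector theta' l -> l <> RtoC 0 ->
  exists al j, win al /\ (j <= m)%nat /\
    let l' := Cplus l (RtoC c) in
    let S := fun x => scal (Cinv l') (fint X A sigma (Cmod l') al 1 (ray j) x) in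
    inverse_at (op_shift As (RtoC c)) l S /\ bdd (/ Cmod l' * M) S).
{ intros l Hl Hn; destruct (shifted_point l Hl Hn) as [Hn' [Harg _]].
  set (l' := Cplus l (RtoC c)) in *.
  destruct (Hgrid (Carg l') Harg) as [j [Hj Hwin]].
  set (al := Carg l' - sigma * ray j) in *.
  exists al, j; split; [exact Hwin|split; [exact Hj|]]; intros l'' S; fold l' in l''.
  assert (Hm' := proj1 (Cmod_gt_0 l') Hn').
  assert (El : fpt sigma (Cmod l') al 1 (ray j) = l').
  { unfold fpt, Rpower; rewrite ln_1, Rmult_0_r, exp_0, Rmult_1_r.
    replace (al + sigma * ray j) with (Carg l') by (unfold al; ring).
    symmetry; apply polar_form, Hn'. }
  split.
  - apply inverse_at_shift; fold l'.
    assert (HI := fint_inverse X A As (theta + eps) K sigma HK (Rlt_le _ _ Hphi0) HA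
      Hsigma Has del0 (Cmod l') al Hdel0 Hwin Hm' 1 (ray j) Rlt_0_1 (Hray j Hj)).
    rewrite El in HI; exact HI.
  - unfold S, l''; rewrite <- Cmod_inv by exact Hn'.
    apply (bdd_scal X M (Cinv l') (fint X A sigma (Cmod l') al 1 (ray j))).
    exact (fint_bdd X A (theta + eps) K sigma HK HA Hsigma del0 _ al Hdel0 Hwin Hm'
      1 (ray j) Rlt_0_1 (Hray j Hj)). }
split.
- split; [apply closed_op_shift, Has|split; [|split]].
  + exact (frac_power_dense X A As (theta + eps) K sigma HK (Rlt_le _ _ Hphi0) HA Hsigma Has Hdense).
  + intros l Hl Hn; destruct (Hres l Hl Hn) as [al [j [_ [_ [H1 H2]]]]].
    exact (resolvent_set_intro X _ l _ _ H2 H1).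
  + exists (Rmax 1 (/ kappa * M)); split; [apply Rmax_l|]; intros l Hl Hn.
    destruct (Hres l Hl Hn) as [al [j [_ [_ [H1 H2]]]]].
    destruct (shifted_point l Hl Hn) as [Hn' [_ [Hq _]]].
    set (l' := Cplus l (RtoC c)) in *; assert (Hm' := proj1 (Cmod_gt_0 l') Hn').
    destruct (resolv_intro X _ l _ _ H2 H1) as [H3 _].
    assert (H4 := proj1 (op_norm_le X _ _ H3)).
    apply Rle_trans with (/ kappa * M); [|apply Rmax_r].
    apply Rle_trans with (Cmod l * (/ Cmod l' * M)).
    * apply Rmult_le_compat_l; [apply Cmod_ge_0|exact H4].
    * rewrite <- Rmult_assoc; apply Rmult_le_compat_r; [exact HM|exact Hq].
- apply R_bounded_rad; split.
  + intros T [l [Hl [Hn ->]]]; destruct (Hres l Hl Hn) as [al [j [_ [_ [H1 H2]]]]].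
    destruct (resolv_intro X _ l _ _ H2 H1) as [H3 _].
    exact (bdd_linear X _ _ (bdd_scal X _ l _ H3)).
  + set (Bd := 2 * K + c0 * (K * K)).
    assert (HBd : 0 < Bd).
    { assert (0 <= c0 * (K * K)) by (apply Rmult_le_pos; nra); unfold Bd; lra. }
    set (Q := Rabs (sin (PI * sigma) / PI) * (2 * k0 * CR + 4 * k0 * (INR (S m) * Bd))).
    assert (HSm : 0 < INR (S m)) by (apply lt_0_INR; lia).
    assert (HQ : 0 <= Q).
    { apply Rmult_le_pos; [apply Rabs_pos|].
      assert (0 < k0 * CR) by (apply Rmult_lt_0_compat; lra).
      assert (0 < k0 * (INR (S m) * Bd)) by (apply Rmult_lt_0_compat; [|apply Rmult_lt_0_compat]; lra).
      lra. }
    assert (Hki : 0 < / kappa) by (apply Rinv_0_lt_compat, Hk1).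
    (* Each operator is [l / l'] times some [fint]. The scalars are bounded by [/ kappa], the [2] is
       that of the complex contraction principle, and [+ 1] ensures positivity. *)
    exists (2 * / kappa * Q + 1); split.
    { assert (0 <= 2 * / kappa * Q) by (apply Rmult_le_pos; lra); lra. }
    intros n T x HT.
    destruct (finite_choice (RtoC 0, (0, O)) n (fun k (p : C * (R * nat)) =>
      let l := fst p in let al := fst (snd p) in let j := snd (snd p) in
      let l' := Cplus l (RtoC c) in
      (l' <> RtoC 0 /\ Cmod l / Cmod l' <= / kappa /\ (c0 <> 0 -> 1 <= Cmod l')) /\
      win al /\ (j <= m)%nat /\
      forall y, T k y = scal (Cdiv l l') (fint X A sigma (Cmod l') al 1 (ray j) y)))
      as [f Hf].
    { intros k Hk; destruct (HT k Hk) as [l [Hl [Hn HTk]]].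
      destruct (Hres l Hl Hn) as [al [j [H1 [H2 [H3 _]]]]].
      destruct (shifted_point l Hl Hn) as [Hn' [_ [Hq Hq2]]].
      exists (l, (al, j)); simpl; repeat split; try assumption.
      intros y; rewrite HTk, (op_inv_inverse X _ _ _ _ H3); cbv beta.
      mring_with X ltac:(unfold Cdiv; ring). }
    set (l := fun k => fst (f k)); set (al := fun k => fst (snd (f k))).
    set (j := fun k => snd (snd (f k))); set (l' := fun k => Cplus (l k) (RtoC c)).
    rewrite (rad_ext X n _ (fun k => scal (Cdiv (l k) (l' k))
      (fint X A sigma (Cmod (l' k)) (al k) 1 (ray (j k)) (x k))))
      by (intros k Hk; apply Hf, Hk).
    assert (Hrx := rad_ge0 X n x).
    assert (HF : rad n (fun k => fint X A sigma (Cmod (l' k)) (al k) 1 (ray (j k)) (x k))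
      <= Q * rad n x).
    { apply (rad_fint X A c0 (theta + eps) K sigma CR del0); try assumption; try (split; assumption).
      intros k Hk; destruct (Hf k Hk) as [[H1 [_ H2]] [H3 [H4 _]]].
      split; [exact (proj1 (Cmod_gt_0 _) H1)|split; [exact H3|split; [exact H4|exact H2]]]. }
    apply Rle_trans with (2 * / kappa * (Q * rad n x)).
    * eapply Rle_trans.
      { apply (rad_contraction X n (/ kappa)); [exact Hki|intros k Hk].
        destruct (Hf k Hk) as [[H1 [H2 _]] _].
        unfold l'; rewrite Cmod_div by exact H1; exact H2. }
      apply Rmult_le_compat_l; [lra|exact HF].
    * lra.
Qed.

End Conclusion.

Theorem theorem1p1 (X0 : CompleteNormedModule C_AbsRing) (theta : R)
    (A : lin_op X0) (c0 : R) :
  0 <= theta < PI ->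
  sectorial theta A ->
  0 <= c0 ->
  R_sectorial theta (op_shift A (RtoC c0)) ->
  forall sigma : R, 0 < sigma < 1 ->
  forall As : lin_op X0, is_frac_power A sigma As ->
  exists c : R, 0 <= c /\ (c0 = 0 -> c = 0) /\
    R_sectorial (PI - (PI - theta) * sigma) (op_shift As (RtoC c)).
Proof.
intros Ht HA Hc0 HAR sigma Hs As Has.
destruct (sectorial_resolvents X0 A theta Ht HA) as [K1 [HK1 R1]].
destruct (sectorial_resolvents X0 _ theta Ht (proj1 HAR)) as [K2 [HK2 R2]].
destruct (R_sectorial_hres X0 _ theta Ht HAR) as [CR [HCR HR]].
set (K := Rmax K1 K2).
assert (HK : 1 <= K) by (eapply Rle_trans; [exact HK1|apply Rmax_l]).
apply (resolvents_weaken X0 A _ _ K (Rmax_l _ _)) in R1.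
apply (resolvents_weaken X0 _ _ _ K (Rmax_r _ _)) in R2.
assert (HP := PI_RGT_0).
(* The four bounds serve, in order, the Neumann extension of the resolvents, the absorption in the
   [R]-bound, the estimate [|1 + d| <= 2] there, and the nonnegativity of
   [PI (1 - sigma) - sigma eps]. *)
set (eps := Rmin (Rmin (/ (2 * K)) (/ (4 * CR))) (Rmin 1 (PI * (1 - sigma)))).
assert (He : 0 < eps).
{ repeat apply Rmin_glb_lt; try lra; try (apply Rinv_0_lt_compat; lra).
  apply Rmult_lt_0_compat; lra. }
assert (He1 : eps <= / (2 * K)) by (eapply Rle_trans; apply Rmin_l).
assert (He2 : eps <= / (4 * CR)) by (eapply Rle_trans; [apply Rmin_l|apply Rmin_r]).
assert (He3 : eps <= 1) by (eapply Rle_trans; [apply Rmin_r|apply Rmin_l]).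
assert (He4 : eps <= PI * (1 - sigma)) by (eapply Rle_trans; apply Rmin_r).
assert (HeK : eps * K <= / 2).
{ apply (Rmult_le_compat_r K) in He1; [|lra].
  replace (/ (2 * K) * K) with (/ 2) in He1 by (field; lra); exact He1. }
assert (HeC : 4 * CR * eps <= 1).
{ apply (Rmult_le_compat_l (4 * CR)) in He2; [|lra].
  rewrite Rinv_r in He2 by lra; exact He2. }
apply (resolvents_extend X0 A theta K eps) in R1; try lra.
apply (resolvents_extend X0 _ theta K eps) in R2; try lra.
assert (HR' := hres_rbounded_extend X0 _ theta eps (2 * K) CR (proj1 Ht) He
  He3 HCR HeC R2 HR).
set (kappa := (1 + cos (PI - (PI - theta) * sigma)) / 2).
exists (if Req_dec_T c0 0 then 0 else / kappa); split; [|split].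
- exact (c_ge0 theta c0 sigma Ht Hs).
- intros E; destruct (Req_dec_T c0 0); [reflexivity|contradiction].
- apply (frac_power_R_sectorial X0 A As theta c0 eps (2 * K) sigma (8 * CR)); try assumption; try lra.
  apply HA.
Qed.
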